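(* Let $C:f=0$ be a reduced plane curve of degree $d$ in $X=\mathbb{P}^2$ over $\mathbb{C}$, set $r=\mathrm{mdr}(f)$ with $r\ge 1$, let $\rho_1\in AR(f)_r$ be a nonzero syzygy and consider the associated subscheme $Z(C,\rho_1)$ of $X$. If $2r\le d-1$, then any line $L$ in $\mathbb{P}^2$ which meets the support of $Z(C,\rho_1)$ is a jumping line. More precisely, the splitting type of $E_C$ along $L$ is $(r-m_L,\,d-1-r+m_L)$ or, equivalently, the order of the jumping line $L$ is given by $o(L)=m_L\le r$. Moreover, the set of jumping lines $V_{r-1}(C)$ is a line arrangement consisting of at most $\nu(C)$ lines, dual to the support of the subscheme $Z(C,\rho_1)$.
   Context: $S=\mathbb{C}[x,y,z]$ with the usual grading; for a graded module $M$, $M(m)_k=M_{m+k}$; $f\in S_d$ is the reduced homogeneous equation of $C$; $f_x,f_y,f_z$ are its partial derivatives. $AR(f)\subset S^3$ is the graded $S$-module with $AR(f)_k=\{(a,b,c)\in S_k^3: af_x+bf_y+cf_z=0\}$ and $\mathrm{mdr}(f)=\min\{k: AR(f)_k\neq 0\}$. $E_C=\widetilde{AR(f)}$ is the associated rank two vector bundle on $X$. For a line $L$, the splitting type of $E_C$ along $L$ is the pair of integers $d_1^L\le d_2^L$ with $E_C|_L\simeq\mathcal{O}_L(-d_1^L)\oplus\mathcal{O}_L(-d_2^L)$; for a generic line $L_0$ the pair $(d_1^{L_0},d_2^{L_0})$ is constant. $L$ is a jumping line of order $o(L)=d_1^{L_0}-d_1^L$ if $o(L)>0$. $V_k(C)=\{L\in\mathbb{P}(S_1):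 d_1^L\le k\}$, where lines $L:\alpha_L=0$ are identified with points $\alpha_L$ of the dual plane $\mathbb{P}(S_1)$; the line in $\mathbb{P}(S_1)$ dual to a point $p\in X$ consists of all lines through $p$. Given a nonzero $\rho_1=(a_1,b_1,c_1)\in AR(f)_r$, for $\rho=(a,b,c)\in AR(f)_m$ let $\Delta(\rho)$ be the determinant of the $3\times3$ matrix with rows $(x,y,z)$, $(a_1,b_1,c_1)$, $(a,b,c)$; it is divisible by $f$, and $v:AR(f)\to S(r-d+1)$ is the graded morphism $v(\rho)=\Delta(\rho)/f$. The homogeneous ideal $B(C,\rho_1)\subset S$ is defined by $\mathrm{im}\,v=B(C,\rho_1)(r-d+1)$, and $Z(C,\rho_1)=V(B(C,\rho_1))\subset X$ is the subscheme it defines, of dimension at most $0$ and locally a complete intersection; $|Z(C,\rho_1)|$ is its support and $\mathcal{I}\subset\mathcal{O}_X$ its ideal sheaf. For a line $L$ with $L\cap|Z(C,\rho_1)|=\{p_1,\dots,p_s\}$, take at $p_k$ local (analytic) coordinates $(u,v)$ centered at $p_k$ with $L:u=0$, write $\mathcal{I}_{p_k}=(g(u,v),h(u,v))\subset\mathbb{C}\{u,v\}$, and set $m_k=\dim_{\mathbb{C}}\mathbb{C}\{u,v\}/(u,g(u,v),h(u,v))$; then $m_L=\sum_{k=1}^s m_k$ (the length of the scheme-theoretic intersection $Z(C,\rho_1)\cap L$). $J_f=(f_x,f_y,f_z)$, $\widehat{J}_f$ is its saturation with respect to $(x,y,z)$, $N(f)=\widehat{J}_f/J_f$, and $\nu(C)=\dim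 N(f)_{\lfloor T/2\rfloor}$ with $T=3(d-2)$. *)

(* Defs.v *)
From HB Require Import structures.
From mathcomp Require Import all_boot all_order all_algebra.
From mathcomp Require Import complex mpoly functions reals.

Set Implicit Arguments.
Unset Strict Implicit.
Unset Printing Implicit Defensive.

Import Order.TTheory GRing.Theory Num.Theory.
Local Open Scope ring_scope.
Local Open Scope complex_scope.

(* Points of X = P^2 are nonzero row vectors p : 'rV[C]_3 up to scaling; lines  *)
(* are nonzero linear forms alpha in S_1 up to scaling.  Notions whose value is *)
(* a number which exists and is unique for mathematical reasons (mdr(f),        *)
(* splitting types, m_L, dimensions, ...) are rendered as predicates on that    *)
(* number.                                                                      *)

(* For subspaces A and I of V, A / (A inter I) has finite dimension n over K. *)
Definition quot_dim (K : fieldType) (V : lmodType K) (A I : V -> Prop)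
    (n : nat) : Prop :=
  exists e : 'I_n -> V,
    [/\ forall i, A (e i),
        forall a, A a -> exists c : 'I_n -> K, I (a - \sum_i c i *: e i)
      & forall c : 'I_n -> K, I (\sum_i c i *: e i) -> forall i, c i = 0].

Section Plane.
Variable R : realType.
Local Notation C := R[i].
Local Notation S := {mpoly C[3]}.

(* p is homogeneous of degree k, for an integer k; S_k = 0 for k < 0. *)
Definition homogz (k : int) (p : S) : Prop :=
  if k is Posz n then p \is n.-homog else p = 0.

(* The graded S-module whose degree k part is the quotient of the subgroup      *)
(* [gdeg k] of an ambient S-module by its subgroup [gnul k].                    *)
Record gmod := GMod {
  gcar : lmodType S;
  gdeg : int -> gcar -> Prop;
  gnul : int -> gcar -> Prop
}.

Definition gself : gmod :=
  @GMod (S^o : lmodType S) homogz (fun _ p => p = 0).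

(* M(m)_k = M_{m+k} *)
Definition gshift (M : gmod) (m : int) : gmod :=
  @GMod (gcar M) (fun k => @gdeg M (m + k)) (fun k => @gnul M (m + k)).

Definition gsum (M N : gmod) : gmod :=
  @GMod (gcar M * gcar N)%type
    (fun k x => gdeg k x.1 /\ gdeg k x.2)
    (fun k x => gnul k x.1 /\ gnul k x.2).

(* M / alpha M for alpha of degree 1; its associated sheaf is the restriction   *)
(* of the sheaf associated with M to the line alpha = 0, seen as a sheaf on X   *)
(* (supported on that line).                                                    *)
Definition grestr (alpha : S) (M : gmod) : gmod :=
  @GMod (gcar M) (@gdeg M)
    (fun k v => exists2 w : gcar M,
       gdeg (k - 1) w & gnul k (v - alpha *: w)).

(* Sections over D_+(g), g homogeneous of degree e > 0, of the sheaf associated *)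
(* with M are the elements of degree 0 of the localization M_g.  The pair (x, k) *)
(* stands for the fraction x / g^k.                                             *)
Section Sections.
Variables (M : gmod) (e : nat) (g : S).
Implicit Types s t : gcar M * nat.

Definition is_sec s : Prop := gdeg (s.2 * e)%N%:Z s.1.

Definition sec_eq s t : Prop :=
  exists j : nat, gnul ((j + s.2 + t.2) * e)%N%:Z
    (g ^+ j *: (g ^+ t.2 *: s.1 - g ^+ s.2 *: t.1)).

Definition sec_add s t : gcar M * nat :=
  (g ^+ t.2 *: s.1 + g ^+ s.2 *: t.1, (s.2 + t.2)%N).

(* the product of the function a / g^l on D_+(g) and the section s *)
Definition sec_scale (a : S) (l : nat) s : gcar M * nat :=
  (a *: s.1, (l + s.2)%N).

(* restriction from D_+(g) to D_+(g h): x / g^k = h^k x / (g h)^k *)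
Definition sec_res (h : S) s : gcar M * nat := (h ^+ s.2 *: s.1, s.2).

End Sections.

(* The sheaves of O_X-modules associated with M and N are isomorphic: there are *)
(* isomorphisms between their sections over the basic open sets D_+(g), linear  *)
(* over the functions on D_+(g) and compatible with restrictions.               *)
Definition sheaf_iso (M N : gmod) : Prop :=
  exists phi : S -> gcar M * nat -> gcar N * nat,
    forall (e : nat) (g : S), (0 < e)%N -> g != 0 -> g \is e.-homog ->
    [/\ forall s, is_sec e s -> is_sec e (phi g s),
        forall s t, is_sec e s -> is_sec e t ->
          (sec_eq e g s t <-> sec_eq e g (phi g s) (phi g t))
      & forall t, is_sec e t ->
          exists2 s, is_sec e s & sec_eq e g (phi g s) t] /\
    [/\ forall s t, is_sec e s -> is_sec e t ->
          sec_eq e g (phi g (sec_add g s t)) (sec_add g (phi g s) (phi g t)),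
        forall (a : S) (l : nat) s, a \is (l * e)%N.-homog -> is_sec e s ->
          sec_eq e g (phi g (sec_scale a l s)) (sec_scale a l (phi g s))
      & forall (e' : nat) (h : S) s,
          (0 < e')%N -> h != 0 -> h \is e'.-homog -> is_sec e s ->
          sec_eq (e + e') (g * h)
            (phi (g * h) (sec_res h s)) (sec_res h (phi g s))].

Definition reduced_form (d : nat) (f : S) : Prop :=
  [/\ f \is d.-homog, f != 0
    & forall g h : S, f = g ^+ 2 * h -> (msize g <= 1)%N].

Definition syz (f : S) (rho : 'rV[S]_3) : Prop :=
  \sum_(i < 3) rho 0 i * f^`M(i) = 0.

(* AR(f)_k *)
Definition AR (f : S) (k : int) (rho : 'rV[S]_3) : Prop :=
  (forall i, homogz k (rho 0 i)) /\ syz f rho.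

Definition ARmod (f : S) : gmod :=
  @GMod 'rV[S]_3 (AR f) (fun _ rho => rho = 0).

Definition is_mdr (f : S) (r : nat) : Prop :=
  (exists2 rho, rho != 0 & AR f r%:Z rho) /\
  (forall (k : nat) rho, (k < r)%N -> AR f k%:Z rho -> rho = 0).

Definition is_line (alpha : S) : Prop := alpha != 0 /\ alpha \is 1.-homog.

(* E_C restricted to the line L is isomorphic to O_L(-d1) + O_L(-d2). *)
Definition splitting_type (f alpha : S) (d1 d2 : int) : Prop :=
  d1 <= d2 /\
  sheaf_iso (grestr alpha (ARmod f))
    (gsum (gshift (grestr alpha gself) (- d1))
          (gshift (grestr alpha gself) (- d2))).

(* Generic lines: those in some nonempty Zariski open subset of P(S_1). *)
Definition generic_splitting_type (f : S) (d1 d2 : int) : Prop :=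
  exists (n : nat) (Phi : S), [/\ Phi \is n.-homog, Phi != 0
    & forall alpha, is_line alpha -> Phi.@[fun i => alpha@_(U_(i))] != 0 ->
        splitting_type f alpha d1 d2].

Definition line_order (f alpha : S) (o : int) : Prop :=
  exists e1 e2 d1 d2 : int,
    [/\ generic_splitting_type f e1 e2, splitting_type f alpha d1 d2
      & o = e1 - d1].

Definition jumping_line (f alpha : S) : Prop :=
  is_line alpha /\ exists2 o : int, line_order f alpha o & 0 < o.

Definition Vlines (f : S) (k : int) (alpha : S) : Prop :=
  is_line alpha /\
  exists d1 d2 : int, splitting_type f alpha d1 d2 /\ d1 <= k.

Definition Delta (rho1 rho : 'rV[S]_3) : S :=
  \det (\matrix_(i < 3) tnth [tuple \row_j 'X_j; rho1; rho] i).

(* B(C, rho1): all quotients Delta(rho) / f, for rho in AR(f) *)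
Definition Bideal (f : S) (rho1 : 'rV[S]_3) (g : S) : Prop :=
  exists2 rho, syz f rho & Delta rho1 rho = g * f.

Definition in_supp (f : S) (rho1 : 'rV[S]_3) (p : 'rV[C]_3) : Prop :=
  p != 0 /\ forall g, Bideal f rho1 g -> g.@[p 0] = 0.

Definition on_line (alpha : S) (p : 'rV[C]_3) : Prop := alpha.@[p 0] = 0.

Definition same_point (p q : 'rV[C]_3) : Prop := exists2 c : C, c != 0 & p = c *: q.

(* Power series in u = 'X_0 and v = 'X_1, given by their coefficients. *)
Local Notation pseries := ('X_{1..2} -> C).

(* membership in C{u,v} *)
Definition convergent (a : pseries) : Prop :=
  exists A b : C, forall m, `|a m| <= A * b ^+ mdeg m.

Definition ps_mul (a b : pseries) : pseries :=
  fun m => \sum_(k : 'X_{1..2 < (mdeg m).+1} | (bmnm k <= m)%MM)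
             a (bmnm k) * b (m - bmnm k)%MM.

Definition ps_poly (P : {mpoly C[2]}) : pseries := fun m => P@_m.

(* the ideal of C{u,v} generated by the elements of G *)
Definition ps_ideal (G : pseries -> Prop) (a : pseries) : Prop :=
  exists (n : nat) (c g : 'I_n -> pseries),
    [/\ forall i, convergent (c i), forall i, G (g i)
      & forall m, a m = \sum_i ps_mul (c i) (g i) m].

(* For an invertible matrix Q with rows p, q1, q2, the local coordinates (u, v) *)
(* centered at p given by (u, v) |-> [p + u q1 + v q2].                         *)
Definition chart (Q : 'M[C]_3) : 3.-tuple {mpoly C[2]} :=
  [tuple (Q 0 i)%:MP + Q 1 i *: 'X_0 + Q 2 i *: 'X_1 | i < 3].

(* The stalk at p of the ideal sheaf of Z(C, rho1) is generated by the germs of *)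
(* the elements of B(C, rho1).  Writing it as (g, h), the ideal below is        *)
(* (u, g, h).                                                                   *)
Definition mult_ideal (f : S) (rho1 : 'rV[S]_3) (Q : 'M[C]_3) : pseries -> Prop :=
  ps_ideal (fun a => a = ps_poly 'X_0 \/
    exists2 g, Bideal f rho1 g & a = ps_poly (g \mPo chart Q)).

(* m_k at the point p; as p and q2 are on L, which is thus given by u = 0. *)
Definition local_mult (f : S) (rho1 : 'rV[S]_3) (alpha : S) (p : 'rV[C]_3)
    (n : nat) : Prop :=
  exists Q : 'M[C]_3,
    [/\ Q \in unitmx, row 0 Q = p, on_line alpha (row 0 Q),
        on_line alpha (row 2 Q)
      & quot_dim convergent (mult_ideal f rho1 Q) n].

Definition line_mult (f : S) (rho1 : 'rV[S]_3) (alpha : S) (m : nat) : Prop :=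
  exists (s : nat) (p : 'I_s -> 'rV[C]_3) (mk : 'I_s -> nat),
    [/\ forall k l, same_point (p k) (p l) -> k = l,
        forall q, in_supp f rho1 q /\ on_line alpha q <->
                  exists k, same_point q (p k),
        forall k, local_mult f rho1 alpha (p k) (mk k)
      & m = (\sum_k mk k)%N].

Definition Jacobian_ideal (f g : S) : Prop :=
  exists a : 'I_3 -> S, g = \sum_i a i * f^`M(i).

Definition saturated_Jacobian_ideal (f g : S) : Prop :=
  exists N : nat, forall m : 'X_{1..3}, mdeg m = N ->
    Jacobian_ideal f ('X_[m] * g).

Definition dim_N (f : S) (k n : nat) : Prop :=
  quot_dim (fun g : S => g \is k.-homog /\ saturated_Jacobian_ideal f g)
    (Jacobian_ideal f) n.

(* for d >= 2, as the subtraction is truncated *)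
Definition is_nu (d : nat) (f : S) (n : nat) : Prop :=
  dim_N f (3 * (d - 2))./2 n.

End Plane.

(* Main.v *)
Require Import Defs.
From HB Require Import structures.
From mathcomp Require Import all_boot all_order all_algebra.
From mathcomp Require Import separable complex mpoly functions reals boolp ring lra zify.

Set Implicit Arguments.
Unset Strict Implicit.
Unset Printing Implicit Defensive.

Import Order.TTheory GRing.Theory Num.Theory.
Local Open Scope ring_scope.

(** Since [f] is reduced, the cross product of two syzygies [rho1] and [rho] is a
    multiple [omega rho1 rho] of [grad f], and [Delta rho1 rho] is
    [d * omega rho1 rho * f]; hence [B(C, rho1)] is spanned by the forms
    [omega rho1 rho].  On a line [L], let [b] be the greatest common divisor of
    the restrictions of these forms, and [m] its degree.  The Plücker relations
    show that [rho1] restricts to [b] times a section [tau] of degree [r - m],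
    and that [tau] has a complement of degree [d - 1 - r + m]: this splits [E_C]
    along [L].  The splitting type is well defined because a section over the
    chart [y <> 0] of [L] is compared with one over [x <> 0] through a power of
    [y / x].  At a point of [L] the restriction of the ideal of [Z(C, rho1)] is
    generated by [b], so [m = m_L] by Weierstrass division.

    For the bound by [nu(C)], let the line [l = 0] avoid the common zeros of
    [rho1], which has no common factor by minimality of [r].  Given [n] points of
    [Z(C, rho1)], let [h] be a product of [n - 1] lines through all the points but
    one.  As the Koszul complex of [rho1] on [l = 0] is exact in high degrees,
    [h grad f = rho1 x X + l^N Y] with [N = n + d - r - floor(d / 2)]; then
    [X . grad f = l^N q] and [q rho1 = Y x grad f], so that [q] lies in the
    saturation of the Jacobian ideal, in degree [floor(3 (d - 2) / 2)].  If a
    combination of these [q] lies in the Jacobian ideal, then since [N] exceeds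
    [deg h] the same combination of the [h] equals [omega rho1 e] for a syzygy [e],
    hence vanishes at all the points, and its coefficients are zero. *)

(** * Linear substitutions and linear forms *)

(** Reducedness enters through one fact. For a point [c] off the curve, [f] is separable along the
    pencil of lines through [c]; Bezout for [f] and its derivative in the direction [c], together
    with Euler's formula, then puts a product of lines through [c] in the Jacobian ideal. Linear
    forms are visibly prime and none divides all of [grad f], so such a product can be used as a
    denominator and cancelled line by line. This stands in for unique factorization: it makes
    [omega] a polynomial, and it shows that [E_C] is locally free, in the form that at every point
    some [omega] is nonzero. On a line, [tau] spans a subbundle [O(-(r - m))] with quotient
    [O(-(d - 1 - r + m))]. The class of this extension lies in the first cohomology of
    [O(d - 1 - 2 r + 2 m)], which vanishes because [2 r <= d - 1]; concretely, two coprime binary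
    forms generate all forms of large degree. The splitting is first one of graded pieces. It
    becomes an isomorphism of sheaves because restriction from [AR(f)] to the free module on [tau]
    and [sigma] is onto in large degrees, again by local freeness. *)

Section Substitution.
Variable K : numClosedFieldType.

Lemma mpoly_ring_ind n (T : {mpoly K[n]} -> Prop) :
  (forall c, T c%:MP) -> (forall i, T 'X_i) ->
  (forall p q, T p -> T q -> T (p + q)) ->
  (forall p q, T p -> T q -> T (p * q)) -> forall p, T p.
Proof.
move=> TC TX TD TM p.
have T1 : T 1 by have := TC 1; rewrite mpolyC1.
rewrite [p]mpolyE; elim/big_rec: _ => [|m q _ Tq].
  by have := TC 0; rewrite mpolyC0.
apply: (TD _ _ _ Tq); rewrite -mul_mpolyC; apply: (TM) => //.
rewrite mpolyXE_id; elim/big_rec: _ => // i r _ Tr; apply: (TM) => //.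
elim: (m i) => [|k IH]; first by rewrite expr0.
by rewrite exprS; apply: (TM).
Qed.

Lemma rmorph_mpoly_eq n (T : nzRingType) (f g : {rmorphism {mpoly K[n]} -> T}) :
  (forall c, f c%:MP = g c%:MP) -> (forall i, f 'X_i = g 'X_i) -> f =1 g.
Proof.
move=> fgC fgX; apply: mpoly_ring_ind => // p q; rewrite ?rmorphD ?rmorphM => -> ->; done.
Qed.

Lemma meval_eq0 n (p : {mpoly K[n]}) :
  (forall v : 'rV[K]_n, p.@[v 0] = 0) -> p = 0.
Proof.
elim: n p => [|n IH] p p0.
  apply/mpolyP => m; rewrite mcoeff0.
  have := p0 0; rewrite -[X in X.@[_]]mpolyKC mevalC => <-.
  by congr (p@_ _); apply/mnmP; case.
pose ev (v : 'rV[K]_n) (t : K) : {rmorphism {mpoly K[n.+1]} -> K} :=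
  horner_eval t \o (map_poly (meval (v 0)) \o @muni n K).
have evE v t : ev v t p = p.@[fun i => if fintype.split (cast_ord (esym (addn1 n)) i) is inl j then v 0 j else t].
  apply: (rmorph_mpoly_eq (g := meval _)) => [c|i] /=.
    by rewrite mevalC muniC map_polyC /horner_eval hornerC /= mevalC.
  rewrite mevalXU /horner_eval.
  rewrite /muni mmapX mmap1U; case: fintype.splitP => j _.
    by rewrite map_polyC hornerC /= mevalXU.
  by rewrite map_polyX hornerX.
have muni0 : muni p = 0.
  apply/polyP => j; rewrite coef0; apply: IH => v.
  suff: map_poly (meval (v 0)) (muni p) = 0.
    by move/polyP/(_ j); rewrite coef_map coef0.
  apply/eqP; apply: contraT => nz.
  have [s] : exists s : seq K, uniq s /\ size s = size (map_poly (meval (v 0)) (muni p)).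
    (* In characteristic zero the naturals give [size] many distinct roots, one more than a nonzero
       polynomial can have. *)
    exists [seq i%:R | i <- iota 0 (size (map_poly (meval (v 0)) (muni p)))].
    rewrite size_map size_iota map_inj_uniq ?iota_uniq //; exact: (mulrIn (oner_neq0 _)).
  case=> us ss; have := max_poly_roots nz _ us; rewrite ss ltnn; apply.
  apply/allP => t _; rewrite rootE; have := evE v t => /= ; rewrite /horner_eval => ->.
  have := p0 (\row_i if fintype.split (cast_ord (esym (addn1 n)) i) is inl j then v 0 j else t).
  by move=> <-; apply/eqP/meval_eq => i; rewrite mxE.
pose bk : {rmorphism {mpoly K[n.+1]} -> {mpoly K[n.+1]}} :=
  horner_eval 'X_ord_max \o (map_poly (@mwiden n K) \o @muni n K).
have bkE : bk p = p.
  apply: (rmorph_mpoly_eq (g := idfun)) => [c|i] /=.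
    by rewrite muniC map_polyC /horner_eval hornerC /= mwidenC.
  rewrite /horner_eval /muni mmapX mmap1U; case: fintype.splitP => j /= ij.
    rewrite map_polyC hornerC /= mwidenX mnmwiden1; congr 'X_[U_(_)].
    exact: val_inj.
  rewrite map_polyX hornerX; congr 'X_[U_(_)]; apply: val_inj => /=.
  by rewrite ij ord1 addn0.
by rewrite -bkE /= muni0 /horner_eval rmorph0 horner0.
Qed.

Lemma exists_meval_neq0 n (p : {mpoly K[n]}) :
  p != 0 -> exists v : 'rV[K]_n, p.@[v 0] != 0.
Proof.
move=> pn0; apply: contrapT => H; case/negP: pn0; apply/eqP/meval_eq0 => v.
by apply/eqP; apply: contraT => ?; case: H; exists v.
Qed.

(** Pullback along the linear map [v |-> v *m M] on row vectors ([lsub_meval]). Rectangular [M] are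
    allowed, so that restriction to a line and its section are instances. *)
Definition lsub n k (M : 'M[K]_(k, n)) : {mpoly K[n]} -> {mpoly K[k]} :=
  comp_mpoly [tuple \sum_j M j i *: 'X_j | i < n].

HB.instance Definition _ n k (M : 'M[K]_(k, n)) :=
  GRing.RMorphism.copy (lsub M) (lsub M).
HB.instance Definition _ n k (M : 'M[K]_(k, n)) :=
  GRing.Linear.copy (lsub M) (lsub M).

Definition lf n (a : 'cV[K]_n) : {mpoly K[n]} := \sum_i a i 0 *: 'X_i.

Lemma lsubC n k (M : 'M[K]_(k, n)) c : lsub M c%:MP = c%:MP.
Proof. by rewrite /lsub comp_mpolyC. Qed.

Lemma lsubX n k (M : 'M[K]_(k, n)) i : lsub M 'X_i = lf (col i M).
Proof.
by rewrite /lsub comp_mpolyXU -tnth_nth tnth_mktuple; apply: eq_bigr => j _; rewrite mxE.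
Qed.

Lemma lsubZ n k (M : 'M[K]_(k, n)) c p : lsub M (c *: p) = c *: lsub M p.
Proof. exact: comp_mpolyZ. Qed.

Lemma lsub0 n k (M : 'M[K]_(k, n)) : lsub M 0 = 0. Proof. exact: rmorph0. Qed.

Lemma lsub1r n k (M : 'M[K]_(k, n)) : lsub M 1 = 1. Proof. exact: rmorph1. Qed.

Lemma lsubN n k (M : 'M[K]_(k, n)) : {morph lsub M : p / - p}. Proof. exact: rmorphN. Qed.

Lemma lsubD n k (M : 'M[K]_(k, n)) : {morph lsub M : p q / p + q}. Proof. exact: rmorphD. Qed.

Lemma lsubM n k (M : 'M[K]_(k, n)) : {morph lsub M : p q / p * q}. Proof. exact: rmorphM. Qed.

Lemma lsub_lf n k (M : 'M[K]_(k, n)) a : lsub M (lf a) = lf (M *m a).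
Proof.
rewrite /lf rmorph_sum /=; under eq_bigr do rewrite lsubZ lsubX /lf scaler_sumr.
rewrite exchange_big /=; apply: eq_bigr => j _; rewrite mxE scaler_suml.
by apply: eq_bigr => i _; rewrite scalerA !mxE mulrC.
Qed.

Lemma lf_meval n (a : 'cV[K]_n) (v : 'rV[K]_n) : (lf a).@[v 0] = (v *m a) 0 0.
Proof.
rewrite /lf rmorph_sum /= mxE; apply: eq_bigr => i _.
by rewrite mevalZ mevalXU mulrC.
Qed.

Lemma lfD n (a b : 'cV[K]_n) : lf (a + b) = lf a + lf b.
Proof. by rewrite -big_split; apply: eq_bigr => i _; rewrite mxE scalerDl. Qed.

Lemma lfZ n c (a : 'cV[K]_n) : lf (c *: a) = c *: lf a.
Proof. by rewrite /lf scaler_sumr; apply: eq_bigr => i _; rewrite mxE scalerA. Qed.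

Lemma lf_delta n (i : 'I_n) : lf (delta_mx i 0) = 'X_i.
Proof.
rewrite /lf (bigD1 i) //= mxE !eqxx scale1r big1 ?addr0 // => j ji.
by rewrite mxE (negPf ji) scale0r.
Qed.

Lemma mcoeff_lf n (a : 'cV[K]_n) i : (lf a)@_(U_(i)) = a i 0.
Proof.
rewrite /lf raddf_sum /= (bigD1 i) //= mcoeffZ mcoeffXU eqxx mulr1 big1 ?addr0 // => j ji.
by rewrite mcoeffZ mcoeffXU (negPf ji) mulr0.
Qed.

Lemma lf_eq0 n (a : 'cV[K]_n) : (lf a == 0) = (a == 0).
Proof.
apply/eqP/eqP => [a0|->].
  by apply/colP => i; rewrite -mcoeff_lf a0 mcoeff0 mxE.
by rewrite /lf big1 // => i _; rewrite mxE scale0r.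
Qed.

Lemma lsub_comp n k l (N : 'M[K]_(l, k)) (M : 'M[K]_(k, n)) p :
  lsub N (lsub M p) = lsub (N *m M) p.
Proof.
apply: (rmorph_mpoly_eq (f := lsub N \o lsub M)) => [c|i] /=.
  by rewrite !lsubC.
by rewrite !lsubX lsub_lf; congr lf; apply/colP => j; rewrite !mxE; apply: eq_bigr => ? _; rewrite mxE.
Qed.

Lemma lsub1 n p : lsub (1%:M : 'M_n) p = p.
Proof.
apply: (rmorph_mpoly_eq (f := lsub 1%:M) (g := idfun)) => [c|i] /=.
  by rewrite lsubC.
by rewrite lsubX -lf_delta; congr lf; apply/colP => j; rewrite !mxE eqxx andbT.
Qed.

Lemma lsub_meval n k (M : 'M[K]_(k, n)) p (v : 'rV[K]_k) :
  (lsub M p).@[v 0] = p.@[(v *m M) 0].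
Proof.
rewrite /lsub comp_mpoly_meval; apply: meval_eq => i.
rewrite tnth_mktuple rmorph_sum mxE /=; apply: eq_bigr => j _.
by rewrite mevalZ mevalXU mulrC.
Qed.

(** Each variable moves by a multiple of [lf a], because [1 - M] is the rank one matrix [a *m v];
    this passes to sums and products. *)
Lemma lsub_congr n (M : 'M[K]_n) (a : 'cV[K]_n) (v : 'rV[K]_n) p :
  1%:M - M = a *m v -> exists q, p = lsub M p + lf a * q.
Proof.
move=> Mav; elim/mpoly_ring_ind: p => [c|i|p q [p' Ep] [q' Eq]|p q [p' Ep] [q' Eq]].
- by exists 0; rewrite lsubC mulr0 addr0.
- exists (v 0 i)%:MP; rewrite lsubX mulrC mul_mpolyC -lfZ -lfD -lf_delta.
  congr lf; apply/colP => j; rewrite !mxE eqxx andbT.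
  have /matrixP/(_ j i) := Mav; rewrite !mxE big_ord1 => /(canRL (subrK _)) ->.
  by rewrite addrC mulrC.
- by exists (p' + q'); rewrite rmorphD {1}Ep {1}Eq /=; ring.
- by exists (p' * lsub M q + lsub M p * q' + lf a * p' * q'); rewrite rmorphM {1}Ep {1}Eq /=; ring.
Qed.

End Substitution.

(** * Homogeneity *)

Section Homogeneity.
Variable K : numClosedFieldType.
Local Notation two := (2%:R : K).

(* With integer degrees and a multiplicative criterion, degrees of quotients
   and of unique solutions of equations can be read off by rescaling. *)
Definition hm n (z : int) (p : {mpoly K[n]}) : Prop := lsub (two%:M) p = two ^ z *: p.

Lemma two_neq0 : two != 0. Proof. by rewrite pnatr_eq0. Qed.

(** The factor 2 serves for rescaling because it has infinite order, so that the scaling factor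
    determines the degree. *)
Lemma exprz_two_inj : injective (fun z : int => two ^ z).
Proof.
have H (k : nat) : two ^+ k = 1 -> k = 0%N.
  by move=> E; apply: contra_eq E; case: k => // k _; rewrite gt_eqF ?exprn_egt1 ?ltr1n.
move=> x y /= E; have {E}: two ^ (x - y) = 1.
  by rewrite expfzDr ?two_neq0 // E -expfzDr ?two_neq0 // subrr.
case Exy: (x - y) => [k|k].
  by rewrite -exprnP => /H k0; apply/eqP; rewrite -subr_eq0 Exy k0.
by rewrite NegzE -exprnN => /(canRL invrK); rewrite invr1 => /H.
Qed.

Lemma mcoeff_lsub_scalar n c (p : {mpoly K[n]}) m :
  (lsub c%:M p)@_m = c ^+ mdeg m * p@_m.
Proof.
have lX k : lsub (c%:M : 'M_n) 'X_[k] = c ^+ mdeg k *: 'X_[k].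
  rewrite /lsub comp_mpolyX mpolyXE_id mdegE -mul_mpolyC.
  rewrite -prodrXr rmorph_prod -big_split /=; apply: eq_bigr => i _.
  rewrite tnth_mktuple (bigD1 i) //= mxE eqxx big1 ?addr0 => [|j /negPf ji]; last first.
    by rewrite mxE ji scale0r.
  by rewrite -mul_mpolyC exprMn rmorphXn.
rewrite {1}[p]mpolyE rmorph_sum /= raddf_sum /= [in RHS](mpolyE p) raddf_sum mulr_sumr /=.
apply: eq_bigr => k _; rewrite lsubZ lX scalerA !mcoeffZ mcoeffX.
by case: eqP => [->|_]; rewrite ?mulr0 // !mulr1 mulrC.
Qed.

Lemma hmP n (k : nat) (p : {mpoly K[n]}) : hm k%:Z p <-> p \is k.-homog.
Proof.
split=> [pk|/dhomogP pk].
  apply/dhomogP => m; rewrite mcoeff_msupp => pm.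
  have := congr1 (mcoeff m) pk; rewrite mcoeff_lsub_scalar mcoeffZ.
  by move/(mulIf pm); rewrite exprnP => /exprz_two_inj[].
apply/mpolyP => m; rewrite mcoeff_lsub_scalar mcoeffZ.
have [->|pm] := eqVneq p@_m 0; first by rewrite !mulr0.
by rewrite (pk m) // mcoeff_msupp.
Qed.

Lemma hm_lt0 n (z : int) (p : {mpoly K[n]}) : z < 0 -> hm z p -> p = 0.
Proof.
move=> z0 pz; apply/mpolyP => m; rewrite mcoeff0; apply/eqP; apply: contraTT z0 => pm.
have := congr1 (mcoeff m) pz; rewrite mcoeff_lsub_scalar mcoeffZ => /(mulIf pm).
by rewrite exprnP => /exprz_two_inj <-.
Qed.

Lemma hm0 n z : hm z (0 : {mpoly K[n]}).
Proof. by rewrite /hm lsub0 scaler0. Qed.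

Lemma hmD n z (p q : {mpoly K[n]}) : hm z p -> hm z q -> hm z (p + q).
Proof. by rewrite /hm lsubD scalerDr => -> ->. Qed.

Lemma hmN n z (p : {mpoly K[n]}) : hm z p -> hm z (- p).
Proof. by rewrite /hm lsubN scalerN => ->. Qed.

Lemma hmB n z (p q : {mpoly K[n]}) : hm z p -> hm z q -> hm z (p - q).
Proof. by move=> hp hq; apply/hmD/hmN. Qed.

Lemma hmZ n z c (p : {mpoly K[n]}) : hm z p -> hm z (c *: p).
Proof. by rewrite /hm lsubZ scalerA mulrC => ->; rewrite scalerA. Qed.

Lemma hm_sum n z I (r : seq I) (P : pred I) (F : I -> {mpoly K[n]}) :
  (forall i, P i -> hm z (F i)) -> hm z (\sum_(i <- r | P i) F i).
Proof. by move=> hF; apply: big_ind => //; [exact: hm0|exact: hmD]. Qed.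

Lemma hmM n z w (p q : {mpoly K[n]}) : hm z p -> hm w q -> hm (z + w) (p * q).
Proof.
rewrite /hm lsubM => -> ->.
by rewrite -scalerAl -scalerAr scalerA expfzDr // two_neq0.
Qed.

Lemma hmC n c : hm 0 (c%:MP : {mpoly K[n]}).
Proof. by rewrite /hm lsubC expr0z scale1r. Qed.

Lemma hm1 n : hm 0 (1 : {mpoly K[n]}).
Proof. by rewrite -mpolyC1; exact: hmC. Qed.

Lemma hm_exp n z (p : {mpoly K[n]}) k : hm z p -> hm (z *+ k) (p ^+ k).
Proof.
move=> hp; elim: k => [|k IH]; first exact: hm1.
by rewrite mulrS exprS; apply: hmM.
Qed.

Lemma hm_lsub n k (M : 'M[K]_(k, n)) z p : hm z p -> hm z (lsub M p).
Proof.
by rewrite /hm => pz; rewrite lsub_comp mul_scalar_mx -mul_mx_scalar -lsub_comp pz lsubZ.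
Qed.

Lemma hmXU n i : hm 1 ('X_i : {mpoly K[n]}).
Proof. by apply/hmP; rewrite dhomogX /= mdeg1. Qed.

Lemma hm_lf n (a : 'cV[K]_n) : hm 1 (lf a).
Proof. by apply: hm_sum => i _; apply/hmZ/hmXU. Qed.

Lemma hm_lf_exp n (a : 'cV[K]_n) k : hm k%:Z (lf a ^+ k).
Proof. by have := hm_exp k (hm_lf a); rewrite -mulr_natr mul1r natz. Qed.

Lemma hm_div n a b (p q : {mpoly K[n]}) :
  p != 0 -> hm a p -> hm b (p * q) -> hm (b - a) q.
Proof.
move=> p0 hp; rewrite /hm lsubM hp -scalerAl scalerAr => E.
have [->|q0] := eqVneq q 0; first by rewrite lsub0 scaler0.
apply: (mulfI p0); apply: (scalerI (a := two ^ a)); first by rewrite expfz_neq0 ?two_neq0.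
by rewrite -[LHS]scalerAr in E *; rewrite E -scalerAr scalerA -expfzDr ?two_neq0 // addrC subrK.
Qed.

Lemma hm_inj n a b (p : {mpoly K[n]}) : p != 0 -> hm a p -> hm b p -> a = b.
Proof.
rewrite /hm => p0 -> /eqP; rewrite -subr_eq0 -scalerBl scaler_eq0 (negPf p0) orbF subr_eq0.
by move/eqP/exprz_two_inj.
Qed.

Lemma hm_meval n (k : nat) (p : {mpoly K[n]}) c (v : 'rV[K]_n) :
  hm k%:Z p -> p.@[(c *: v) 0] = c ^+ k * p.@[v 0].
Proof.
move/hmP/dhomogP => pk; rewrite -mul_mx_scalar -lsub_meval -mevalZ; congr (_.@[_]).
apply/mpolyP => m; rewrite mcoeff_lsub_scalar mcoeffZ.
have [->|pm] := eqVneq p@_m 0; first by rewrite !mulr0.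
by rewrite (pk m) // mcoeff_msupp.
Qed.

Lemma hm_mderiv n z (p : {mpoly K[n]}) i : hm z p -> hm (z - 1) p^`M(i).
Proof.
case: z => [k|k] hp; last by rewrite (hm_lt0 _ hp) // mderiv0; exact: hm0.
apply/mpolyP => m; rewrite mcoeff_lsub_scalar mcoeffZ mcoeff_mderiv.
have [->|pm] := eqVneq p@_(m + U_(i)) 0; first by rewrite mul0rn !mulr0.
move/hmP/dhomogP: hp => /(_ (m + U_(i))%MM); rewrite mcoeff_msupp pm => /(_ isT).
by rewrite /= mdegD mdeg1 addn1 => <-; rewrite -[X in Posz X]addn1 PoszD addrK.
Qed.

Lemma hm_euler n (k : nat) (p : {mpoly K[n]}) :
  hm k%:Z p -> \sum_i 'X_i * p^`M(i) = k%:R *: p.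
Proof.
move/hmP/dhomogP => pk; rewrite [p]mpolyE.
under eq_bigr => i _ do rewrite raddf_sum mulr_sumr /=.
rewrite exchange_big scaler_sumr /=; apply: eq_big_seq => m /pk <-.
under eq_bigr => i _ do rewrite mderivZ mderivX -scalerAr.
rewrite -scaler_sumr scalerA mulrC -scalerA; congr (_ *: _).
rewrite /= [in RHS]mdegE natr_sum scaler_suml; apply: eq_bigr => i _.
rewrite -scalerAr -mpolyXD; have [->|mi] := eqVneq (m i) 0%N; first by rewrite !scale0r.
congr (_ *: 'X_[_]); rewrite addmC submK //.
by apply/mnm_lepP => j; rewrite mnm1E; case: eqP => // <-; rewrite lt0n.
Qed.

Lemma hm_rescale n z (p : {mpoly K[n]}) (v : 'rV[K]_n) c :
  hm z p -> c != 0 -> (p.@[(c *: v) 0] == 0) = (p.@[v 0] == 0).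
Proof.
case: z => [k|k] hp c0; last by rewrite (hm_lt0 _ hp) // !meval0 !eqxx.
by rewrite (hm_meval _ _ hp) mulf_eq0 expf_eq0 (negPf c0) andbF.
Qed.

Lemma hm_zero_scale n z (p : {mpoly K[n]}) (v : 'rV[K]_n) c :
  hm z p -> p.@[v 0] = 0 -> p.@[(c *: v) 0] = 0.
Proof.
case: z => [k|k] hp pv; last by rewrite (hm_lt0 _ hp) // meval0.
by rewrite (hm_meval _ _ hp) pv mulr0.
Qed.

End Homogeneity.

Lemma predz n : n.+1%:Z - 1 = n%:Z. Proof. by lia. Qed.

(** * Divisibility by linear forms *)

Section LinearForms.
Variable K : numClosedFieldType.

Definition mdvd n (p q : {mpoly K[n]}) : Prop := exists s, q = p * s.

(** [T] projects onto the hyperplane [lf a = 0]. Divisibility by [lf a] becomes membership in the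
    kernel of a ring morphism into a domain, and primality of linear forms follows at once. *)
Lemma lf_dvd_projection n (a : 'cV[K]_n) : a != 0 ->
  exists T : 'M[K]_n, T *m a = 0 /\ forall p, mdvd (lf a) p <-> lsub T p = 0.
Proof.
move=> a0; have [i ai] := cV0Pn _ a0.
pose v : 'rV[K]_n := (a i 0)^-1 *: delta_mx 0 i.
have va : v *m a = 1%:M.
  rewrite -scalemxAl -rowE; apply/matrixP => j k; rewrite !ord1 !mxE eqxx.
  by rewrite mulVf.
have Ta : (1%:M - a *m v) *m a = 0.
  by rewrite mulmxBl mul1mx -mulmxA va mulmx1 subrr.
exists (1%:M - a *m v); split=> // p; split=> [[s ->]|p0].
  by rewrite lsubM lsub_lf Ta /lf big1 ?mul0r // => j _; rewrite mxE scale0r.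
have [|s Es] := @lsub_congr K n (1%:M - a *m v) a v p; first by rewrite opprB addrC subrK.
by exists s; rewrite Es p0 add0r.
Qed.

Lemma lf_prime n (a : 'cV[K]_n) p q :
  a != 0 -> mdvd (lf a) (p * q) -> mdvd (lf a) p \/ mdvd (lf a) q.
Proof.
move=> /lf_dvd_projection[T [_ TP]]; rewrite !TP lsubM => /eqP.
by rewrite mulf_eq0 => /orP[]/eqP; [left|right].
Qed.

Lemma lf_prime_exp n (a : 'cV[K]_n) p k :
  a != 0 -> mdvd (lf a) (p ^+ k) -> mdvd (lf a) p.
Proof.
move=> a0; elim: k => [|k IH]; last by rewrite exprS => /(lf_prime a0)[].
have [T [Ta TP]] := lf_dvd_projection a0.
by rewrite expr0 !TP lsub1r => /eqP; rewrite oner_eq0.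
Qed.

Lemma lf_dvd_meval n (a : 'cV[K]_n) p :
  a != 0 -> (forall v : 'rV_n, v *m a = 0 -> p.@[v 0] = 0) -> mdvd (lf a) p.
Proof.
move=> /lf_dvd_projection[T [Ta TP]] p0; apply/TP/meval_eq0 => v.
by rewrite lsub_meval p0 // -mulmxA Ta mulmx0.
Qed.

Lemma fresh_scalar (s : seq K) : exists c, c \notin s.
Proof.
have [[c _ cs]|] := pselect (exists2 c, c \in [seq i%:R | i <- iota 0 (size s).+1] & c \notin s).
  by exists c.
move=> H; exfalso; suff : ((size s).+1 <= size s)%N by rewrite ltnn.
rewrite -[X in (X <= _)%N](size_iota 0) -(size_map (fun i => i%:R : K)); apply: uniq_leq_size.
  by rewrite map_inj_uniq ?iota_uniq //; exact: (mulrIn (oner_neq0 _)).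
by move=> c ci; apply: contraT => cs; case: H; exists c.
Qed.

Lemma dhomog_const n (p : {mpoly K[n]}) : hm 0 p -> p = (p@_0%MM)%:MP.
Proof.
move/(hmP 0)/dhomogP => p0; apply/mpolyP => m; rewrite mcoeffC.
have [E|pm] := eqVneq p@_m 0.
  by rewrite E; case: eqP => [<-|_]; rewrite ?E ?mul0r ?mulr0.
have /p0 /= /eqP : m \in msupp p by rewrite mcoeff_msupp.
rewrite mdeg_eq0 => /eqP ->.
by rewrite eqxx mulr1.
Qed.

End LinearForms.

(** * Binary forms *)

Section BinaryForms.
Variable K : numClosedFieldType.
Local Notation A := {mpoly K[2]}.
Implicit Types (a b p q : A) (v w : 'rV[K]_2).

(** For [v] nonzero, the linear form whose only zero on the projective line is the point [v]. *)
Definition lam v : A := lf (\col_i if i == 0 then v 0 1 else - v 0 0).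

Lemma hm_lam v : hm 1 (lam v). Proof. exact: hm_lf. Qed.

Lemma lam_meval v w : (lam v).@[w 0] = v 0 1 * w 0 0 - v 0 0 * w 0 1.
Proof.
by rewrite lf_meval mxE !big_ord_recl big_ord0 !mxE /= [lift _ _](_ : _ = 1) //=; [ring|exact: val_inj].
Qed.

Lemma I2P (i : 'I_2) : i = 0 \/ i = 1.
Proof. by case: i => [[|[|//]] ?]; [left|right]; apply: val_inj. Qed.

Lemma rV2P v w : v 0 0 = w 0 0 -> v 0 1 = w 0 1 -> v = w.
Proof. by move=> e0 e1; apply/rowP => i; case: (I2P i) => ->. Qed.

Lemma rV2_neq0 v : (v != 0) = (v 0 0 != 0) || (v 0 1 != 0).
Proof.
rewrite -negb_and; congr negb; apply/eqP/andP => [->|[/eqP v0 /eqP v1]]; first by rewrite !mxE eqxx.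
by apply: rV2P; rewrite ?v0 ?v1 mxE.
Qed.

Lemma lam_coef_eq0 v : (\col_(i < 2) (if i == 0 then v 0 1 else - v 0 0) == 0) = (v == 0).
Proof.
apply/eqP/eqP => [/colP E|->].
  apply: rV2P; first by have := E 1; rewrite !mxE /= => /eqP; rewrite oppr_eq0 => /eqP.
  by have := E 0; rewrite !mxE.
by apply/colP => i; rewrite !mxE oppr0 if_same.
Qed.

Lemma lam_eq0 v : (lam v == 0) = (v == 0).
Proof. by rewrite /lam lf_eq0 lam_coef_eq0. Qed.

Lemma lam_zero v w : v != 0 -> (lam v).@[w 0] = 0 -> exists c, w = c *: v.
Proof.
rewrite lam_meval rV2_neq0 => v0 /eqP; rewrite subr_eq0 => /eqP E.
case/orP: v0 => v0; [exists (w 0 0 / v 0 0)|exists (w 0 1 / v 0 1)]; apply: rV2P; rewrite mxE ?divfK //.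
  by rewrite mulrAC [w 0 0 * _]mulrC E [_ * w 0 1]mulrC mulfK.
by rewrite mulrAC [w 0 1 * _]mulrC -E [_ * w 0 0]mulrC mulfK.
Qed.

Lemma lam_self v : (lam v).@[v 0] = 0.
Proof. by rewrite lam_meval mulrC subrr. Qed.

Lemma lam_factor z p v : hm z p -> v != 0 -> p.@[v 0] = 0 ->
  exists2 q, p = lam v * q & hm (z - 1) q.
Proof.
move=> hp v0 pv; have [q Eq] : mdvd (lam v) p.
  apply: lf_dvd_meval; first by rewrite lam_coef_eq0.
  move=> w wl; have [|c ->] := @lam_zero v w v0; first by rewrite lf_meval wl mxE.
  exact: hm_zero_scale hp pv.
exists q => //; apply: (@hm_div _ _ _ _ (lam v)); rewrite -?Eq ?lam_eq0 //.
exact: hm_lam.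
Qed.

(** One representative for each point of the projective line: equality of points becomes equality of
    vectors, and multiplicities of roots become [count_mem]. *)
Definition normal_point v := (v 0 0 == 1) || (v 0 0 == 0) && (v 0 1 == 1).

Lemma normal_point_neq0 v : normal_point v -> v != 0.
Proof. by rewrite rV2_neq0 => /orP[/eqP->|/andP[_ /eqP->]]; rewrite oner_eq0 ?orbT. Qed.

Lemma normal_point_eq v w c : normal_point v -> normal_point w -> w = c *: v -> w = v.
Proof.
move=> nv nw E; have w0 : w 0 0 = c * v 0 0 by rewrite E mxE.
have w1 : w 0 1 = c * v 0 1 by rewrite E mxE.
rewrite E; suff -> : c = 1 by rewrite scale1r.
case/orP: nv => [/eqP v0|/andP[/eqP v0 /eqP v1]]; rewrite ?v0 ?v1 ?mulr1 ?mulr0 in w0 w1.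
  case/orP: nw => [/eqP <- //|/andP[/eqP e0 /eqP e1]].
  by move: e1; rewrite w1 -w0 e0 mul0r => /esym/eqP; rewrite oner_eq0.
by case/orP: nw => [|/andP[_ /eqP <- //]]; rewrite w0 eq_sym oner_eq0.
Qed.

Lemma binary_form_zero (k : nat) b : (0 < k)%N -> hm k%:Z b ->
  exists2 v, normal_point v & b.@[v 0] = 0.
Proof.
move=> k0 hb; pose pt (x y : K) : 'rV[K]_2 := \row_i (if i == 0 then x else y).
have ptE (v : 'rV[K]_2) : v = pt (v 0 0) (v 0 1) by apply: rV2P; rewrite mxE.
have [b01|b01] := eqVneq b.@[pt 0 1 0] 0.
  by exists (pt 0 1) => //; rewrite /normal_point !mxE /= !eqxx orbT.
pose q : {poly K} := mmap polyC (fun i : 'I_2 => if i == 0 then 1 else 'X) b.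
have qE t : q.[t] = b.@[pt 1 t 0].
  rewrite /q; move: (b); apply: (rmorph_mpoly_eq
    (f := horner_eval t \o mmap polyC (fun i : 'I_2 => if i == 0 then 1 else 'X))) => [c|i] /=.
    by rewrite mmapC /horner_eval hornerC mevalC.
  rewrite mmapX mmap1U /horner_eval mevalXU mxE.
  by case: ifP => _; rewrite ?hornerX // hornerC.
have [/size_poly1P[c c0 Eq]|/closed_rootP[t]] := boolP (size q == 1%N); last first.
  rewrite rootE qE => /eqP bt; exists (pt 1 t) => //.
  by rewrite /normal_point !mxE /= eqxx.
(* A constant dehomogenization would make [b] a multiple of ['X_0 ^+ k], which vanishes at the point
   [(0, 1)] already excluded. *)
suff E : b = c *: 'X_0 ^+ k.
  by move: b01; rewrite E mevalZ rmorphXn /= mevalXU mxE /= expr0n; case: (k) k0 => // ?; rewrite mulr0 eqxx.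
have X0 : 'X_0 != 0 :> A by rewrite -lf_delta lf_eq0; apply/eqP => /colP/(_ 0); rewrite !mxE /= => /eqP; rewrite oner_eq0.
apply: (mulfI X0); apply/eqP; rewrite -subr_eq0; apply/eqP/meval_eq0 => v.
rewrite mevalB !mevalM mevalZ rmorphXn /= mevalXU -mulrBr.
have [->|v0] := eqVneq (v 0 0) 0; first by rewrite mul0r.
have -> : v = v 0 0 *: pt 1 (v 0 1 / v 0 0).
  by apply: rV2P; rewrite !mxE /= ?mulr1 // mulrCA mulfV // mulr1.
rewrite (hm_meval _ _ hb) -qE Eq hornerC !mxE /= mulr1 [c * _]mulrC subrr mulr0 //.
Qed.

Definition nozero2 a b : Prop := forall v, v != 0 -> a.@[v 0] = 0 -> b.@[v 0] = 0 -> False.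

Lemma hm0_neq0_inv b : hm 0 b -> b != 0 -> exists b', b * b' = 1.
Proof.
move=> /dhomog_const ->; set c := mcoeff _ _; rewrite mpolyC_eq0 => c0.
by exists (c^-1)%:MP; rewrite -rmorphM /= mulfV.
Qed.

(** The linear factors of [b] are removed one by one: each is prime and divides [a * c], but not
    [a], which is nonzero at its root. *)
Lemma nozero2_coprime m (n : nat) a b c e :
  hm m a -> hm n%:Z b -> b != 0 -> nozero2 a b -> a * c = b * e -> mdvd b c.
Proof.
move=> ha; elim: n b c e => [|n IH] b c e hb b0 ab E.
  have [b' bb'] := hm0_neq0_inv hb b0.
  by exists (b' * c); rewrite mulrA bb' mul1r.
have [v /normal_point_neq0 v0 bv] := binary_form_zero (ltn0Sn n) hb.
have [b' Eb hb'] := lam_factor hb v0 bv.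
have [||[s Es]|[c' Ec]] := @lf_prime _ _ (\col_i if i == 0 then v 0 1 else - v 0 0) a c.
- by rewrite lam_coef_eq0.
- by rewrite -/(lam v) E Eb; exists (b' * e); rewrite mulrA.
- by case: (ab v) => //; rewrite Es -/(lam v) mevalM lam_self mul0r.
rewrite -/(lam v) in Ec; have [||||t Et] := IH b' c' e.
- by rewrite predz in hb'.
- by apply: contraNneq b0 => E0; rewrite Eb E0 mulr0.
- by move=> w w0 aw bw; apply: (ab w) => //; rewrite Eb mevalM bw mulr0.
- apply: (@mulfI _ (lam v)); first by rewrite lam_eq0.
  by rewrite mulrCA -Ec E Eb mulrA.
by exists t; rewrite Eb Ec Et mulrA.
Qed.

(** At a zero of [b], a multiple of [a] interpolates [q]; after subtracting it, the linear factor
    cancels and the degree of [b] drops. The ideal of a coprime pair is everything from degree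
    [m + n - 1] on. The last hypothesis keeps [D] positive while [b] still has factors, so that the
    induction stays in natural degrees. *)
Lemma nozero2_span (m n D : nat) a b q :
  hm m%:Z a -> hm n%:Z b -> b != 0 -> nozero2 a b -> hm D%:Z q ->
  (m + n <= D.+1)%N -> (0 < m)%N || (m + n <= D)%N ->
  exists x y, [/\ hm (D%:Z - m%:Z) x, hm (D%:Z - n%:Z) y & q = x * a + y * b].
Proof.
move=> ha; elim: n D b q => [|n IH] D b q hb b0 ab hq le1 le2.
  have [b' bb'] := hm0_neq0_inv hb b0.
  exists 0, (q * b'); split; first exact: hm0; last by rewrite mul0r add0r mulrAC -mulrA bb' mulr1.
  by apply: (hm_div b0 hb); rewrite mulrCA bb' mulr1.
have [v /normal_point_neq0 v0 bv] := binary_form_zero (ltn0Sn n) hb.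
have [b' Eb hb'] := lam_factor hb v0 bv.
have av : a.@[v 0] != 0 by apply/eqP => av; apply: (ab v).
have [i vi] : exists i, v 0 i != 0.
  by move: v0; rewrite rV2_neq0 => /orP[]; [exists 0|exists 1].
have mD : (m <= D)%N by lia.
pose x0 : A := (q.@[v 0] / a.@[v 0] / v 0 i ^+ (D - m)) *: 'X_i ^+ (D - m).
have hx0 : hm (D%:Z - m%:Z) x0.
  have := hm_exp (D - m) (hmXU K i); rewrite natz -subzn // => h; exact: hmZ.
have [q' Eq hq'] : exists2 q', q - x0 * a = lam v * q' & hm (D%:Z - 1) q'.
  apply: lam_factor => //; first by apply: hmB => //; rewrite -[D%:Z](subrK m%:Z); apply: hmM.
  by rewrite mevalB mevalM mevalZ rmorphXn /= mevalXU divfK ?expf_neq0 // divfK // subrr.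
have D0 : (0 < D)%N by case/orP: le2 => [|]; lia.
have [||||||x [y [hx hy Eq']]] := IH D.-1 b' q'.
- by rewrite predz in hb'.
- by apply: contraNneq b0 => E0; rewrite Eb E0 mulr0.
- by move=> w w0 aw bw; apply: (ab w) => //; rewrite Eb mevalM bw mulr0.
- by move: hq'; rewrite -{1}(prednK D0) predz.
- lia.
- by case/orP: le2 => [->//|]; rewrite orbC; lia.
exists (x0 + lam v * x), y; split.
- apply: hmD => //; rewrite (_ : _ - _ = 1 + (D.-1%:Z - m%:Z)); last lia.
  by apply: hmM => //; exact: hm_lam.
- by rewrite (_ : _ - _ = D.-1%:Z - n%:Z) //; lia.
by rewrite -[q](subrK (x0 * a)) Eq Eq' Eb; ring.
Qed.

(** Common zeros are divided out as long as there are any; the degree of the member [b] bounds the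
    number of divisions. [F] is any set of forms, not an ideal, so the conclusion gives, at each
    point separately, one quotient that is nonzero there. *)
Lemma family_gcd (F : A -> Prop) (n : nat) b :
  (forall x, F x -> exists z, hm z x) -> F b -> b != 0 -> hm n%:Z b ->
  exists (m : nat) g, [/\ hm m%:Z g, g != 0, forall x, F x -> mdvd g x
    & forall v, v != 0 -> exists2 y, F (g * y) & y.@[v 0] != 0].
Proof.
elim: n F b => [|n IH] F b hF Fb b0 hb; last first.
  have [[v [v0 Fv]]|nF] := pselect (exists v, v != 0 /\ forall x, F x -> x.@[v 0] = 0).
    have [b' Eb hb'] := lam_factor hb v0 (Fv _ Fb).
    have lv0 : lam v != 0 by rewrite lam_eq0.
    have [||||m [g [hg g0 gF nz]]] := IH (fun y => F (lam v * y)) b'.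
    - move=> y Fy; have [z hz] := hF _ Fy.
      by exists (z - 1); apply: hm_div hz => //; exact: hm_lam.
    - by rewrite -Eb.
    - by apply: contraNneq b0 => E0; rewrite Eb E0 mulr0.
    - by rewrite predz in hb'.
    exists m.+1, (lam v * g); split.
    - by rewrite -[m.+1]add1n PoszD; apply: hmM => //; exact: hm_lam.
    - by rewrite mulf_neq0.
    - move=> x Fx; have [z hz] := hF _ Fx.
      have [x' Ex _] := lam_factor hz v0 (Fv _ Fx); rewrite Ex in Fx.
      by have [y Ey] := gF _ Fx; exists y; rewrite Ex Ey mulrA.
    by move=> w w0; have [y] := nz _ w0; exists y; rewrite -?mulrA.
  exists 0%N, 1; split; [exact: hm1|exact: oner_neq0| |].
    by move=> x _; exists x; rewrite mul1r.
  move=> v v0; apply: contrapT => H; apply: nF; exists v; split=> // x Fx.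
  by apply/eqP; apply: contraT => xv; case: H; exists x; rewrite ?mul1r.
exists 0%N, 1; split; [exact: hm1|exact: oner_neq0| |].
  by move=> x _; exists x; rewrite mul1r.
move=> v v0; exists b; rewrite ?mul1r //.
by move: b0; rewrite (dhomog_const hb) mevalC mpolyC_eq0.
Qed.

Lemma binary_form_prod (n : nat) b : hm n%:Z b -> b != 0 ->
  exists c s, [/\ c != 0, size s = n, all normal_point s
    & b = c *: \prod_(v <- s) lam v].
Proof.
elim: n b => [|n IH] b hb b0.
  exists (b@_0%MM), [::]; split=> //.
    by move: b0; rewrite (dhomog_const hb) mpolyC_eq0 mcoeffC eqxx mulr1.
  by rewrite big_nil {1}(dhomog_const hb) -mul_mpolyC mulr1.
have [v nv bv] := binary_form_zero (ltn0Sn n) hb.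
have [b' Eb hb'] := lam_factor hb (normal_point_neq0 nv) bv.
have [||c [s [c0 ss ns Eb']]] := IH b'.
- by rewrite predz in hb'.
- by apply: contraNneq b0 => E0; rewrite Eb E0 mulr0.
exists c, (v :: s); split=> //=; first by rewrite ss.
  by rewrite nv.
by rewrite big_cons Eb Eb' scalerAr.
Qed.

Lemma linear_form_avoiding (s : seq 'rV[K]_2) : all (fun v => v != 0) s ->
  exists2 u : A, hm 1 u & all (fun v : 'rV_2 => u.@[v 0] != 0) s.
Proof.
move=> /allP s0; have [t nt] := fresh_scalar [seq - v 0 0 / v 0 1 | v : 'rV[K]_2 <- s].
exists ('X_0 + t *: 'X_1).
  by apply: hmD; [exact: hmXU|apply/hmZ/hmXU].
apply/allP => v vs; rewrite mevalD mevalZ !mevalXU.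
have := s0 v vs; rewrite rV2_neq0 /=; have [->|v1 _] := eqVneq (v 0 1) 0.
  by rewrite mulr0 addr0 orbF.
apply: contraNneq nt => E; apply/mapP; exists v => //.
by apply: (mulIf v1); rewrite divfK //; apply/eqP; rewrite -addr_eq0 addrC E.
Qed.

(** * Graded ideals of binary forms without common zero *)

Section GradedIdeal.
Variable G : nat -> A -> Prop.
Hypothesis Ghm : forall n x, G n x -> hm n%:Z x.
Hypothesis GD : forall n x y, G n x -> G n y -> G n (x + y).
Hypothesis GM : forall n k x c, G n x -> hm k%:Z c -> G (k + n) (c * x).
Hypothesis Gnz : forall v, v != 0 -> exists n x, G n x /\ x.@[v 0] != 0.

Lemma graded_ideal_avoiding (s : seq 'rV[K]_2) : all (fun v => v != 0) s ->
  exists n x, G n x /\ all (fun v : 'rV_2 => x.@[v 0] != 0) s.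
Proof.
elim: s => [_|v s IH /= /andP[v0 s0]].
  have [|n [x [Gx _]]] := @Gnz (const_mx 1); last by exists n, x.
  by rewrite rV2_neq0 !mxE oner_eq0.
have [n [x [Gx xs]]] := IH s0; have [n' [y [Gy yv]]] := Gnz v0.
have [xv|xv] := eqVneq x.@[v 0] 0; last by exists n, x; rewrite xv.
have [|u hu /= /andP[uv us]] := @linear_form_avoiding (v :: s); first by rewrite /= v0.
have hu' k : hm k%:Z (u ^+ k) by have := hm_exp k hu; rewrite natz.
(* Powers of [u] bring [x] and [y] to one degree without creating zeros at the points; [c] then
   avoids the finitely many values for which the combination vanishes at one of them. *)
have [c] := fresh_scalar (0 :: [seq - (u.@[w 0] ^+ n' * x.@[w 0]) / (u.@[w 0] ^+ n * y.@[w 0]) | w : 'rV[K]_2 <- s]).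
rewrite inE negb_or => /andP[c0 cs].
exists (n + n')%N, (u ^+ n' * x + (c *: u ^+ n) * y); split.
  by apply: GD; [rewrite addnC|]; apply: GM => //; exact: hmZ.
apply/andP; split.
  by rewrite mevalD !mevalM mevalZ !rmorphXn /= xv mulr0 add0r !mulf_neq0 ?expf_neq0.
apply/allP => w ws; rewrite mevalD !mevalM mevalZ !rmorphXn /=.
have uw := allP us _ ws; have xw := allP xs _ ws.
have [->|yw] := eqVneq y.@[w 0] 0; first by rewrite mulr0 addr0 mulf_neq0 ?expf_neq0.
apply: contraNneq cs => E; apply/mapP; exists w => //.
have D0 : u.@[w 0] ^+ n * y.@[w 0] != 0 by rewrite mulf_neq0 ?expf_neq0.
by apply: (mulIf D0); rewrite divfK // mulrA; apply/eqP; rewrite -addr_eq0 addrC E.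
Qed.

Lemma graded_ideal_coprime_pair : exists (n1 n2 : nat) a b,
  [/\ G n1 a, G n2 b, b != 0 & nozero2 a b].
Proof.
have [|n2 [b [Gb b1]]] := @Gnz (const_mx 1); first by rewrite rV2_neq0 !mxE oner_eq0.
have b0 : b != 0 by apply: contraNneq b1 => ->; rewrite meval0.
have [c [s [c0 _ /allP ns Eb]]] := binary_form_prod (Ghm Gb) b0.
have [|n1 [a [Ga as_]]] := @graded_ideal_avoiding s.
  by apply/allP => v /ns/normal_point_neq0.
exists n1, n2, a, b; split=> // v v0 av /eqP; rewrite Eb mevalZ rmorph_prod /= mulf_eq0 (negPf c0) /=.
rewrite prodf_seq_eq0 => /hasP[w ws /= /eqP lw].
have [k Ek] := lam_zero (normal_point_neq0 (ns _ ws)) lw.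
have k0 : k != 0 by apply: contraNneq v0 => E; rewrite Ek E scale0r.
by move/eqP: av; rewrite Ek (hm_rescale _ (Ghm Ga)) // (negPf (allP as_ _ ws)).
Qed.

(** Projective Nullstellensatz in two variables: [nozero2_span] for a coprime pair taken in the
    ideal. *)
Lemma graded_ideal_cofinite : exists n0, forall n x, (n0 <= n)%N -> hm n%:Z x -> G n x.
Proof.
have [n1 [n2 [a [b [Ga Gb b0 ab]]]]] := graded_ideal_coprime_pair.
exists (n1 + n2)%N => n x len hx.
have [||u [w [hu hw ->]]] := nozero2_span (Ghm Ga) (Ghm Gb) b0 ab hx.
- exact: leq_trans len _.
- by rewrite len orbT.
rewrite subzn in hu; last by apply: leq_trans len; exact: leq_addr.
rewrite subzn in hw; last by apply: leq_trans len; exact: leq_addl.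
apply: GD.
  by rewrite -(@subnK n1 n); [apply: GM|apply: leq_trans len; exact: leq_addr].
by rewrite -(@subnK n2 n); [apply: GM|apply: leq_trans len; exact: leq_addl].
Qed.

End GradedIdeal.

End BinaryForms.

(** * Restriction to a line *)

Section Frames.
Variable K : numClosedFieldType.

Lemma exists_unitmx_col n (a : 'cV[K]_n.+1) :
  a != 0 -> exists2 Q : 'M[K]_n.+1, Q \in unitmx & col 0 Q = a.
Proof.
move=> a0; have ra : \rank a = 1%N.
  by apply/eqP; rewrite eqn_leq rank_leq_col lt0n mxrank_eq0 a0.
have := mulmx_ebase a; rewrite ra [row_ebase a]mx11_scalar; set c := row_ebase a 0 0.
rewrite mul_mx_scalar => Ea; have c0 : c != 0.
  by apply: contraNneq a0 => c0; rewrite -Ea c0 scale0r.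
exists (c *: col_ebase a); first by rewrite unitmxZ ?unitfE // col_ebase_unit.
rewrite -[RHS]Ea; apply/colP => i; rewrite !mxE; congr (c * _).
rewrite (bigD1 0) //= mxE eqxx mulr1 big1 ?addr0 // => j j0.
by rewrite mxE -(inj_eq val_inj) /= in j0 *; rewrite (negPf j0) mulr0.
Qed.

Lemma exists_unitmx_row n (a : 'rV[K]_n.+1) :
  a != 0 -> exists2 Q : 'M[K]_n.+1, Q \in unitmx & row 0 Q = a.
Proof.
move=> a0; have [|Q uQ Ea] := @exists_unitmx_col n a^T; first by rewrite trmx_eq0.
by exists Q^T; rewrite ?unitmx_tr // -tr_col Ea trmxK.
Qed.

(* Restriction to the line [lf a = 0] is composition with [frame_in], and
   [frame_out] splits it: forms on the line are identified with binary forms. *)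
Record line_frame (a : 'cV[K]_3) := LineFrame {
  frame_in : 'M[K]_(2, 3);
  frame_out : 'M[K]_(3, 2);
  frame_off : 'rV[K]_3;
  frame_inK : frame_in *m frame_out = 1%:M;
  frame_in_a : frame_in *m a = 0;
  frame_split : 1%:M - frame_out *m frame_in = a *m frame_off
}.

Lemma exists_line_frame (a : 'cV[K]_3) : a != 0 -> inhabited (line_frame a).
Proof.
move=> /exists_unitmx_col[Q uQ Ea]; pose M := invmx Q.
have MQ : M *m Q = 1%:M by rewrite mulVmx.
have QM : Q *m M = 1%:M by rewrite mulmxV.
constructor; exists (row' 0 M) (col' 0 Q) (row 0 M).
- apply/matrixP => i j; have /matrixP/(_ (lift 0 i) (lift 0 j)) := MQ.
  by rewrite !mxE (inj_eq lift_inj) => <-; apply: eq_bigr => k _; rewrite !mxE.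
- apply/matrixP => i j; rewrite !mxE; have /matrixP/(_ (lift 0 i) 0) := MQ.
  rewrite !mxE => E; apply: (etrans _ E); apply: eq_bigr => k _; by rewrite -Ea ord1 !mxE.
- rewrite -QM; apply/matrixP => i j; rewrite !mxE big_ord1 (bigD1 0) //= -Ea !mxE.
  rewrite -[RHS]addr0 -addrA; congr (_ + _); apply/eqP; rewrite subr_eq0; apply/eqP.
  rewrite (reindex_onto (lift 0) (fun k => odflt 0 (unlift 0 k))) /=; last first.
    by move=> k k0; case: unliftP k0 => [k' -> //|->]; rewrite eqxx.
  by apply: eq_big => [k|k _]; rewrite ?liftK ?eqxx ?mxE.
Qed.

Section Frame.
Variables (a : 'cV[K]_3) (F : line_frame a).
Hypothesis a0 : a != 0.
Let P := frame_in F.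
Let N := frame_out F.

Definition res : {mpoly K[3]} -> {mpoly K[2]} := lsub P.
Definition lft : {mpoly K[2]} -> {mpoly K[3]} := lsub N.
HB.instance Definition _ := GRing.RMorphism.copy res (lsub P).
HB.instance Definition _ := GRing.RMorphism.copy lft (lsub N).

Lemma resM : {morph res : p q / p * q}. Proof. exact: rmorphM. Qed.
Lemma resD : {morph res : p q / p + q}. Proof. exact: rmorphD. Qed.
Lemma resB : {morph res : p q / p - q}. Proof. exact: rmorphB. Qed.
Lemma resN : {morph res : p / - p}. Proof. exact: rmorphN. Qed.
Lemma res0 : res 0 = 0. Proof. exact: rmorph0. Qed.
Lemma resC c : res c%:MP = c%:MP. Proof. exact: lsubC. Qed.
Lemma res_var i : res 'X_i = lf (col i P). Proof. exact: lsubX. Qed.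

Lemma res_lf : res (lf a) = 0.
Proof. by rewrite /res lsub_lf frame_in_a; apply/eqP; rewrite lf_eq0. Qed.

Lemma lftK : cancel lft res.
Proof. by move=> p; rewrite /res /lft lsub_comp frame_inK lsub1. Qed.

Lemma res_lft_mod p : exists q, p = lft (res p) + lf a * q.
Proof. by rewrite /res /lft lsub_comp; apply: lsub_congr (frame_split F). Qed.

Lemma res_eq0P p : res p = 0 <-> mdvd (lf a) p.
Proof.
split=> [p0|[q ->]]; last by rewrite rmorphM /= res_lf mul0r.
by have [q ->] := res_lft_mod p; rewrite p0 rmorph0 add0r; exists q.
Qed.

Lemma res_hm z p : hm z p -> hm z (res p). Proof. exact: hm_lsub. Qed.

Lemma lft_hm z p : hm z p -> hm z (lft p). Proof. exact: hm_lsub. Qed.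

Lemma res_eq0_hm z p : hm z p -> res p = 0 -> exists2 q, p = lf a * q & hm (z - 1) q.
Proof.
move=> hp /res_eq0P[q Eq]; exists q => //.
by apply: (@hm_div _ _ _ _ (lf a)); rewrite ?lf_eq0 // -?Eq //; exact: hm_lf.
Qed.

Lemma res_meval p (w : 'rV[K]_2) : (res p).@[w 0] = p.@[(w *m P) 0].
Proof. exact: lsub_meval. Qed.

Lemma frame_pt_on (w : 'rV[K]_2) : (w *m P) *m a = 0.
Proof. by rewrite -mulmxA frame_in_a mulmx0. Qed.

Lemma frame_ptK (w : 'rV[K]_2) : (w *m P) *m N = w.
Proof. by rewrite -mulmxA frame_inK mulmx1. Qed.

Lemma frame_ptP (x : 'rV[K]_3) : x *m a = 0 -> (x *m N) *m P = x.
Proof.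
move=> xa; apply/eqP; rewrite eq_sym -subr_eq0 -{1}(mulmx1 x) -mulmxA -mulmxBr.
by rewrite frame_split mulmxA xa mul0mx.
Qed.

Lemma frame_pt_neq0 (w : 'rV[K]_2) : (w *m P != 0) = (w != 0).
Proof.
congr negb; apply/eqP/eqP => [E|->]; last by rewrite mul0mx.
by rewrite -(frame_ptK w) E mul0mx.
Qed.

Lemma frame_out_neq0 (x : 'rV[K]_3) : x *m a = 0 -> x != 0 -> x *m N != 0.
Proof. by move=> xa; apply: contraNneq => E; rewrite -(frame_ptP xa) E mul0mx. Qed.

Lemma res_meval_out p (x : 'rV[K]_3) : x *m a = 0 -> (res p).@[(x *m N) 0] = p.@[x 0].
Proof. by move=> xa; rewrite res_meval (frame_ptP xa). Qed.

Lemma res_cross_cancel p q g x y :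
  res p = g * x -> res q = g * y -> res (lft y * p - lft x * q) = 0.
Proof.
by move=> Ep Eq; rewrite resB !resM !lftK Ep Eq mulrCA [x * _]mulrCA [x * y]mulrC subrr.
Qed.

End Frame.

#[global] Opaque res lft.

End Frames.

(** * Cross product identities *)

Section Vectors.
Variable T : comNzRingType.
Implicit Types u v w n : 'rV[T]_3.

Lemma I3P (i : 'I_3) : [\/ i = 0, i = 1 | i = 2].
Proof.
by case: i => [[|[|[|//]]] ?]; [constructor 1|constructor 2|constructor 3]; apply: val_inj.
Qed.

Lemma sum3 (V : nmodType) (F : 'I_3 -> V) : \sum_i F i = F 0 + F 1 + F 2.
Proof.
rewrite !big_ord_recl big_ord0 addr0 addrA.
by congr (_ + F _ + F _); apply: val_inj.
Qed.

Lemma rV3P u v : u 0 0 = v 0 0 -> u 0 1 = v 0 1 -> u 0 2 = v 0 2 -> u = v.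
Proof. by move=> ? ? ?; apply/rowP => i; case: (I3P i) => ->. Qed.

Definition dot u v : T := \sum_i u 0 i * v 0 i.

Definition cross u v : 'rV[T]_3 :=
  \row_i if i == 0 then u 0 1 * v 0 2 - u 0 2 * v 0 1
         else if i == 1 then u 0 2 * v 0 0 - u 0 0 * v 0 2
         else u 0 0 * v 0 1 - u 0 1 * v 0 0.

Lemma dotE u v : dot u v = u 0 0 * v 0 0 + u 0 1 * v 0 1 + u 0 2 * v 0 2.
Proof. exact: sum3. Qed.

Ltac v3 := rewrite ?dotE; try (apply: rV3P); rewrite ?dotE ?mxE /= ?dotE ?mxE /=; ring.

Lemma dotC u v : dot u v = dot v u. Proof. v3. Qed.
Lemma dotDl u v w : dot (u + v) w = dot u w + dot v w. Proof. v3. Qed.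
Lemma dotBl u v w : dot (u - v) w = dot u w - dot v w. Proof. v3. Qed.
Lemma dotZl c u w : dot (c *: u) w = c * dot u w. Proof. v3. Qed.
Lemma dotDr u v w : dot u (v + w) = dot u v + dot u w. Proof. v3. Qed.
Lemma dotZr c u w : dot u (c *: w) = c * dot u w. Proof. v3. Qed.
Lemma crossC u v : cross u v = - cross v u. Proof. v3. Qed.
Lemma crossvv u : cross u u = 0. Proof. v3. Qed.
Lemma crossDl u v w : cross (u + v) w = cross u w + cross v w. Proof. v3. Qed.
Lemma crossZl c u w : cross (c *: u) w = c *: cross u w. Proof. v3. Qed.
Lemma crossDr u v w : cross u (v + w) = cross u v + cross u w. Proof. v3. Qed.
Lemma crossBr u v w : cross u (v - w) = cross u v - cross u w. Proof. v3. Qed.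
Lemma crossZr c u w : cross u (c *: w) = c *: cross u w. Proof. v3. Qed.
Lemma dot_crossl u v : dot u (cross u v) = 0. Proof. v3. Qed.
Lemma dot_crossr u v : dot v (cross u v) = 0. Proof. v3. Qed.
Lemma cross_crossr u v w : cross u (cross v w) = dot u w *: v - dot u v *: w.
Proof. v3. Qed.
Lemma cross_crossl u v w : cross (cross u v) w = dot u w *: v - dot v w *: u.
Proof. v3. Qed.
Lemma dot_cross_cycle u v w : dot u (cross v w) = dot w (cross u v).
Proof. v3. Qed.

(** Expansion of [n] in the basis dual to [u, v, w], multiplied by their determinant; that
    determinant is therefore zero when the three vectors are orthogonal to a nonzero [n]. *)
Lemma dot_cross_decomp u v w n :
  dot u (cross v w) *: n =
  dot u n *: cross v w + dot v n *: cross w u + dot w n *: cross u v.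
Proof. v3. Qed.

Lemma cross_cramer u v w i :
  cross u v 0 i *: w - cross u w 0 i *: v + cross v w 0 i *: u =
  dot u (cross v w) *: delta_mx 0 i.
Proof.
by case: (I3P i) => ->; apply: rV3P; rewrite dotE !mxE /=; ring.
Qed.

End Vectors.

Section Orthogonal.
Variables (T : idomainType) (n : 'rV[T]_3).
Hypothesis n0 : n != 0.
Implicit Types r : 'rV[T]_3.

Lemma scalerv_inj : injective (fun w => w *: n).
Proof.
have [i ni] := rV0Pn _ n0.
by move=> w w' /= /rowP/(_ i); rewrite !mxE => /(mulIf ni).
Qed.

Lemma orthogonal_det0 r1 r2 r3 : dot r1 n = 0 -> dot r2 n = 0 -> dot r3 n = 0 ->
  dot r1 (cross r2 r3) = 0.
Proof.
move=> e1 e2 e3; apply: scalerv_inj.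
by rewrite /= dot_cross_decomp e1 e2 e3 !scale0r !addr0.
Qed.

(** Cramer's rule for three vectors whose determinant vanishes; cancelling a nonzero entry of [n]
    leaves the three-term relation between the coefficients of the cross products. *)
Lemma orthogonal_plucker r1 r2 r3 a b c :
  dot r1 n = 0 -> dot r2 n = 0 -> dot r3 n = 0 ->
  cross r1 r2 = a *: n -> cross r1 r3 = b *: n -> cross r2 r3 = c *: n ->
  a *: r3 - b *: r2 + c *: r1 = 0.
Proof.
move=> e1 e2 e3 E1 E2 E3; have [i ni] := rV0Pn _ n0.
have := cross_cramer r1 r2 r3 i; rewrite orthogonal_det0 // scale0r E1 E2 E3 => /rowP E.
apply/rowP => j; rewrite [RHS]mxE; apply: (mulfI ni); rewrite mulr0.
by have := E j; rewrite !mxE => <-; ring.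
Qed.

End Orthogonal.

Lemma map_cross (T U : comNzRingType) (g : {rmorphism T -> U}) u v :
  map_mx g (cross u v) = cross (map_mx g u) (map_mx g v).
Proof. by apply: rV3P; rewrite !mxE /= rmorphB !rmorphM. Qed.

(** * Dehomogenization and reduced forms *)

Section DirectionalDerivative.
Variables (K : numClosedFieldType) (n : nat) (c : 'rV[K]_n).

Definition dirderiv (p : {mpoly K[n]}) : {mpoly K[n]} := \sum_i c 0 i *: p^`M(i).

Lemma dirderivC x : dirderiv x%:MP = 0.
Proof. by rewrite /dirderiv big1 // => i _; rewrite mderivC scaler0. Qed.

Lemma dirderivX i : dirderiv 'X_i = (c 0 i)%:MP.
Proof.
have UU : (U_(i) - U_(i) = 0 :> 'X_{1..n})%MM.
  by apply/mnmP => k; rewrite mnmBE subnn mnm0E.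
rewrite /dirderiv (bigD1 i) //= mderivX mnm1E eqxx scale1r UU mpolyX0 big1 ?addr0.
  by rewrite -mul_mpolyC mulr1.
by move=> j /negPf ji; rewrite mderivX mnm1E eq_sym ji scale0r scaler0.
Qed.

Lemma dirderivD p q : dirderiv (p + q) = dirderiv p + dirderiv q.
Proof. by rewrite -big_split; apply: eq_bigr => i _; rewrite mderivD scalerDr. Qed.

Lemma dirderivM p q : dirderiv (p * q) = dirderiv p * q + p * dirderiv q.
Proof.
rewrite /dirderiv mulr_suml mulr_sumr -big_split; apply: eq_bigr => i _.
by rewrite mderivM scalerDr scalerAl scalerAr.
Qed.

Lemma hm_dirderiv z p : hm z p -> hm (z - 1) (dirderiv p).
Proof. by move=> hp; apply: hm_sum => i _; apply/hmZ/hm_mderiv. Qed.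

Lemma deriv_rmorph (T : comNzRingType) (g : {rmorphism {mpoly K[n]} -> {poly T}}) :
  (forall x, (g x%:MP)^`() = 0) -> (forall i, (g 'X_i)^`() = g (c 0 i)%:MP) ->
  forall p, (g p)^`() = g (dirderiv p).
Proof.
move=> gC gX; elim/mpoly_ring_ind => [x|i|p q Ep Eq|p q Ep Eq].
- by rewrite gC dirderivC rmorph0.
- by rewrite gX dirderivX.
- by rewrite rmorphD derivD Ep Eq -rmorphD dirderivD.
- by rewrite rmorphM derivM Ep Eq -!rmorphM -rmorphD dirderivM.
Qed.

End DirectionalDerivative.

Section Dehomogenization.
Variable K : numClosedFieldType.
Local Notation S := {mpoly K[3]}.

(** Each line divides either [g], and is moved out of it, or every [q i], by primality. The indexed
    family and the exponent cover two uses: a square factor of [f] ([e = 1]) and a common factor of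
    three forms ([e = 0]). *)
Lemma lf_prod_cancel (I : Type) e (s : seq 'cV[K]_3) (p q : I -> S) (g : S) :
  all (fun l => l != 0) s ->
  (forall i, (\prod_(l <- s) lf l) * p i = g ^+ e.+1 * q i) ->
  exists s' g' q', [/\ {subset s' <= s}, g = g' * \prod_(l <- s') lf l
    & forall i, p i = g' ^+ e.+1 * q' i].
Proof.
elim: s g q => [|l s IH] g q /=.
  move=> _ E; exists [::], g, q; rewrite big_nil mulr1; split=> // i.
  by have := E i; rewrite big_nil mul1r.
move=> /andP[l0 s0] E; have fl0 : lf l != 0 by rewrite lf_eq0.
have [[g1 Eg]|ng] := pselect (mdvd (lf l) g).
  have [i|s' [g' [q' [ss Eg1 Ep]]]] := IH g1 (fun i => lf l ^+ e * q i) s0.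
    have Ei := E i; rewrite big_cons -mulrA in Ei; apply: (mulfI fl0); rewrite Ei.
    by rewrite Eg exprMn exprS; ring.
  exists (l :: s'), g', q'; split=> //.
    move=> x; rewrite !inE => /orP[->//|/ss ->]; exact: orbT.
  by rewrite Eg Eg1 big_cons; ring.
have dq i : exists b, q i = lf l * b.
  have [|/(lf_prime_exp l0)/ng[]|//] := @lf_prime _ _ l (g ^+ e.+1) (q i) l0.
  by rewrite -E big_cons -mulrA; exists (\prod_(j <- s) lf j * p i).
have [q1 Eq] := choice dq.
have [i|s' [g' [q' [ss Eg1 Ep]]]] := IH g q1 s0.
  by have Ei := E i; rewrite big_cons -mulrA in Ei; apply: (mulfI fl0); rewrite Ei Eq; ring.
by exists s', g', q'; split=> // x /ss; rewrite inE orbC => ->.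
Qed.

Variable M : 'M[K]_3.
Hypothesis uM : M \in unitmx.
Let c := row 0 M.

Definition affine0 : S -> {poly {poly K}} :=
  mmap (polyC \o polyC) (fun i : 'I_3 => if i == 0 then 'X else if i == 1 then 'X%:P else 1).

(* In the coordinates given by the rows [c], [q1], [q0] of [M], the form [p]
   is sent to the polynomial [p(q0 + x q1 + z c)] of [K[x][z]]. *)
Definition affine : S -> {poly {poly K}} := affine0 \o lsub M.
HB.instance Definition _ := GRing.RMorphism.copy affine
  (mmap (polyC \o polyC) (fun i : 'I_3 => if i == 0 then 'X else if i == 1 then 'X%:P else 1) \o lsub M).

Lemma affineD : {morph affine : p q / p + q}. Proof. exact: rmorphD. Qed.

Lemma affineB : {morph affine : p q / p - q}. Proof. exact: rmorphB. Qed.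

Lemma affineM : {morph affine : p q / p * q}. Proof. exact: rmorphM. Qed.

Definition coord (i : 'I_3) : S := lf (col i (invmx M)).

Lemma lsub_coord i : lsub M (coord i) = 'X_i.
Proof.
rewrite /coord lsub_lf -lf_delta; congr lf.
by rewrite colE mulmxA mulmxV // mul1mx.
Qed.

Lemma hm_coord i : hm 1 (coord i). Proof. exact: hm_lf. Qed.

Lemma affineC x : affine x%:MP = x%:P%:P.
Proof. by rewrite /affine /= lsubC /affine0 mmapC. Qed.

Lemma affine_coord i : affine (coord i) = if i == 0 then 'X else if i == 1 then 'X%:P else 1.
Proof. by rewrite /affine /= lsub_coord /affine0 mmapX mmap1U. Qed.

Lemma affineE p a b :
  (affine p).[b%:P].[a] = p.@[(b *: row 0 M + a *: row 1 M + row 2 M) 0].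
Proof.
pose y : 'rV[K]_3 := \row_i if i == 0 then b else if i == 1 then a else 1.
have -> : b *: row 0 M + a *: row 1 M + row 2 M = y *m M.
  by apply/rowP => j; rewrite !mxE sum3 !mxE /= mul1r.
rewrite -lsub_meval /affine /=; move: (lsub M p); apply: (rmorph_mpoly_eq
  (f := horner_eval a \o (horner_eval b%:P \o
    mmap (polyC \o polyC) (fun i : 'I_3 => if i == 0 then 'X else if i == 1 then 'X%:P else 1)))) => [x|i] /=.
  by rewrite mmapC /horner_eval /= !hornerC mevalC.
rewrite mmapX mmap1U /horner_eval mevalXU mxE.
by case: (I3P i) => -> /=; rewrite ?hornerX ?hornerC ?hornerX.
Qed.

#[global] Opaque affine.

Lemma affine_inj (k : nat) p : hm k%:Z p -> affine p = 0 -> p = 0.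
Proof.
move=> hp p0; have L2 : coord 2 != 0.
  by apply/eqP => E; have := affine_coord 2; rewrite E rmorph0 /= => /esym/eqP; rewrite oner_eq0.
(* Multiplication by [coord 2] produces a polynomial that also vanishes on the line at infinity,
   which the affine chart does not see. *)
apply: (mulfI L2); rewrite mulr0; apply: meval_eq0 => v; rewrite mevalM.
have [y Ev] : exists y, v = y *m M by exists (v *m invmx M); rewrite mulmxKV.
have -> : (coord 2).@[v 0] = y 0 2.
  by rewrite /coord lf_meval Ev colE mulmxA mulmxK // -colE mxE.
have [->|y2] := eqVneq (y 0 2) 0; first by rewrite mul0r.
have -> : v = y 0 2 *: (y 0 0 / y 0 2 *: row 0 M + y 0 1 / y 0 2 *: row 1 M + row 2 M).
  rewrite Ev; apply/rowP => j; rewrite !mxE sum3 .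
  by field.
by rewrite (hm_meval _ _ hp) -affineE p0 !horner0 mulr0 mulr0.
Qed.

(** Since every large degree is available, several polynomials can be homogenized to matching
    degrees, and [affine_inj] then turns affine identities into identities of forms. *)
Lemma affine_lift g : exists k0 : nat, forall k : nat, (k0 <= k)%N ->
  exists2 p, hm k%:Z p & affine p = g.
Proof.
pose good g := exists k0 : nat, forall k : nat, (k0 <= k)%N ->
  exists2 p, hm k%:Z p & affine p = g.
have goodM g1 g2 : good g1 -> good g2 -> good (g1 * g2).
  move=> [k1 H1] [k2 H2]; exists (k1 + k2)%N => k lek.
  have [p1 hp1 <-] := H1 k1 (leqnn _).
  have [|p2 hp2 <-] := H2 (k - k1)%N; first lia.
  exists (p1 * p2); last by rewrite rmorphM.
  by rewrite -(@subnKC k1 k) ?PoszD; [apply: hmM|lia].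
have goodD g1 g2 : good g1 -> good g2 -> good (g1 + g2).
  move=> [k1 H1] [k2 H2]; exists (k1 + k2)%N => k lek.
  have [|p1 hp1 <-] := H1 k; first lia.
  have [|p2 hp2 <-] := H2 k; first lia.
  by exists (p1 + p2); rewrite ?rmorphD //; apply: hmD.
have hx k : hm k%:Z (coord 2 ^+ k) by have := hm_exp k (hm_coord 2); rewrite natz.
have x1 k : affine (coord 2 ^+ k) = 1 by rewrite rmorphXn /= affine_coord expr1n.
have goodX i : good (affine (coord i)).
  exists 1%N => -[//|k] _; exists (coord i * coord 2 ^+ k); last by rewrite rmorphM /= x1 mulr1.
  by rewrite -[k.+1]add1n PoszD; apply: hmM => //; exact: hm_coord.
have goodC x : good x%:P%:P.
  exists 0%N => k _; exists (x%:MP * coord 2 ^+ k); last by rewrite rmorphM /= x1 mulr1 affineC.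
  by rewrite -[k%:Z]add0r; apply: hmM => //; exact: hmC.
have goodP x : good x%:P.
  elim/poly_ind: x => [|x y IH]; first by have := goodC 0; rewrite polyC0.
  rewrite polyCD polyCM; apply: (goodD) => //; apply: (goodM) => //.
  by have := goodX 1; rewrite affine_coord.
rewrite -/(good g); elim/poly_ind: g => [|x y IH]; first by have := goodP 0.
apply: (goodD) => //; apply: (goodM) => //.
by have := goodX 0; rewrite affine_coord.
Qed.

Lemma affine_lf l :
  affine (lf l) = ((M *m l) 0 0)%:P%:P * 'X + (((M *m l) 1 0)%:P * 'X + ((M *m l) 2 0)%:P)%:P.
Proof.
have -> : lf l = \sum_j ((M *m l) j 0)%:MP * coord j.
  rewrite -{1}[l](mulKmx uM); move: (M *m l) => m.
  have -> : invmx M *m m = \sum_j m j 0 *: col j (invmx M).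
    apply/colP => k; rewrite mxE summxE; apply: eq_bigr => j _; by rewrite !mxE mulrC.
  by rewrite !sum3 !lfD !lfZ !mul_mpolyC.
rewrite rmorph_sum sum3 /= !rmorphM /= !affineC !affine_coord /= mulr1.
by rewrite polyCD polyCM addrA.
Qed.

Lemma affine_deriv p : (affine p)^`() = affine (dirderiv c p).
Proof.
apply: deriv_rmorph => [x|i]; first by rewrite /= affineC derivC.
rewrite /= -lf_delta affine_lf derivD derivC addr0 derivM derivC mul0r add0r derivX mulr1.
by rewrite -colE !mxE -affineC.
Qed.

End Dehomogenization.

(** * Reduced forms and pencils of lines *)

Section Factors.
Variable K : numClosedFieldType.
Local Notation S := {mpoly K[3]}.

Definition grad (f : S) : 'rV[S]_3 := \row_i f^`M(i).

Lemma grad_euler (d : nat) f : hm d%:Z f -> dot (\row_i 'X_i) (grad f) = d%:R *: f.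
Proof. by move=> hf; rewrite -(hm_euler hf); apply: eq_bigr => i _; rewrite !mxE. Qed.

Section Affine.
Variable M : 'M[K]_3.
Hypothesis uM : M \in unitmx.

Lemma affine_lf_prod (s : seq 'cV[K]_3) : (forall l, l \in s -> row 0 M *m l = 0) ->
  exists y, affine M (\prod_(l <- s) lf l) = y%:P.
Proof.
elim: s => [_|l s IH H]; first by exists 1; rewrite big_nil rmorph1.
have [|y Ey] := IH; first by move=> l' ls; apply: H; rewrite inE ls orbT.
have l0 : (M *m l) 0 0 = 0.
  by have := H l (mem_head _ _); rewrite -row_mul => /rowP/(_ 0); rewrite !mxE.
by rewrite big_cons affineM Ey affine_lf // l0 mul0r add0r -polyCM; eexists.
Qed.

(** A polynomial in [x] alone splits into linear factors, and each root is a line through the point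
    [row 0 M]; copies of the line at infinity, which also passes through that point, adjust the
    degree. Denominators cleared from identities over [K(x)] thus become products of lines through
    the point. *)
Lemma affine_const_lift (D : {poly K}) : D != 0 -> exists k0 : nat, forall k : nat, (k0 <= k)%N ->
  exists x s, [/\ x != 0, forall l, l \in s -> l != 0 /\ row 0 M *m l = 0,
    hm k%:Z (x%:MP * \prod_(l <- s) lf l : S) & affine M (x%:MP * \prod_(l <- s) lf l) = D%:P].
Proof.
move=> D0; have [r Er] := closed_field_poly_normal D; exists (size r) => k lek.
pose C j := col j (invmx M).
pose s := [seq C 1 - z *: C 2 | z <- r] ++ nseq (k - size r) (C 2).
have MC j : M *m C j = delta_mx j 0 by rewrite /C colE mulmxA mulmxV // mul1mx.
have M0C j : j != 0 -> row 0 M *m C j = 0.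
  move=> j0; rewrite -row_mul MC; apply/matrixP => a b.
  by rewrite !mxE eq_sym (negPf j0).
have C0 j : C j != 0.
  apply/eqP => E; have := MC j; rewrite E mulmx0 => /colP/(_ j)/eqP.
  by rewrite !mxE !eqxx eq_sym oner_eq0.
exists (lead_coef D), s; split.
- by rewrite lead_coef_eq0.
- move=> l; rewrite mem_cat => /orP[/mapP[z _ ->]|/nseqP[-> _]]; last by rewrite M0C.
  split; last by rewrite mulmxBr -scalemxAr !M0C // scaler0 subrr.
  apply/eqP => E; have := congr1 (fun t => M *m t) E.
  rewrite mulmxBr -scalemxAr !MC mulmx0 => /colP/(_ 1)/eqP.
  by rewrite !mxE /= mulr0 subr0 oner_eq0.
- rewrite -[k%:Z]add0r; apply: hmM; first exact: hmC.
  have <- : size s = k by rewrite size_cat size_map size_nseq subnKC.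
  elim: (s) => [|l t IH]; first by rewrite big_nil; exact: hm1.
  by rewrite big_cons /= -[(size t).+1]add1n PoszD; apply: hmM => //; exact: hm_lf.
rewrite affineM affineC [in RHS]Er -mul_polyC polyCM; congr (_ * _).
rewrite rmorph_prod /= big_cat /= [X in _ * X]big1_seq; last first.
  by move=> l /nseqP[-> _]; rewrite affine_lf // MC !mxE /= mul0r add0r polyC0 mul0r add0r.
rewrite mulr1 big_map rmorph_prod; apply: eq_bigr => z _.
rewrite affine_lf // mulmxBr -scalemxAr !MC !mxE /=.
by rewrite !mulr0 !subr0 sub0r mulr1 !polyC0 mul0r add0r polyCN !polyC1 mul1r.
Qed.

End Affine.

(** A repeated factor of positive degree in [z], once denominators in [x] are cleared, homogenizes
    to [lines * f = g ^+ 2 * h]. Cancelling the lines leaves a square dividing [f], whose root must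
    be constant; so [g] is a product of lines through [row 0 M], which has degree 0 in [z]. *)
Lemma reduced_separable (M : 'M[K]_3) (d : nat) f : M \in unitmx ->
  hm d%:Z f -> f != 0 -> (forall g h, f = g ^+ 2 * h -> (msize g <= 1)%N) ->
  separable_poly (affine M f).
Proof.
move=> uM hf f0 fred.
have p0 : affine M f != 0 by apply/eqP => /(affine_inj uM hf)/eqP; rewrite (negPf f0).
have charP (n : nat) : (n.+1%:R : {poly K}) != 0 by rewrite -polyC_natr polyC_eq0 pnatr_eq0.
apply/separable_polyP; split; last first.
  (* In characteristic zero the leading term of a polynomial of positive degree survives
     derivation. *)
  move=> u _ su; have u0 : u != 0 by rewrite -size_poly_gt0 ltnW.
  apply/eqP => /polyP/(_ (size u).-2); rewrite coef_deriv coef0.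
  have -> : (size u).-2.+1 = (size u).-1 by case: (size u) su => [|[]].
  rewrite -mulr_natr => /eqP; rewrite mulf_eq0 -lead_coefE lead_coef_eq0 (negPf u0) /=.
  by case: (size u) su => [|[|n]] //= _; rewrite (negPf (charP n)).
apply/poly_square_freeP => u su; apply/negP => /Pdiv.Idomain.dvdpP[[D q] /= D0 E].
have u0 : u != 0.
  by apply: contraNneq p0 => u0; move: E; rewrite u0 expr0n /= mulr0 => /eqP; rewrite -mul_polyC mulf_eq0 polyC_eq0 (negPf D0).
have [k1 H1] := affine_lift uM u; have [k2 H2] := affine_lift uM q.
have [k3 H3] := affine_const_lift uM D0.
pose k := (k1 + k2 + k3 + d)%N.
have [|g hg Eg] := H1 k; first by rewrite /k; lia.
have [|h hh Eh] := H2 k; first by rewrite /k; lia.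
have [|x [s [x0 sP hs Es]]] := H3 (k + k + k - d)%N; first by rewrite /k; lia.
have Ef : (\prod_(l <- s) lf l) * f = g ^+ 2 * (x^-1%:MP * h).
  apply: (mulfI (x := x%:MP)); first by rewrite mpolyC_eq0.
  rewrite [RHS]mulrCA [X in _ = _ * X]mulrA -mpolyCM mulfV // mpolyC1 mul1r [LHS]mulrA.
  apply/eqP; rewrite -subr_eq0; apply/eqP/(affine_inj uM (k := (k + k + k)%N)).
    apply: hmB; first by rewrite -(@subnK d (k + k + k)) ?PoszD; [exact: hmM|rewrite /k; lia].
    by rewrite !PoszD; apply: hmM => //; rewrite expr2; apply: hmM.
  rewrite affineB (affineM _ _ f) Es (affineM _ _ h) expr2 (affineM _ g g) Eg Eh.
  by rewrite mul_polyC E expr2 mulrC subrr.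
have [||s' [g' [h' [ss Eg' Ef']]]] := @lf_prod_cancel K unit 1 s (fun=> f) (fun=> x^-1%:MP * h) g.
- by apply/allP => l /sP[].
- by move=> _; rewrite Ef.
have g'1 := fred _ _ (Ef' tt).
have [|y Ey] := affine_lf_prod uM (s := s'); first by move=> l /ss/sP[].
case/negP: su; rewrite eqn_leq size_poly_gt0 u0 andbT -Eg Eg' affineM Ey.
by rewrite (msize1_polyC g'1) (affineC M) -polyCM size_polyC_leq1.
Qed.

(** Projection from a point [c] off the curve: by separability, Bezout for [f] and its derivative in
    the direction [c] yields a nonzero polynomial in the parameter of the pencil, that is, a product
    of lines through [c]. Both terms lie in the Jacobian ideal, [f] by Euler's formula. *)
Lemma reduced_jacobian_forms (d : nat) f : (0 < d)%N ->
  hm d%:Z f -> f != 0 -> (forall g h, f = g ^+ 2 * h -> (msize g <= 1)%N) ->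
  exists (c : 'rV[K]_3) s u, [/\ f.@[c 0] != 0,
    forall l, l \in s -> l != 0 /\ c *m l = 0
    & \prod_(l <- s) lf l = dot u (grad f)].
Proof.
move=> d0 hf f0 fred; have [c fc] := exists_meval_neq0 f0.
have c0 : c != 0.
  apply: contraNneq fc => ->; rewrite -(scale0r 0) (hm_meval _ _ hf) expr0n.
  by case: (d) d0 => // n _; rewrite mul0r.
have [M uM Mc] := exists_unitmx_row c0.
have := reduced_separable uM hf f0 fred.
rewrite separable_poly.unlock => /Bezout_coprimepP[[U V] /= /eqpP[[D1 D2] /= /andP[D10 D20] E]].
have [k1 H1] := affine_lift uM (D1%:P * U); have [k2 H2] := affine_lift uM (D1%:P * V).
have [k3 H3] := affine_const_lift uM D20.
pose k := (k1 + k2 + k3 + d)%N.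
have [|g hg Eg] := H1 (k - d)%N; first by rewrite /k; lia.
have [|h hh Eh] := H2 (k - d).+1; first by rewrite /k; lia.
have [|x [s [x0 sP hs Es]]] := H3 k; first by rewrite /k; lia.
have hdf := hm_dirderiv c hf; set df := dirderiv c f in hdf.
have Ex : x%:MP * \prod_(l <- s) lf l = g * f + h * df.
  apply/eqP; rewrite -subr_eq0; apply/eqP/(affine_inj uM (k := k)).
    apply: hmB => //; apply: hmD; first by rewrite -(@subnK d k) ?PoszD; [apply: hmM|rewrite /k; lia].
    rewrite (_ : k%:Z = (k - d).+1%:Z + (d%:Z - 1)); first exact: hmM.
    by rewrite /k; lia.
  rewrite affineB Es affineD (affineM M g) (affineM M h) Eg Eh /df.
  rewrite -Mc -affine_deriv //.
  by rewrite -!mulrA -mulrDr mul_polyC E -mul_polyC mulr1 subrr.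
exists c, s, (x^-1%:MP *: (g *: ((d%:R^-1)%:MP *: \row_i 'X_i) + h *: map_mx (@mpolyC 3 K) c)).
split=> //; first by move=> l /sP; rewrite Mc.
have dK : d%:R != 0 :> K by rewrite pnatr_eq0 -lt0n.
rewrite dotZl dotDl (dotZl g) (dotZl h) dotZl (grad_euler hf).
rewrite [X in g * X]mul_mpolyC scalerA mulVf // scale1r.
have -> : dot (map_mx (@mpolyC 3 K) c) (grad f) = df.
  by apply: eq_bigr => i _; rewrite !mxE mul_mpolyC.
by rewrite -Ex mulrA -mpolyCM mulVf // mpolyC1 mul1r.
Qed.

Lemma idomain_bezout (R : idomainType) (p q : {poly R}) :
  exists D u v, D != 0 /\ D *: gcdp p q = u * p + v * q.
Proof.
have [[u v] /= /eqpP[[D1 D2] /= /andP[D10 D20] E]] := Bezoutp p q.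
exists D2, (D1 *: u), (D1 *: v); split=> //.
by rewrite -E scalerDr !scalerAl.
Qed.

Lemma gcd3_bezout (R : idomainType) (P : 'I_3 -> {poly R}) i0 : P i0 != 0 ->
  (exists D u, D != 0 /\ D%:P = \sum_i u i * P i) \/
  (exists k (g : {poly R}) q, [/\ k != 0, (1 < size g)%N & forall i, k *: P i = q i * g]).
Proof.
move=> Pi0.
have [D1 [u0 [u1 [D10 E1]]]] := idomain_bezout (P 0) (P 1).
have [D2 [v0 [v1 [D20 E2]]]] := idomain_bezout (gcdp (P 0) (P 1)) (P 2).
set g := gcdp (gcdp _ _) _ in E2.
have gP i : g %| P i.
  case: (I3P i) => ->; rewrite /g ?dvdp_gcdr //.
    by rewrite (dvdp_trans (dvdp_gcdl _ _)) ?dvdp_gcdl.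
  by rewrite (dvdp_trans (dvdp_gcdl _ _)) ?dvdp_gcdr.
have g0 : g != 0 by apply: contraNneq Pi0 => g0; have := gP i0; rewrite g0 dvd0p.
have [g1|g1] := eqVneq (size g) 1%N; [left|right].
  have [y y0 Eg] : exists2 y, y != 0 & g = y%:P by apply/size_poly1P/eqP.
  exists (D1 * D2 * y), (fun i => if i == 0 then v0 * u0 else if i == 1 then v0 * u1 else D1%:P * v1).
  split; first by rewrite !mulf_neq0.
  rewrite -mul_polyC in E1; rewrite -mul_polyC in E2.
  rewrite sum3 /= !polyCM -Eg -mulrA E2.
  transitivity (v0 * (D1%:P * gcdp (P 0) (P 1)) + D1%:P * v1 * P 2); first by ring.
  by rewrite E1; ring.
have /choice[cq cqP] : forall i, exists cq : R * {poly R}, cq.1 != 0 /\ cq.1 *: P i = cq.2 * g.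
  by move=> i; have /Pdiv.Idomain.dvdpP[cq ? ?] := gP i; exists cq.
exists (\prod_j (cq j).1), g, (fun i => (\prod_(j | j != i) (cq j).1) *: (cq i).2); split.
- by apply/prodf_neq0 => i _; have [] := cqP i.
- by rewrite ltn_neqAle eq_sym g1 size_poly_gt0.
by move=> i; rewrite (bigD1 i) //= mulrC -scalerA (proj2 (cqP i)) scalerAl.
Qed.

Lemma comb_root (R : comNzRingType) (P : 'I_3 -> {poly {poly R}}) D u a b :
  D%:P = \sum_i u i * P i -> (forall i, (P i).[b].[a] = 0) -> D.[a] = 0.
Proof.
move=> E P0; rewrite -[D in LHS](hornerC _ b) E sum3 !hornerD !hornerM.
by rewrite !P0 !mulr0 !addr0.
Qed.

(** In the pencil of lines through a point [c] where [p i0] is nonzero, Bezout gives a nonzero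
    polynomial [D] whose roots contain the lines through the other common zeros; a line [x = a] with
    [D.[a] != 0] avoids them. If there is no such [D], the forms have a common factor of positive
    degree in [z], which homogenizes to a common factor excluded by hypothesis. *)
Lemma common_zero_free_line (r : nat) (p : 'I_3 -> S) i0 : (0 < r)%N ->
  (forall i, hm r%:Z (p i)) -> p i0 != 0 ->
  (forall g q, (forall i, p i = g * q i) -> (msize g <= 1)%N) ->
  exists2 l : 'cV[K]_3, l != 0 &
    forall v : 'rV[K]_3, v != 0 -> v *m l = 0 -> exists i, (p i).@[v 0] != 0.
Proof.
move=> r0 hp pi0 prim; have [c pc] := exists_meval_neq0 pi0.
have c0 : c != 0.
  apply: contraNneq pc => ->; rewrite -(scale0r 0) (hm_meval _ _ (hp i0)) expr0n.
  by case: (r) r0 => // n _; rewrite mul0r.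
have [M uM Mc] := exists_unitmx_row c0.
pose P i := affine M (p i).
have Pi0 : P i0 != 0 by apply/eqP => /(affine_inj uM (hp i0))/eqP; rewrite (negPf pi0).
have [[D [U [D0 ED]]]|[k [g [q [k_0 g1 Eq]]]]] := gcd3_bezout Pi0.
  have [a Da] : exists a, D.[a] != 0.
    have [s us ss] : exists2 s : seq K, uniq s & size s = size D.
      exists [seq i%:R | i <- iota 0 (size D)]; last by rewrite size_map size_iota.
      by rewrite map_inj_uniq ?iota_uniq //; exact: (mulrIn (oner_neq0 _)).
    apply: contrapT => H; have := max_poly_roots D0 _ us; rewrite ss ltnn.
    suff /[swap] /[apply] : all (root D) s by [].
    by apply/allP => t _; apply: contrapT => /negP Dt; apply: H; exists t.
  pose l : 'cV[K]_3 := col 1 (invmx M) - a *: col 2 (invmx M).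
  have Ml : M *m l = delta_mx 1 0 - a *: delta_mx 2 0.
    by rewrite /l mulmxBr -scalemxAr !colE !mulmxA mulmxV // !mul1mx.
  exists l.
    apply/eqP => l0; have := Ml; rewrite l0 mulmx0 => /colP/(_ 1)/eqP.
    by rewrite !mxE /= mulr0 subr0 eq_sym oner_eq0.
  move=> v v_0 vl; have [y' Ev] : exists y', v = y' *m M by exists (v *m invmx M); rewrite mulmxKV.
  have y1 : y' 0 1 = a * y' 0 2.
    move: vl; rewrite Ev -mulmxA Ml mulmxBr -scalemxAr -!colE => /colP/(_ 0)/eqP.
    by rewrite !mxE subr_eq0 => /eqP.
  (* The only point at infinity of the chosen line is [c], where [p i0] does not vanish. *)
  have [y2|y2] := eqVneq (y' 0 2) 0.
    have Ev' : v = y' 0 0 *: c.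
      by rewrite Ev -Mc; apply/rowP => j; rewrite !mxE sum3 y1 y2 mulr0 !mul0r !addr0.
    exists i0; rewrite Ev' (hm_rescale _ (hp i0)) //.
    by apply: contraNneq v_0 => E; rewrite Ev' E scale0r.
  apply: contrapT => H; case/negP: Da; apply/eqP.
  have Ev' : v = y' 0 2 *: (y' 0 0 / y' 0 2 *: row 0 M + a *: row 1 M + row 2 M).
    by rewrite Ev; apply/rowP => j; rewrite !mxE sum3 y1; field.
  have P0 i : (P i).[(y' 0 0 / y' 0 2)%:P].[a] = 0.
    rewrite affineE; apply/eqP; rewrite -(hm_rescale _ (hp i) y2) -Ev'.
    by apply: contraT => ?; case: H; exists i.
  exact: comb_root ED P0.
have [n1 H1] := affine_lift uM g.
have /choice[n2 H2] i := affine_lift uM (q i).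
have [n3 H3] := affine_const_lift uM k_0.
pose n := (n1 + n2 0%R + n2 1%R + n2 2%R + n3 + r)%N.
have n2n i : (n2 i <= n)%N by case: (I3P i) => ->; rewrite /n; lia.
have [|G hG EG] := H1 n; first by rewrite /n; lia.
have /choice[Q HQ] i : exists Q, hm n%:Z Q /\ affine M Q = q i.
  by have [Q] := H2 i n (n2n i); exists Q.
have [|x [s [x0 sP hs Es]]] := H3 (n + n - r)%N; first by rewrite /n; lia.
have [||s' [G' [Q' [ss EG' Ep]]]] := @lf_prod_cancel K _ 0 s p (fun i => x^-1%:MP * Q i) G.
- by apply/allP => l /sP[].
- move=> i; apply: (mulfI (x := x%:MP)); first by rewrite mpolyC_eq0.
  rewrite expr1 [RHS]mulrCA [X in _ = _ * X]mulrA -mpolyCM mulfV // mpolyC1 mul1r [LHS]mulrA.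
  have [hQ EQ] := HQ i.
  apply/eqP; rewrite -subr_eq0; apply/eqP/(affine_inj uM (k := (n + n)%N)).
    apply: hmB; first by rewrite -(@subnK r (n + n)) ?PoszD; [apply: hmM|rewrite /n; lia].
    by rewrite !PoszD; apply: hmM.
  rewrite affineB (affineM _ _ (p i)) Es (affineM _ G) EQ EG.
  by rewrite mul_polyC Eq mulrC subrr.
have G'1 : (msize G' <= 1)%N by apply: (prim _ Q') => i; rewrite Ep expr1.
have [|y Ey] := affine_lf_prod uM (s := s'); first by move=> l /ss/sP[].
move: g1; rewrite ltnNge -EG EG' affineM Ey.
by rewrite (msize1_polyC G'1) (affineC M) -polyCM size_polyC_leq1.
Qed.

End Factors.

(** * Jacobian syzygies *)

Section Syzygies.
Variable K : numClosedFieldType.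
Local Notation S := {mpoly K[3]}.
Variables (d : nat) (f : S).

Definition reduced_eq : Prop :=
  [/\ (0 < d)%N, hm d%:Z f, f != 0 & forall g h, f = g ^+ 2 * h -> (msize g <= 1)%N].

Hypothesis Hf : reduced_eq.
Let d0 : (0 < d)%N. Proof. by case: Hf. Qed.
Let hf : hm d%:Z f. Proof. by case: Hf. Qed.
Let f0 : f != 0. Proof. by case: Hf. Qed.
Let fred : forall g h, f = g ^+ 2 * h -> (msize g <= 1)%N. Proof. by case: Hf. Qed.
Local Notation n := (grad f).

Definition hmv k m z (u : 'rV[{mpoly K[k]}]_m) : Prop := forall i, hm z (u 0 i).

Definition ar z (rho : 'rV[S]_3) : Prop := hmv z rho /\ dot rho n = 0.

Lemma hm_grad i : hm (d%:Z - 1) (n 0 i).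
Proof. by rewrite mxE; apply: hm_mderiv. Qed.

Lemma msize_lf (l : 'cV[K]_3) : l != 0 -> (1 < msize (lf l))%N.
Proof.
move=> l0; rewrite ltnNge; apply/negP => /msize1_polyC E.
have l0' : lf l != 0 by rewrite lf_eq0.
have h0 : hm 0 (lf l) by rewrite E; exact: hmC.
by have := hm_inj l0' (hm_lf l) h0.
Qed.

(** Otherwise the line divides [f] by Euler's formula, and differentiating [f = lf l * g] makes it
    divide [g] as well: its square divides [f]. *)
Lemma grad_line_neq0 (l : 'cV[K]_3) : l != 0 -> exists i, ~ mdvd (lf l) (n 0 i).
Proof.
move=> l0; apply: contrapT => H.
have dn i : mdvd (lf l) (n 0 i) by apply: contrapT => ?; apply: H; exists i.
have dK : d%:R != 0 :> K by rewrite pnatr_eq0 -lt0n.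
have [g Eg] : mdvd (lf l) f.
  have -> : f = d%:R^-1 *: dot (\row_i 'X_i) n.
    by rewrite (grad_euler hf) scalerA mulVf // scale1r.
  have /choice[q Eq] := dn; rewrite dotE !mxE.
  have Eq' i : f^`M(i) = lf l * q i by have := Eq i; rewrite mxE.
  exists (d%:R^-1 *: ('X_0 * q 0 + 'X_1 * q 1 + 'X_2 * q 2)).
  by rewrite !Eq' -scalerAr; congr (_ *: _); ring.
have [i li] : exists i, l i 0 != 0.
  apply: contrapT => H'; case/negP: l0; apply/eqP/colP => i; rewrite mxE.
  by apply/eqP; apply: contraT => ?; case: H'; exists i.
have dl : (lf l)^`M(i) = (l i 0)%:MP.
  have h := hm_mderiv i (hm_lf l); rewrite subrr in h.
  by rewrite (dhomog_const h) mcoeff_mderiv mnm0E add0m mcoeff_lf.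
have [h Eh] : mdvd (lf l) g.
  have [q] := dn i; rewrite mxE Eg mderivM dl => E.
  exists ((l i 0)^-1 *: (q - g^`M(i))).
  rewrite -scalerAr mulrBr -E addrK mul_mpolyC scalerA mulVf // scale1r //.
have := fred (g := lf l) (h := h); rewrite leqNgt msize_lf // => H'; suff: false by [].
by apply: H'; rewrite Eg Eh mulrA expr2.
Qed.

Lemma grad_neq0 : exists i, n 0 i != 0.
Proof.
have [|i ni] := @grad_line_neq0 (const_mx 1).
  by apply/eqP => /colP/(_ 0)/eqP; rewrite !mxE oner_eq0.
by exists i; apply/eqP => E; apply: ni; exists 0; rewrite E mulr0.
Qed.

Lemma gradv_neq0 : n != 0.
Proof. by have [j] := grad_neq0; apply: contraNneq => ->; rewrite mxE. Qed.

Lemma scale_grad_inj : injective (fun w => w *: n).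
Proof. exact: scalerv_inj gradv_neq0. Qed.

(** Over the fraction field [G] is a multiple of the gradient. A product of lines lying in the
    Jacobian ideal is a common denominator, and its lines cancel one at a time because none divides
    the whole gradient. *)
Lemma parallel_grad (G : 'rV[S]_3) : cross G n = 0 -> exists g, G = g *: n.
Proof.
move=> Gn; have [c [s [u [fc sP Es]]]] := reduced_jacobian_forms d0 hf f0 fred.
have Gij i j : G 0 i * n 0 j = G 0 j * n 0 i.
  have /rowP E := Gn; have := (E 0, E 1, E 2); rewrite !mxE /= => -[[e0 e1] e2].
  move/subr0_eq: e0; move/subr0_eq: e1; move/subr0_eq: e2 => e2 e1 e0.
  by case: (I3P i) => ->; case: (I3P j) => ->; rewrite ?mxE ?e0 ?e1 ?e2.
suff [g Eg] : exists g, forall j, G 0 j = g * n 0 j.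
  by exists g; apply/rowP => j; rewrite mxE.
have : exists g, forall j, (\prod_(l <- s) lf l) * G 0 j = g * n 0 j.
  exists (dot u G) => j; rewrite Es !dotE !mulrDl.
  by congr (_ + _ + _); rewrite -mulrA [n 0 _ * _]mulrC Gij mulrA.
elim: s {Es} sP => [_ [g Eg]|l s IH sP [g Eg]].
  by exists g => j; rewrite -Eg big_nil mul1r.
have [l0 _] := sP l (mem_head _ _).
apply: IH; first by move=> l' l's; apply: sP; rewrite inE l's orbT.
have [i ni] := grad_line_neq0 l0.
have [|[g' Eg']|//] := @lf_prime _ _ l g (n 0 i) l0.
  by rewrite -Eg big_cons -mulrA; exists ((\prod_(j <- s) lf j) * G 0 i).
exists g' => j; apply: (@mulfI _ (lf l)); first by rewrite lf_eq0.
by have := Eg j; rewrite big_cons -mulrA Eg' -mulrA.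
Qed.

(* The coordinate of [rho /\ rho'] on the generator [grad f] of the second
   exterior power of the syzygy bundle. *)
Definition omega rho rho' : S :=
  if pselect (exists w, cross rho rho' = w *: n) is left ex then sval (cid ex) else 0.

Lemma omegaE rho rho' : dot rho n = 0 -> dot rho' n = 0 ->
  cross rho rho' = omega rho rho' *: n.
Proof.
move=> e e'; rewrite /omega; case: pselect => [ex|[]]; first exact: svalP (cid ex).
by apply: parallel_grad; rewrite cross_crossl e e' !scale0r subrr.
Qed.

Lemma omega_uniq rho rho' w : dot rho n = 0 -> dot rho' n = 0 ->
  cross rho rho' = w *: n -> omega rho rho' = w.
Proof. by move=> e e' E; apply: scale_grad_inj; rewrite /= -omegaE. Qed.

#[global] Opaque omega.

Lemma omega_hm z z' rho rho' : ar z rho -> ar z' rho' ->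
  hm (z + z' - (d%:Z - 1)) (omega rho rho').
Proof.
move=> [hr e] [hr' e']; have [i ni] := grad_neq0.
apply: (hm_div ni (hm_grad i)).
have /rowP/(_ i) := omegaE e e'; rewrite [RHS]mxE mulrC => <-.
rewrite mxE; case: (I3P i) => -> /=; apply: hmB; first [exact: hmM | rewrite addrC; exact: hmM].
Qed.

Lemma omegaC rho rho' : dot rho n = 0 -> dot rho' n = 0 -> omega rho' rho = - omega rho rho'.
Proof. by move=> e e'; apply: omega_uniq => //; rewrite crossC omegaE // scaleNr. Qed.

Lemma omega_vv rho : dot rho n = 0 -> omega rho rho = 0.
Proof. by move=> e; apply: omega_uniq => //; rewrite crossvv scale0r. Qed.

Lemma dot_grad_comb a b c r1 r2 r3 : dot r1 n = 0 -> dot r2 n = 0 -> dot r3 n = 0 ->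
  dot (a *: r1 + b *: r2 + c *: r3) n = 0.
Proof. by move=> e1 e2 e3; rewrite !dotDl !dotZl e1 e2 e3 !mulr0 !addr0. Qed.

Lemma omega_combr rho a b c r1 r2 r3 :
  dot rho n = 0 -> dot r1 n = 0 -> dot r2 n = 0 -> dot r3 n = 0 ->
  omega rho (a *: r1 + b *: r2 + c *: r3) =
  a * omega rho r1 + b * omega rho r2 + c * omega rho r3.
Proof.
move=> e e1 e2 e3; apply: omega_uniq => //; first exact: dot_grad_comb.
by rewrite !crossDr !crossZr !omegaE // !scalerA -!scalerDl.
Qed.

Lemma omega_combl rho a b c r1 r2 r3 :
  dot rho n = 0 -> dot r1 n = 0 -> dot r2 n = 0 -> dot r3 n = 0 ->
  omega (a *: r1 + b *: r2 + c *: r3) rho =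
  a * omega r1 rho + b * omega r2 rho + c * omega r3 rho.
Proof.
move=> e e1 e2 e3; apply: omega_uniq => //; first exact: dot_grad_comb.
by rewrite !crossDl !crossZl !omegaE // !scalerA -!scalerDl.
Qed.

Lemma omega_plucker r1 r2 r3 : dot r1 n = 0 -> dot r2 n = 0 -> dot r3 n = 0 ->
  omega r1 r2 *: r3 - omega r1 r3 *: r2 + omega r2 r3 *: r1 = 0.
Proof.
by move=> e1 e2 e3; apply: (orthogonal_plucker gradv_neq0) => //; exact: omegaE.
Qed.

Definition koszul (w : 'rV[S]_3) : 'rV[S]_3 := cross w n.

Lemma koszul_syz w : dot (koszul w) n = 0.
Proof. by rewrite dotC dot_crossr. Qed.

Lemma koszul_ar z w : hmv z w -> ar (z + (d%:Z - 1)) (koszul w).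
Proof.
move=> hw; split; last exact: koszul_syz.
move=> i; rewrite mxE; case: (I3P i) => -> /=; apply: hmB; apply: hmM => //; exact: hm_grad.
Qed.

(** For [rho = rho1] and [w] a basis vector, this puts every entry of [rho1] among the forms
    [omega rho1 _] up to sign, so that [rho1] vanishes at the points of [Z(C, rho1)]. *)
Lemma omega_koszul rho w : dot rho n = 0 -> omega rho (koszul w) = - dot rho w.
Proof.
move=> e; apply: omega_uniq => //; first exact: koszul_syz.
by rewrite /koszul cross_crossr e scale0r sub0r scaleNr.
Qed.

Lemma omega_koszul2 w w' : omega (koszul w) (koszul w') = dot n (cross w w').
Proof.
apply: omega_uniq; try exact: koszul_syz.
rewrite /koszul cross_crossl dot_crossr scale0r subr0.
by rewrite dot_cross_cycle.
Qed.

(** The Koszul syzygies of the two coordinate vectors other than the one of index [i]; hence some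
    [omega] is nonzero wherever the gradient is. *)
Lemma grad_omega i : exists r1 r2 : 'rV[S]_3,
  [/\ ar (d%:Z - 1) r1, ar (d%:Z - 1) r2 & omega r1 r2 = n 0 i].
Proof.
have hd j : hmv 0 (delta_mx 0 j : 'rV[S]_3).
  by move=> k; rewrite mxE; case: (_ && _); [exact: hm1|exact: hm0].
have ha j : ar (d%:Z - 1) (koszul (delta_mx 0 j)).
  by rewrite -[X in ar X _]add0r; apply: koszul_ar.
pose j1 : 'I_3 := if i == 0 then 1 else if i == 1 then 2 else 0.
pose j2 : 'I_3 := if i == 0 then 2 else if i == 1 then 0 else 1.
exists (koszul (delta_mx 0 j1)), (koszul (delta_mx 0 j2)); split=> //.
rewrite omega_koszul2 dotE; rewrite /j1 /j2.
by case: (I3P i) => -> /=; rewrite !mxE /=; ring.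
Qed.

End Syzygies.

Section VectorIdentities.
Variable T : comNzRingType.
Implicit Types (a b g x y w : T) (r e : 'rV[T]_3).

Lemma reduce_by_pair g b x1 x2 w1 w2 a o1 o2 r e1 e2 :
  b *: r - o1 *: e2 + o2 *: e1 = 0 ->
  g * o1 = x1 * b + a * w1 -> g * o2 = x2 * b + a * w2 ->
  b *: (g *: r - x1 *: e2 + x2 *: e1) = a *: (w1 *: e2 - w2 *: e1).
Proof.
move=> /rowP E E1 E2; apply/rowP => j; have := E j; rewrite !mxE => /eqP.
rewrite addr_eq0 subr_eq => /eqP br.
transitivity (g * (b * r 0 j) - b * x1 * e2 0 j + b * x2 * e1 0 j); first by ring.
rewrite br; transitivity ((g * o1) * e2 0 j - (g * o2) * e1 0 j - b * x1 * e2 0 j + b * x2 * e1 0 j).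
  by ring.
by rewrite E1 E2; ring.
Qed.

Lemma compose_reduction g a b x1 x2 y1 y2 r r' r'' e1 e2 :
  r = x1 *: e1 + x2 *: e2 + b *: r' -> g *: r' = y1 *: e1 + y2 *: e2 + a *: r'' ->
  g *: r = (g * x1 + b * y1) *: e1 + (g * x2 + b * y2) *: e2 + (b * a) *: r''.
Proof.
move=> -> /rowP E; apply/rowP => j; have := E j; rewrite !mxE => Ej.
rewrite mulrDr mulrDr [g * (b * _)]mulrCA Ej; ring.
Qed.

Lemma reduction_solved g a x1 x2 r r' e1 e2 :
  g *: r - x1 *: e2 + x2 *: e1 = a *: r' ->
  g *: r = (- x2) *: e1 + x1 *: e2 + a *: r'.
Proof. by move=> <-; apply/rowP => j; rewrite !mxE; ring. Qed.

Lemma dot_mod r (h o c : T) (u a b : 'rV[T]_3) :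
  (forall i, h * r 0 i = a 0 i * o + c * b 0 i) -> h * dot u r = dot u a * o + c * dot u b.
Proof.
move=> E; rewrite !dotE.
transitivity (u 0 0 * (h * r 0 0) + u 0 1 * (h * r 0 1) + u 0 2 * (h * r 0 2)); first by ring.
by rewrite !E; ring.
Qed.

End VectorIdentities.

(** * Local freeness of the syzygy bundle *)

Section LocalFreeness.
Variable K : numClosedFieldType.
Local Notation S := {mpoly K[3]}.
Variables (d : nat) (f : S).
Hypothesis Hf : reduced_eq d f.
Local Notation n := (grad f).

Lemma cross_eq0_scale (c p : 'rV[K]_3) : c != 0 -> cross c p = 0 -> exists t, p = t *: c.
Proof.
move=> c0 /rowP E; have := (E 0, E 1, E 2); rewrite !mxE /= => -[[/subr0_eq e0 /subr0_eq e1] /subr0_eq e2].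
have [i ci] := rV0Pn _ c0.
exists (p 0 i / c 0 i); apply/rowP => j; rewrite mxE; apply: (mulfI ci).
rewrite [RHS]mulrA [c 0 i * (_ / _)]mulrC divfK //.
rewrite [RHS]mulrC; case: (I3P i) => ->; case: (I3P j) => ->;
  by [|rewrite e0|rewrite -e0|rewrite e1|rewrite -e1|rewrite e2|rewrite -e2].
Qed.

Lemma row_mul_dot (T : comNzRingType) (u : 'rV[T]_3) (v : 'cV[T]_3) : (u *m v) 0 0 = dot u v^T.
Proof. by rewrite mxE; apply: eq_bigr => i _; rewrite mxE. Qed.

Lemma row_mul_eq0 (T : comNzRingType) (u : 'rV[T]_3) (v : 'cV[T]_3) : (u *m v = 0) <-> dot u v^T = 0.
Proof.
rewrite -row_mul_dot; split=> [->|E]; first by rewrite mxE.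
by apply/matrixP => i j; rewrite !ord1 E mxE.
Qed.

Lemma lf_exp_prime m (l : 'cV[K]_m) k (a b : {mpoly K[m]}) : l != 0 ->
  ~ mdvd (lf l) a -> mdvd (lf l ^+ k) (a * b) -> mdvd (lf l ^+ k) b.
Proof.
move=> l0 na; have l0' : lf l != 0 by rewrite lf_eq0.
elim: k b => [|k IH] b; first by move=> _; exists b; rewrite mul1r.
move=> [q Eq]; have [|//|[b' Eb]] := @lf_prime _ m l a b l0.
  by rewrite Eq exprS -mulrA; exists (lf l ^+ k * q).
have [|c Ec] := IH b'.
  by exists q; apply: (mulfI l0'); rewrite [RHS]mulrA -exprS -Eq Eb; ring.
by exists c; rewrite Eb Ec exprS mulrA.
Qed.

Section Point.
Variables (p : 'rV[K]_3) (l0 : 'cV[K]_3).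
Hypothesis p0 : p != 0.
Hypothesis l0_neq0 : l0 != 0.
Hypothesis pl0 : p *m l0 = 0.
Local Notation alpha := (lf l0).

(* Near [p], the syzygies are generated by [e1] and [e2] up to multiples of
   [alpha]; iterating replaces [alpha] by any of its powers. *)
Lemma local_generators : exists k1 k2 z e1 e2 G,
  [/\ ar f k1 e1 /\ ar f k2 e2, hm z G, G.@[p 0] != 0, ~ mdvd alpha (omega f e1 e2)
    & forall m k rho, ar f k rho -> exists x1 x2 k' rho', ar f k' rho' /\
        G ^+ m *: rho = x1 *: e1 + x2 *: e2 + alpha ^+ m *: rho'].
Proof.
have [F] := exists_line_frame l0_neq0; pose r := res F.
have ra x : r (alpha * x) = 0 by rewrite /r resM res_lf mul0r.
pose fam (x : {mpoly K[2]}) := exists k k' e e',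
  [/\ ar f k e, ar f k' e' & x = r (omega f e e')].
have famh x : fam x -> exists z, hm z x.
  move=> [k [k' [e [e' [ae ae' ->]]]]]; exists (k + k' - (d%:Z - 1)).
  exact/res_hm/(omega_hm Hf).
have d1 : (0 < d)%N by case: Hf.
have [i ni] := grad_line_neq0 Hf l0_neq0.
have [r1 [r2 [ar1 ar2 Er]]] := grad_omega Hf i.
have [|||m [g [hg g0 gfam gnz]]] := @family_gcd K fam d.-1 (r (n 0 i)) famh.
- by exists (d%:Z - 1), (d%:Z - 1), r1, r2; rewrite Er.
- by apply/eqP => /(res_eq0P F)/ni.
- rewrite (_ : d.-1%:Z = d%:Z - 1); first exact/res_hm/(hm_grad Hf).
  by lia.
pose P := p *m frame_out F.
(* [omega f e1 e2] restricts to the common divisor [g] times a form [y] that is nonzero at [p]; so,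
   modulo [alpha] and up to the factor [G], it divides every other [omega]. *)
have [y [k1 [k2 [e1 [e2 [ae1 ae2 Ey]]]]] yP] := gnz P (frame_out_neq0 F pl0 p0).
pose G := lft F y; pose de := omega f e1 e2.
have hde := omega_hm Hf ae1 ae2; rewrite -/de in hde.
pose z := k1 + k2 - (d%:Z - 1) - m%:Z.
have y0 : y != 0 by apply: contraNneq yP => ->; rewrite meval0.
have hy : hm z y by apply: (hm_div g0 hg); rewrite Ey; exact: res_hm.
have hG : hm z G by exact: lft_hm.
have Gp : G.@[p 0] != 0 by rewrite -(res_meval_out F G pl0) /G lftK.
have nde : ~ mdvd alpha de.
  move=> /(res_eq0P F); rewrite -/r -Ey => /eqP; rewrite mulf_eq0 (negPf g0) (negPf y0) //.
exists k1, k2, z, e1, e2, G; split=> //.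
have [_ s1] := ae1; have [_ s2] := ae2.
have step k j e rho : ar f j e -> ar f k rho ->
    exists x w, hm (j + k - (d%:Z - 1) - m%:Z) x /\ G * omega f e rho = x * de + alpha * w.
  move=> ae arho; have [|x Ex] := gfam (r (omega f e rho)); first by exists j, k, e, rho; split; [exact: ae|exact: arho|reflexivity].
  have hx : hm (j + k - (d%:Z - 1) - m%:Z) x.
    by apply: (hm_div g0 hg); rewrite -Ex; exact/res_hm/(omega_hm Hf).
  exists (lft F x).
  have /(res_eq0P F)[w Ew] : res F (G * omega f e rho - lft F x * de) = 0.
    exact: res_cross_cancel Ex (esym Ey).
  by exists w; split; [exact: lft_hm|rewrite -Ew addrC subrK].
have one k rho : ar f k rho -> exists x1 x2 rho', ar f (z + k - 1) rho' /\
    G *: rho = x1 *: e1 + x2 *: e2 + alpha *: rho'.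
  move=> arho; have [hrho srho] := arho.
  have [x1 [w1 [hx1 E1]]] := step _ _ _ _ ae1 arho.
  have [x2 [w2 [hx2 E2]]] := step _ _ _ _ ae2 arho.
  have pl := omega_plucker Hf s1 s2 srho; rewrite -/de in pl.
  (* By the Plücker relation [de *: X] is divisible by [alpha], which is prime and does not divide
     [de]; hence [X] is divisible. *)
  pose X := G *: rho - x1 *: e2 + x2 *: e1.
  have EX : de *: X = alpha *: (w1 *: e2 - w2 *: e1).
    exact: reduce_by_pair pl E1 E2.
  have dX j : exists q, X 0 j = alpha * q.
    have [|//|//] := @lf_prime _ _ l0 de (X 0 j) l0_neq0.
    exists ((w1 *: e2 - w2 *: e1) 0 j).
    by have /rowP/(_ j) := EX; rewrite mxE [RHS]mxE.
  have /choice[q Eq] := dX; pose rho' : 'rV[S]_3 := \row_j q j.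
  have EX' : X = alpha *: rho' by apply/rowP => j; rewrite Eq !mxE.
  have a0 : alpha != 0 by rewrite lf_eq0.
  exists (- x2), x1, rho'; split; last first.
    exact: reduction_solved.
  split; last first.
    apply: (mulfI a0); rewrite mulr0 -dotZl -EX' /X.
    by rewrite dotDl dotBl !dotZl srho s1 s2 !mulr0 subr0 addr0.
  move=> j; rewrite mxE; apply: (hm_div a0 (hm_lf l0)); rewrite -Eq !mxE.
  apply: hmD; first apply: hmB; first by apply: hmM.
    rewrite (_ : z + k = (k1 + k - (d%:Z - 1) - m%:Z) + k2); last by rewrite /z; ring.
    by apply: hmM => //; case: ae2.
  rewrite (_ : z + k = (k2 + k - (d%:Z - 1) - m%:Z) + k1); last by rewrite /z; ring.
  by apply: hmM => //; case: ae1.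
elim=> [|mm IH] k rho arho.
  by exists 0, 0, k, rho; rewrite !expr0 !scale1r !scale0r !add0r.
have [x1 [x2 [k' [rho' [arho' E]]]]] := IH _ _ arho.
have [y1 [y2 [rho'' [arho'' E'']]]] := one _ _ arho'.
exists (G * x1 + alpha ^+ mm * y1), (G * x2 + alpha ^+ mm * y2), (z + k' - 1), rho''; split=> //.
by rewrite exprS exprSr -scalerA; exact: compose_reduction E E''.
Qed.

End Point.

(** Where the gradient vanishes, take the line [l0] through [p] and [c], and a product of lines in
    the Jacobian ideal, of the form [l0 ^+ k * g] with [g] nonzero at [p]. Writing the partial
    derivatives through [e1], [e2] modulo [l0 ^+ k.+1] and cancelling [l0 ^+ k] gives an equation
    whose left side is nonzero at [p], and whose right side would vanish there if [omega f e1 e2]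
    did. *)
Lemma omega_locally_nonzero (p : 'rV[K]_3) : p != 0 ->
  exists k1 k2 e1 e2, [/\ ar f k1 e1, ar f k2 e2 & (omega f e1 e2).@[p 0] != 0].
Proof.
move=> p0; have [d0 hf f0 fred] := Hf.
have [[i np]|sing] := pselect (exists i, (n 0 i).@[p 0] != 0).
  have [r1 [r2 [ar1 ar2 Er]]] := grad_omega Hf i.
  by exists (d%:Z - 1), (d%:Z - 1), r1, r2; rewrite Er.
have np i : (n 0 i).@[p 0] = 0 by apply/eqP; apply: contraT => ?; case: sing; exists i.
have fp : f.@[p 0] = 0.
  have /(congr1 (meval (p 0))) := grad_euler hf; rewrite mevalZ dotE !mevalD !mevalM !np !mulr0 !addr0.
  by move/esym/eqP; rewrite mulf_eq0 pnatr_eq0 eqn0Ngt d0 => /eqP.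
have [c [s [u [fc sP Es]]]] := reduced_jacobian_forms d0 hf f0 fred.
have c0 : c != 0.
  apply: contraNneq fc => ->; rewrite -(scale0r 0) (hm_meval _ _ hf) expr0n.
  by rewrite eqn0Ngt d0 mul0r.
pose l0 := (cross c p)^T.
have l00 : l0 != 0.
  rewrite trmx_eq0; apply/eqP => /(cross_eq0_scale c0)[t Et].
  have t0 : t != 0 by apply: contraNneq p0 => t0; rewrite Et t0 scale0r.
  by move/eqP: fp; rewrite Et (hm_rescale _ hf) // (negPf fc).
have pl0 : p *m l0 = 0 by apply/row_mul_eq0; rewrite trmxK dot_crossr.
have [k1 [k2 [z [e1 [e2 [G [[ae1 ae2] hG Gp nde H]]]]]]] := local_generators p0 l00 pl0.
exists k1, k2, e1, e2; split=> //; apply/eqP => dep.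
(* All lines of the product pass through [c]; those that also pass through [p] are multiples of
   [l0]. *)
have [k [g [Eg gp]]] : exists k g, \prod_(l <- s) lf l = lf l0 ^+ k * g /\ g.@[p 0] != 0.
  elim: s sP {Es} => [_|l s IH sP].
    by exists 0%N, 1; rewrite big_nil expr0 mul1r meval1 oner_eq0.
  have [|k [g [Eg gp]]] := IH; first by move=> l' l's; apply: sP; rewrite inE l's orbT.
  have [l_0 cl] := sP l (mem_head _ _).
  have [lp|lp] := eqVneq (lf l).@[p 0] 0; last first.
    by exists k, (lf l * g); rewrite big_cons Eg mevalM mulf_neq0 //; split=> //; ring.
  have [t Et] : exists t, l^T = t *: l0^T.
    apply: cross_eq0_scale; first by rewrite trmx_eq0.
    rewrite trmxK cross_crossl; move/row_mul_eq0: cl => ->.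
    have -> : dot p l^T = 0 by rewrite -row_mul_dot -lf_meval.
    by rewrite !scale0r subrr.
  have {Et} Et : l = t *: l0 by apply: trmx_inj; rewrite Et linearZ.
  have t0 : t != 0 by apply: contraNneq l_0 => t0; rewrite Et t0 scale0r.
  exists k.+1, (t *: g); rewrite mevalZ mulf_neq0 //; split=> //.
  by rewrite big_cons Eg Et lfZ exprS -scalerAl -scalerAr mulrA.
have [_ s1] := ae1; have [_ s2] := ae2.
(* The exponent exceeds the number [k] of factors [l0] by one, so that after cancellation one factor
   [l0], zero at [p], remains. *)
have span i : exists a b, G ^+ k.+1 * G ^+ k.+1 * n 0 i = a * omega f e1 e2 + lf l0 ^+ k.+1 * b.
  have [r1 [r2 [ar1 ar2 Er]]] := grad_omega Hf i.
  have [x1 [x2 [k' [r1' [ar1' E1]]]]] := H k.+1 _ _ ar1.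
  have [y1 [y2 [k'' [r2' [ar2' E2]]]]] := H k.+1 _ _ ar2.
  have [_ t1] := ar1; have [_ t2] := ar2; have [_ t1'] := ar1'; have [_ t2'] := ar2'.
  have E : omega f (G ^+ k.+1 *: r1) (G ^+ k.+1 *: r2) = G ^+ k.+1 * G ^+ k.+1 * n 0 i.
    apply: (omega_uniq Hf); rewrite ?dotZl ?t1 ?t2 ?mulr0 //.
    by rewrite crossZl crossZr (omegaE Hf t1 t2) Er !scalerA.
  have sr2 : dot (G ^+ k.+1 *: r2) n = 0 by rewrite dotZl t2 mulr0.
  move: E; rewrite E1 (omega_combl Hf) // E2 !(omega_combr Hf) // ?(omega_vv Hf) //.
  rewrite (omegaC Hf s1 s2) => <-.
  move: (omega f e1 e2) (omega f e1 r2') (omega f e2 r2') (omega f r1' e1) (omega f r1' e2) (omega f r1' r2').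
  move: (lf l0 ^+ k.+1) => a o o1 o2 o3 o4 o5.
  exists (x1 * y2 - x2 * y1), (x1 * o1 + x2 * o2 + y1 * o3 + y2 * o4 + a * o5); ring.
have [a [b Eab]] : exists a b, G ^+ k.+1 * G ^+ k.+1 * (lf l0 ^+ k * g) = a * omega f e1 e2 + lf l0 ^+ k.+1 * b.
  have /choice[a /choice[b E]] := span.
  exists (dot u (\row_i a i)), (dot u (\row_i b i)); rewrite -Eg Es.
  by apply: dot_mod => i; rewrite E !mxE.
have [a' Ea] : mdvd (lf l0 ^+ k) a.
  apply: (lf_exp_prime l00 nde); rewrite mulrC.
  exists (G ^+ k.+1 * G ^+ k.+1 * g - lf l0 * b).
  by rewrite mulrBr [X in _ = X - _]mulrCA Eab [X in _ = _ - X]mulrA -exprSr addrK mulrC.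
have E : G ^+ k.+1 * G ^+ k.+1 * g = a' * omega f e1 e2 + lf l0 * b.
  apply: (@mulfI _ (lf l0 ^+ k)); first by rewrite expf_neq0 // lf_eq0.
  by rewrite mulrCA Eab Ea exprSr; ring.
have /eqP := congr1 (meval (p 0)) E.
rewrite mevalD !mevalM dep lf_meval pl0 mxE mulr0 mul0r addr0 !mulf_eq0 (negPf gp) orbF orbb.
by rewrite rmorphXn /= expf_eq0 (negPf Gp) andbF.
Qed.

End LocalFreeness.

(** * Splitting along a line *)

Section SplittingIdentities.
Variable T : idomainType.
Implicit Types (a b g x y : T) (r e t s w : 'rV[T]_3).

Lemma plucker_split g b2 b3 x y o12 o13 o23 r1 r2 r3 t : g != 0 ->
  o12 = g * b2 -> o13 = g * b3 -> o23 = x * b2 + y * b3 -> r1 = g *: t ->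
  o12 *: r3 - o13 *: r2 + o23 *: r1 = 0 ->
  forall j, b2 * (r3 + x *: t) 0 j = b3 * (r2 - y *: t) 0 j.
Proof.
move=> g0 -> -> -> -> /rowP E j; apply: (mulfI g0); apply/eqP; rewrite -subr_eq0; apply/eqP.
by have := E j; rewrite !mxE => <-; ring.
Qed.

Lemma plucker_reduce g b2 b c o12 o1 o2 r1 r2 r t s : g != 0 -> r2 = b2 *: s + c *: t ->
  o12 = g * b2 -> o1 = g * b -> r1 = g *: t ->
  o12 *: r - o1 *: r2 + o2 *: r1 = 0 ->
  forall j, b2 * (r - b *: s) 0 j = (b * c - o2) * t 0 j.
Proof.
move=> g0 -> -> -> -> /rowP E j; apply: (mulfI g0); apply/eqP; rewrite -subr_eq0; apply/eqP.
by have := E j; rewrite !mxE => <-; ring.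
Qed.

Lemma proportional_swap (b2 b3 u a2 a3 v : T) : v != 0 ->
  b2 * u = a2 * v -> b3 * u = a3 * v -> b2 * a3 = b3 * a2.
Proof. by move=> v0 E2 E3; apply: (mulIf v0); rewrite -!mulrA -E2 -E3 mulrCA. Qed.

Lemma proportional_cancel (b u a v w : T) : b != 0 -> b * u = a * v -> a = b * w -> u = w * v.
Proof. by move=> b0 E Ea; apply: (mulfI b0); rewrite E Ea mulrA. Qed.

Lemma cross_split g b c o r1 r2 t s w : g != 0 -> b != 0 ->
  r1 = g *: t -> r2 = b *: s + c *: t -> o = g * b -> cross r1 r2 = o *: w ->
  cross t s = w.
Proof.
move=> g0 b0 -> -> ->; rewrite crossDr !crossZl !crossZr crossvv !scaler0 addr0 scalerA.
move=> /rowP E; apply/rowP => j; apply: (mulfI (mulf_neq0 g0 b0)).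
by have := E j; rewrite mxE [RHS]mxE.
Qed.

Lemma cross_comb2 a b a' b' t s :
  cross (a *: t + b *: s) (a' *: t + b' *: s) = (a * b' - a' * b) *: cross t s.
Proof. by apply: rV3P; rewrite !mxE /=; ring. Qed.

Lemma cramer2 x y a b a' b' t s :
  (x * b' - y * a') *: (a *: t + b *: s) + (a * y - b * x) *: (a' *: t + b' *: s) =
  ((a * b' - a' * b) * x) *: t + ((a * b' - a' * b) * y) *: s.
Proof. by apply/rowP => j; rewrite !mxE; ring. Qed.

Lemma comb2_inj (n : 'rV[T]_3) a b a' b' t s : n != 0 -> cross t s = n ->
  a *: t + b *: s = a' *: t + b' *: s -> a = a' /\ b = b'.
Proof.
move=> n0 Ets E; split; apply: (scalerv_inj n0) => /=; rewrite -Ets.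
  by have := congr1 (fun z => cross z s) E; rewrite !crossDl !crossZl !crossvv !scaler0 !addr0.
by have := congr1 (fun z => cross t z) E; rewrite !crossDr !crossZr !crossvv !scaler0 !add0r.
Qed.

End SplittingIdentities.

Section LineSplitting.
Variable K : numClosedFieldType.
Local Notation S := {mpoly K[3]}.
Local Notation A := {mpoly K[2]}.
Variables (d r : nat) (f : S) (rho1 : 'rV[S]_3).
Hypothesis Hf : reduced_eq d f.
Hypothesis ar1 : ar f r%:Z rho1.
Hypothesis rho1_neq0 : rho1 != 0.
Hypothesis rmin : forall (k : nat) rho, (k < r)%N -> ar f k%:Z rho -> rho = 0.
Hypothesis rd : (2 * r <= d - 1)%N.
Local Notation n := (grad f).

Let s1 : dot rho1 n = 0. Proof. by case: ar1. Qed.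

Lemma omegaDr rho e e' : dot rho n = 0 -> dot e n = 0 -> dot e' n = 0 ->
  omega f rho (e + e') = omega f rho e + omega f rho e'.
Proof.
move=> h h1 h2; apply: (omega_uniq Hf) => //; first by rewrite dotDl h1 h2 addr0.
by rewrite crossDr (omegaE Hf h h1) (omegaE Hf h h2) scalerDl.
Qed.

Lemma omegaZr c rho e : dot rho n = 0 -> dot e n = 0 ->
  omega f rho (c *: e) = c * omega f rho e.
Proof.
move=> h h1; apply: (omega_uniq Hf) => //; first by rewrite dotZl h1 mulr0.
by rewrite crossZr (omegaE Hf h h1) scalerA.
Qed.

Lemma arD k e e' : ar f k e -> ar f k e' -> ar f k (e + e').
Proof.
move=> [h1 h2] [h1' h2']; split; last by rewrite dotDl h2 h2' addr0.
by move=> i; rewrite mxE; apply: hmD.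
Qed.

Lemma arZ k j c e : hm j c -> ar f k e -> ar f (j + k) (c *: e).
Proof.
move=> hc [h1 h2]; split; last by rewrite dotZl h2 mulr0.
by move=> i; rewrite mxE; apply: hmM.
Qed.

Lemma ar_lt0 k e : k < 0 -> ar f k e -> e = 0.
Proof. by move=> k0 [he _]; apply/rowP => i; rewrite mxE; exact: hm_lt0 (he i). Qed.

Lemma ar_div_line (l : 'cV[K]_3) k e : l != 0 -> ar f k e ->
  (forall i, mdvd (lf l) (e 0 i)) -> exists2 e', ar f (k - 1) e' & e = lf l *: e'.
Proof.
move=> l0 [he se] /choice[q Eq]; have l0' : lf l != 0 by rewrite lf_eq0.
have Ee : e = lf l *: \row_i q i by apply/rowP => i; rewrite !mxE Eq.
exists (\row_i q i) => //; split.
  by move=> i; rewrite mxE; apply: (hm_div l0' (hm_lf l)); rewrite -Eq.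
by apply: (mulfI l0'); rewrite -dotZl -Ee se mulr0.
Qed.

(** Dividing [rho1] by the line would give a nonzero syzygy of degree [r - 1]. *)
Lemma rho1_line_neq0 (l : 'cV[K]_3) : l != 0 -> exists i, ~ mdvd (lf l) (rho1 0 i).
Proof.
move=> l0; apply: contrapT => H; case/negP: rho1_neq0; apply/eqP.
have [|e' ae' ->] := ar_div_line l0 ar1.
  by move=> i; apply: contrapT => ?; apply: H; exists i.
have [r0|r0] := posnP r; first by rewrite (ar_lt0 _ ae') ?scaler0 // r0.
rewrite (rmin (k := r.-1) (rho := e')) ?scaler0 //; first by rewrite prednK.
by rewrite (_ : r.-1%:Z = r%:Z - 1) //; lia.
Qed.

Variable l0 : 'cV[K]_3.
Hypothesis l0_neq0 : l0 != 0.
Variable F : line_frame l0.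
Definition resv (u : 'rV[S]_3) : 'rV[A]_3 := map_mx (res F) u.

Lemma resvE u i : resv u 0 i = res F (u 0 i).
Proof. exact: mxE. Qed.

Lemma resvD u v : resv (u + v) = resv u + resv v.
Proof. by apply/rowP => i; rewrite !mxE resD. Qed.

Lemma resvB u v : resv (u - v) = resv u - resv v.
Proof. by apply/rowP => i; rewrite !mxE resB. Qed.

Lemma resvZ c u : resv (c *: u) = res F c *: resv u.
Proof. by apply/rowP => i; rewrite !mxE resM. Qed.

Lemma resv0 : resv 0 = 0.
Proof. by apply/rowP => i; rewrite !mxE res0. Qed.

Lemma resv_cross u v : resv (cross u v) = cross (resv u) (resv v).
Proof. exact: map_cross. Qed.

Lemma resv_hm z u : hmv z u -> hmv z (resv u).
Proof. by move=> hu i; rewrite mxE; exact/res_hm/hu. Qed.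

Lemma resv_grad_neq0 : resv n != 0.
Proof.
have [i ni] := grad_line_neq0 Hf l0_neq0; apply/eqP => /rowP/(_ i).
by rewrite mxE [RHS]mxE => /(res_eq0P F).
Qed.

Lemma resv_eq0 k e : ar f k e -> resv e = 0 -> exists2 e', ar f (k - 1) e' & e = lf l0 *: e'.
Proof.
move=> ae /rowP E; apply: ar_div_line => // i; apply/(res_eq0P F).
by have := E i; rewrite mxE [RHS]mxE.
Qed.

#[global] Opaque resv.

Lemma resv_plucker r1 r2 r3 : dot r1 n = 0 -> dot r2 n = 0 -> dot r3 n = 0 ->
  res F (omega f r1 r2) *: resv r3 - res F (omega f r1 r3) *: resv r2
    + res F (omega f r2 r3) *: resv r1 = 0.
Proof.
by move=> h1 h2 h3; have /(congr1 resv) := omega_plucker Hf h1 h2 h3; rewrite resvD resvB !resvZ resv0.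
Qed.

(** [tau] and [sigma] are a frame of [E_C] on the line: their wedge is the generator [grad f] of the
    determinant, and every syzygy restricts to a combination of them. The clauses with [omega] say
    that [b] generates the ideal of [Z(C, rho1)] on the line: it divides every [omega f rho1 e], and
    at each point one quotient is nonzero. *)
Definition on_split (m : nat) (b : A) (tau sigma : 'rV[A]_3) : Prop :=
  [/\ hm m%:Z b /\ b != 0, (m <= r)%N, hmv (r%:Z - m%:Z) tau /\ hmv (d%:Z - 1 - r%:Z + m%:Z) sigma,
      cross tau sigma = resv n /\ resv rho1 = b *: tau
    & (forall k e, ar f k e -> exists x y,
         [/\ hm (k - (r%:Z - m%:Z)) x, hm (k - (d%:Z - 1 - r%:Z + m%:Z)) y,
           resv e = x *: tau + y *: sigma & res F (omega f rho1 e) = b * y]) /\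
      (forall v : 'rV[K]_2, v != 0 -> exists k e y,
         [/\ ar f k e, res F (omega f rho1 e) = b * y & y.@[v 0] != 0])].

(** The extension of the quotient by [tau] is split by hand. Two syzygies [r2], [r3] have coprime
    coordinates [b2], [b3] in the quotient; corrected by multiples of [tau] they become [b2] and
    [b3] times one vector, which is [sigma]. The corrections exist as soon as the restriction of
    [omega f r2 r3] is a combination of [b2] and [b3]. *)
Lemma exists_split : exists m b tau sigma, on_split m b tau sigma.
Proof.
have [d1 hf f0 fred] := Hf.
pose fam (x : A) := exists k e, ar f k e /\ x = res F (omega f rho1 e).
have famh x : fam x -> exists z, hm z x.
  move=> [k [e [ae ->]]]; exists (r%:Z + k - (d%:Z - 1)); exact/res_hm/(omega_hm Hf).
have fam1 i : fam (- res F (rho1 0 i)).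
  have hd : hmv 0 (delta_mx 0 i : 'rV[S]_3).
    by move=> k; rewrite mxE; case: (_ && _); [exact: hm1|exact: hm0].
  exists (0 + (d%:Z - 1)), (koszul f (delta_mx 0 i)); split; first exact: koszul_ar.
  rewrite (omega_koszul Hf) // /dot (bigD1 i) //= big1 => [|j /negPf ji]; last first.
    by rewrite mxE ji mulr0.
  by rewrite mxE !eqxx mulr1 addr0 resN.
have [i1 ni1] := rho1_line_neq0 l0_neq0.
have ri1 : res F (rho1 0 i1) != 0 by apply/eqP => /(res_eq0P F)/ni1.
have [||m [b [hb b0 bfam bnz]]] := @family_gcd K fam r (- res F (rho1 0 i1)) famh (fam1 i1).
- by rewrite oppr_eq0.
- by apply/hmN/res_hm; case: ar1.
have /choice[tau' Etau] i : exists t, res F (rho1 0 i) = b * t.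
  have [t Et] := bfam _ (fam1 i); exists (- t).
  by rewrite mulrN -Et opprK.
pose tau : 'rV[A]_3 := \row_i tau' i.
have Er1 : resv rho1 = b *: tau by apply/rowP => i; rewrite resvE Etau !mxE.
have htau : hmv (r%:Z - m%:Z) tau.
  move=> i; rewrite mxE; apply: (hm_div b0 hb); rewrite -Etau; apply: res_hm; by case: ar1.
have tau0 : tau 0 i1 != 0.
  by rewrite mxE; apply: contraNneq ri1 => E; rewrite Etau E mulr0.
have mr : (m <= r)%N.
  rewrite leqNgt; apply/negP => rm; case/negP: tau0; apply/eqP.
  by apply: hm_lt0 (htau i1); lia.
pose e1 := r%:Z - m%:Z; pose e2 := d%:Z - 1 - r%:Z + m%:Z.
(* [G] collects the coordinates of syzygies in the quotient by [tau], graded by their own degree: an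
   ideal of binary forms without common zero. *)
pose G (nn : nat) (x : A) := exists e, ar f (nn%:Z + e2) e /\ res F (omega f rho1 e) = b * x.
have Ghm nn x : G nn x -> hm nn%:Z x.
  move=> [e [ae E]]; rewrite (_ : nn%:Z = r%:Z + (nn%:Z + e2) - (d%:Z - 1) - m%:Z); last first.
    by rewrite /e2; ring.
  by apply: (hm_div b0 hb); rewrite -E; exact/res_hm/(omega_hm Hf).
have GD nn x y : G nn x -> G nn y -> G nn (x + y).
  move=> [e [ae E]] [e' [ae' E']]; exists (e + e'); split; first exact: arD.
  by rewrite omegaDr //; [rewrite resD E E' mulrDr|case: ae|case: ae'].
have GM nn k x c : G nn x -> hm k%:Z c -> G (k + nn)%N (c * x).
  move=> [e [ae E]] hc; exists (lft F c *: e); split.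
    rewrite PoszD -addrA; apply: arZ => //; exact: lft_hm.
  by rewrite omegaZr //; [rewrite resM lftK E mulrCA|case: ae].
have Gnz (v : 'rV[K]_2) : v != 0 -> exists nn x, G nn x /\ x.@[v 0] != 0.
  move=> v0; have [y [k [e [ae Ey]]] yv] := bnz v v0.
  have y0 : y != 0 by apply: contraNneq yv => ->; rewrite meval0.
  have hy : hm (k - e2) y.
    rewrite (_ : k - e2 = r%:Z + k - (d%:Z - 1) - m%:Z); last by rewrite /e2; ring.
    by apply: (hm_div b0 hb); rewrite Ey; exact/res_hm/(omega_hm Hf).
  case Ek: (k - e2) hy => [nn|nn] hy; last by rewrite (hm_lt0 _ hy) ?eqxx in y0.
  by exists nn, y; split=> //; exists e; split; rewrite -?Ek ?subrK // Ey.
have [n2 [n3 [b2 [b3 [[r2 [ar2 E2]] [r3 [ar3 E3]] b30 nz23]]]]] := graded_ideal_coprime_pair Ghm GD GM Gnz.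
have hb2 := Ghm _ _ (ex_intro _ _ (conj ar2 E2)); have hb3 := Ghm _ _ (ex_intro _ _ (conj ar3 E3)).
have [hr2 s2] := ar2; have [hr3 s3] := ar3.
(* The excess of [D] over [n2 + n3] is [d - 1 - 2 r + 2 m], nonnegative since [2 r <= d - 1]; this
   is what [nozero2_span] needs. *)
have [D ED] : exists D : nat, n2%:Z + n3%:Z + e2 - e1 = D%:Z.
  by exists (n2 + n3 + (d - 1 - 2 * r) + 2 * m)%N; rewrite /e2 /e1; lia.
have h23 : hm D%:Z (res F (omega f r2 r3)).
  rewrite -ED (_ : _ - e1 = n2%:Z + e2 + (n3%:Z + e2) - (d%:Z - 1)); last first.
    by rewrite /e1 /e2; ring.
  exact/res_hm/(omega_hm Hf).
have [||x [y [hx hy E23]]] := nozero2_span hb2 hb3 b30 nz23 h23.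
- by rewrite /e1 /e2 in ED; lia.
- by rewrite /e1 /e2 in ED; apply/orP; right; lia.
have pls := plucker_split b0 E2 E3 E23 Er1 (resv_plucker s1 s2 s3).
have /choice[sig' Esig] j : mdvd b3 ((resv r3 + x *: tau) 0 j).
  exact: nozero2_coprime hb2 hb3 b30 nz23 (pls j).
pose sigma : 'rV[A]_3 := \row_j sig' j.
have Esig3 : resv r3 = b3 *: sigma + (- x) *: tau.
  by apply/rowP => j; have := Esig j; rewrite !mxE => <-; rewrite mulNr addrK.
have Esig2 : resv r2 = b2 *: sigma + y *: tau.
  apply/rowP => j; have := pls j; rewrite Esig !mxE mulrCA => /(mulfI b30) ->.
  by rewrite subrK.
have hsigma : hmv e2 sigma.
  have e2E : n3%:Z + e2 - n3%:Z = e2 by ring.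
  move=> j; rewrite mxE -e2E.
  apply: (hm_div b30 hb3); rewrite -Esig mxE; apply: hmD; first exact: resv_hm.
  rewrite mxE (_ : n3%:Z + e2 = (D%:Z - n2%:Z) + e1); last by rewrite -ED; ring.
  exact: hmM.
have ts : cross tau sigma = resv n.
  apply: (cross_split b0 b30 Er1 Esig3 E3).
  by rewrite -resv_cross -resvZ (omegaE Hf s1 s3).
exists m, b, tau, sigma; split=> //; split; last first.
  move=> v v0; have [y' [k [e [ae Ey]]] yv] := bnz v v0; by exists k, e, y'.
move=> k e ae; have [he se] := ae.
have [z Ez] := bfam _ (ex_intro _ k (ex_intro _ e (conj ae erefl))).
(* After subtraction of [z *: sigma] the syzygy is proportional to [tau] on the line, and
   coprimality of [b2] and [b3] makes the factor a polynomial. *)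
have Y2 := plucker_reduce b0 Esig2 E2 Ez Er1 (resv_plucker s1 s2 se).
have Y3 := plucker_reduce b0 Esig3 E3 Ez Er1 (resv_plucker s1 s3 se).
set a2 := z * y - _ in Y2; set a3 := z * - x - _ in Y3.
have [w Ew] : mdvd b3 a3.
  apply: (nozero2_coprime hb2 hb3 b30 nz23 (e := a2)).
  exact: proportional_swap tau0 (Y2 i1) (Y3 i1).
have EY j : (resv e - z *: sigma) 0 j = w * tau 0 j.
  exact: proportional_cancel b30 (Y3 j) Ew.
have Ee : resv e = w *: tau + z *: sigma.
  by apply/rowP => j; have := EY j; rewrite !mxE => <-; rewrite subrK.
have hz : hm (k - e2) z.
  rewrite (_ : k - e2 = r%:Z + k - (d%:Z - 1) - m%:Z); last by rewrite /e2; ring.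
  by apply: (hm_div b0 hb); rewrite -Ez; exact/res_hm/(omega_hm Hf).
exists w, z; split=> //; apply: (hm_div tau0 (htau i1)); rewrite mulrC -EY mxE.
apply: hmD; first exact: resv_hm.
have := hmN (hmM hz (hsigma i1)); rewrite subrK => h; by rewrite 2!mxE.
Qed.

(** The multipliers [x] that bring all combinations of [tau] and [sigma] into the image of [AR(f)]
    form a graded ideal. By Cramer's rule it contains the restrictions of all [omega f u1 u2], one
    of which is nonzero at any given point; so it contains all forms of large degree. *)
Lemma split_surjective m b tau sigma : on_split m b tau sigma ->
  exists n0 : nat, forall (nn : nat) x, (n0 <= nn)%N -> hm nn%:Z x ->
  forall k t1 t2, hm (k - (r%:Z - m%:Z)) t1 -> hm (k - (d%:Z - 1 - r%:Z + m%:Z)) t2 ->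
  exists2 e, ar f (nn%:Z + k) e & resv e = (x * t1) *: tau + (x * t2) *: sigma.
Proof.
set e1 := r%:Z - m%:Z; set e2 := d%:Z - 1 - r%:Z + m%:Z.
move=> [_ _ _ [ts _] [dec _]].
pose G (nn : nat) (x : A) := hm nn%:Z x /\
  forall k t1 t2, hm (k - e1) t1 -> hm (k - e2) t2 ->
  exists2 e, ar f (nn%:Z + k) e & resv e = (x * t1) *: tau + (x * t2) *: sigma.
suff [n0 Hn0] : exists n0, forall nn x, (n0 <= nn)%N -> hm nn%:Z x -> G nn x.
  by exists n0 => nn x len hx; have [] := Hn0 _ _ len hx.
apply: graded_ideal_cofinite => [nn x []|nn x y [hx Hx] [hy Hy]|nn k x c [hx Hx] hc|v v0] //.
- split; first exact: hmD.
  move=> k t1 t2 h1 h2; have [e ae Ee] := Hx _ _ _ h1 h2; have [e' ae' Ee'] := Hy _ _ _ h1 h2.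
  exists (e + e'); first exact: arD.
  by rewrite resvD Ee Ee' !mulrDl !scalerDl addrACA.
- split; first by rewrite PoszD; exact: hmM.
  move=> j t1 t2 h1 h2; have [e ae Ee] := Hx _ _ _ h1 h2.
  exists (lft F c *: e); first by rewrite PoszD -addrA; apply: arZ => //; exact: lft_hm.
  by rewrite resvZ lftK Ee scalerDr !scalerA !mulrA.
have p0 : v *m frame_in F != 0 by rewrite frame_pt_neq0.
have [k1 [k2 [u1 [u2 [au1 au2 up]]]]] := omega_locally_nonzero Hf p0.
pose x := res F (omega f u1 u2).
have xv : x.@[v 0] != 0 by rewrite /x res_meval.
have hx : hm (k1 + k2 - (d%:Z - 1)) x by exact/res_hm/(omega_hm Hf).
have x0 : x != 0 by apply: contraNneq xv => ->; rewrite meval0.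
case Ek: (k1 + k2 - (d%:Z - 1)) hx => [nn|nn] hx; last by rewrite (hm_lt0 _ hx) ?eqxx in x0.
exists nn, x; split=> //; split=> // k t1 t2 h1 h2.
have [a1 [c1 [ha1 hc1 E1 _]]] := dec _ _ au1; have [a2 [c2 [ha2 hc2 E2 _]]] := dec _ _ au2.
have Ex : x = a1 * c2 - a2 * c1.
  apply: (scalerv_inj resv_grad_neq0) => /=.
  have [_ su1] := au1; have [_ su2] := au2.
  by rewrite -[in RHS]ts -cross_comb2 -E1 -E2 -resv_cross (omegaE Hf su1 su2) resvZ.
exists (lft F (t1 * c2 - t2 * a2) *: u1 + lft F (a1 * t2 - c1 * t1) *: u2); last first.
  by rewrite resvD !resvZ !lftK E1 E2 Ex; exact: cramer2.
apply: arD.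
  rewrite -Ek (_ : _ + k = k - e1 + (k2 - e2) + k1); last by rewrite /e1 /e2; ring.
  apply: arZ => //; apply: lft_hm; apply: hmB; first exact: hmM.
  rewrite (_ : _ + _ = k - e2 + (k2 - e1)); last by ring.
  exact: hmM.
rewrite -Ek (_ : _ + k = k1 - e1 + (k - e2) + k2); last by rewrite /e1 /e2; ring.
apply: arZ => //; apply: lft_hm; apply: hmB; first exact: hmM.
rewrite (_ : _ + _ = k1 - e2 + (k - e1)); last by ring.
exact: hmM.
Qed.

End LineSplitting.

(* The numerator of the difference of the fractions [a / g^k] and [b / g^l],
   multiplied by [g^j]. *)
Definition cocyc (T : pzRingType) (V : lmodType T) (g : T) (a : V) (k : nat) (b : V) (l j : nat) : V :=
  g ^+ j *: (g ^+ l *: a - g ^+ k *: b).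

Lemma cocyc_pair (T : pzRingType) (U V : lmodType T) (g : T) (a b : U * V) k l j :
  cocyc g a k b l j = (cocyc g a.1 k b.1 l j, cocyc g a.2 k b.2 l j).
Proof. by []. Qed.

Lemma cocyc_comb2 (T : comNzRingType) (g x y x' y' : T) (u v t s : 'rV[T]_3) k l j :
  u = x *: t + y *: s -> v = x' *: t + y' *: s ->
  cocyc g u k v l j = cocyc g (x : T^o) k x' l j *: t + cocyc g (y : T^o) k y' l j *: s.
Proof.
move=> -> ->; apply/rowP => i; rewrite /cocyc !mxE.
rewrite -![_ *: (_ : T^o)]/(_ * _); ring.
Qed.

Lemma lincomb_comb2 (T : comNzRingType) (p q x y x' y' : T) (u v t s : 'rV[T]_3) :
  u = x *: t + y *: s -> v = x' *: t + y' *: s ->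
  p *: u + q *: v = (p * x + q * x') *: t + (p * y + q * y') *: s.
Proof. by move=> -> ->; rewrite !scalerDr !scalerDl !scalerA addrACA. Qed.

(** ['X_0] does not divide ['X_1 ^+ b], so ['X_0 ^+ (c - a)] divides [p], which bounds its degree
    from below. *)
Lemma twist_bound (K : numClosedFieldType) (p w : {mpoly K[2]}) z a b c :
  p != 0 -> hm z p -> 'X_0 ^+ a * 'X_1 ^+ b * p = 'X_0 ^+ c * w -> (a <= c)%N ->
  c%:Z - a%:Z <= z.
Proof.
move=> p0 hp E ac; have e0 : delta_mx 0 0 != 0 :> 'cV[K]_2.
  by apply/eqP => /colP/(_ 0)/eqP; rewrite !mxE oner_eq0.
have X0 i : 'X_i != 0 :> {mpoly K[2]}.
  by rewrite -lf_delta lf_eq0; apply/eqP => /colP/(_ i)/eqP; rewrite !mxE !eqxx oner_eq0.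
have [q Eq] : mdvd ('X_0 ^+ (c - a)) p.
  rewrite -lf_delta; apply: (lf_exp_prime (a := 'X_1 ^+ b) e0).
    move=> /(lf_prime_exp e0)[q Eq].
    have := congr1 (meval ((delta_mx 0 1 : 'rV[K]_2) 0)) Eq.
    rewrite lf_delta mevalM !mevalXU !mxE /= mul0r => /eqP; rewrite oner_eq0 //.
  exists w; rewrite lf_delta; apply: (mulfI (expf_neq0 a (X0 0))).
  by rewrite mulrA E mulrA -exprD subnKC.
have q0 : q != 0 by apply: contraNneq p0 => E0; rewrite Eq E0 mulr0.
have hX : hm (c - a)%N%:Z ('X_0 ^+ (c - a) : {mpoly K[2]}).
  by have := hm_exp (c - a) (hmXU K 0); rewrite natz.
have hq : hm (z - (c - a)%N%:Z) q by apply: hm_div hX _; rewrite ?expf_neq0 // -Eq.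
rewrite subzn // leNgt; apply/negP => lt; case/negP: q0; apply/eqP.
by apply: hm_lt0 hq; rewrite subr_lt0.
Qed.

(** In the use with [n2 = k0 + e], the fractions [p / X_0^k] and [q / X_1^l] represent sections of
    [O(-d)] on the two charts that differ by [(X_1 / X_0)^e]: a global section of [O(e - d)], zero
    as [e < d]. *)
Lemma twist_zero (K : numClosedFieldType) (p q : {mpoly K[2]}) (n1 n2 k0 k l : nat) (d e : int) :
  ('X_0 * 'X_1) ^+ (k0 + l) * ('X_1 ^+ k * p) =
    ('X_0 * 'X_1) ^+ k * ('X_1 ^+ n2 * 'X_0 ^+ n1 * ('X_0 ^+ l * q)) ->
  n1%:Z = k0%:Z - e -> e < d -> hm (- d + k%:Z) p -> p = 0.
Proof.
move=> E En lt hp; apply/eqP; apply: contraT => p0.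
have k_d : 0 <= - d + k%:Z.
  by rewrite leNgt; apply/negP => neg; case/negP: p0; apply/eqP; exact: hm_lt0 hp.
have E' : 'X_0 ^+ (k0 + l) * 'X_1 ^+ (k0 + l + k) * p = 'X_0 ^+ (k + n1 + l) * ('X_1 ^+ (k + n2) * q).
  transitivity (('X_0 * 'X_1) ^+ (k0 + l) * ('X_1 ^+ k * p)); first by rewrite exprMn !exprD; ring.
  by rewrite E exprMn !exprD; ring.
have := twist_bound p0 hp E'; lia.
Qed.

(* Equality [a / g^k = b / g^l] of fractions over a domain. *)
Definition fr (T : idomainType) (g a : T) (k : nat) (b : T) (l : nat) : Prop :=
  g ^+ l * a = g ^+ k * b.

Lemma fr_sym (T : idomainType) (g a : T) k b l : fr g a k b l -> fr g b l a k.
Proof. by move=> /esym. Qed.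

Lemma fr_trans (T : idomainType) (g a : T) k b l c m : g != 0 ->
  fr g a k b l -> fr g b l c m -> fr g a k c m.
Proof.
rewrite /fr => g0 E E'; apply: (mulfI (expf_neq0 l g0)).
by rewrite mulrCA E mulrCA E' mulrCA.
Qed.

Lemma fr_res (T : idomainType) (g h a : T) k b l :
  fr g a k b l -> fr (g * h) (h ^+ k * a) k (h ^+ l * b) l.
Proof.
rewrite /fr => E; rewrite !exprMn.
transitivity (h ^+ l * h ^+ k * (g ^+ l * a)); first by ring.
by rewrite E; ring.
Qed.

Lemma fr_scale (T : idomainType) (g x a : T) n k b l :
  fr g a k b l -> fr g (x * a) (n + k) (x * b) (n + l).
Proof.
rewrite /fr => E; rewrite !exprD.
transitivity (g ^+ n * x * (g ^+ l * a)); first by ring.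
by rewrite E; ring.
Qed.

(** * Fractions on a line and coordinates in a split frame *)

Section SplitCoordinates.
Variable K : numClosedFieldType.
Local Notation S := {mpoly K[3]}.
Local Notation A := {mpoly K[2]}.
Variables (l0 : 'cV[K]_3) (F : line_frame l0).
Hypothesis l0_neq0 : l0 != 0.
Local Notation alpha := (lf l0).
Local Notation rs := (res F).

Lemma hm_expn n e (g : {mpoly K[n]}) i : hm e%:Z g -> hm (i * e)%N%:Z (g ^+ i).
Proof. by move=> hg; have := hm_exp i hg; rewrite -mulr_natl natz -PoszM. Qed.

Lemma hm_cocyc c e g a k b l j : hm e%:Z g -> hm (c + (k * e)%N%:Z) a ->
  hm (c + (l * e)%N%:Z) b -> hm (c + ((j + k + l) * e)%N%:Z) (cocyc g (a : S^o) k b l j : S).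
Proof.
move=> hg ha hb; have hx i := hm_expn i hg.
rewrite (_ : _ + _ = (j * e)%N%:Z + (c + ((k + l) * e)%N%:Z)); last first.
  by rewrite !mulnDl !PoszD; ring.
apply: hmM => //; apply: hmB.
  rewrite (_ : _ + _ = (l * e)%N%:Z + (c + (k * e)%N%:Z)); first exact: hmM.
  by rewrite !mulnDl !PoszD; ring.
rewrite (_ : _ + _ = (k * e)%N%:Z + (c + (l * e)%N%:Z)); first exact: hmM.
by rewrite !mulnDl !PoszD; ring.
Qed.

Lemma hm_frac_add c e g (a b : S) k l : hm e%:Z g -> hm (c + (k * e)%N%:Z) a ->
  hm (c + (l * e)%N%:Z) b -> hm (c + ((k + l) * e)%N%:Z) (g ^+ l * a + g ^+ k * b).
Proof.
move=> hg ha hb; have hx i := hm_expn i hg; apply: hmD.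
  rewrite (_ : _ + _ = (l * e)%N%:Z + (c + (k * e)%N%:Z)); first exact: hmM.
  by rewrite !mulnDl !PoszD; ring.
rewrite (_ : _ + _ = (k * e)%N%:Z + (c + (l * e)%N%:Z)); first exact: hmM.
by rewrite !mulnDl !PoszD; ring.
Qed.

Lemma hm_frac_scale c e (a x : S) k l : hm (l * e)%N%:Z a -> hm (c + (k * e)%N%:Z) x ->
  hm (c + ((l + k) * e)%N%:Z) (a * x).
Proof.
move=> ha hx; rewrite (_ : _ + _ = (l * e)%N%:Z + (c + (k * e)%N%:Z)); first exact: hmM.
by rewrite !mulnDl !PoszD; ring.
Qed.

Lemma hm_frac_res c e e' (h x : S) k : hm e'%:Z h -> hm (c + (k * e)%N%:Z) x ->
  hm (c + (k * (e + e'))%N%:Z) (h ^+ k * x).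
Proof.
move=> hh hx; rewrite (_ : _ + _ = (k * e')%N%:Z + (c + (k * e)%N%:Z)).
  by apply: hmM => //; exact: hm_expn.
by rewrite !mulnDr !PoszD; ring.
Qed.

Lemma resX p k : rs (p ^+ k) = rs p ^+ k.
Proof. exact: rmorphXn. Qed.

Lemma res_cocyc g (x y : S) k l j :
  rs (cocyc g (x : S^o) k y l j : S) = cocyc (rs g) (rs x : A^o) k (rs y) l j.
Proof. by rewrite /cocyc resM resB !resM !resX. Qed.

(** The exponent [j] is kept because [g] may vanish on the line, where all fractions over [D_+(g)]
    agree; dropping it, as [rfr] does, requires [rs g != 0]. *)
Definition frac_eq (g a : S) k b l j : Prop := cocyc (rs g) (rs a : A^o) k (rs b) l j = 0.

Lemma frac_eqP g a k b l j : rs (cocyc g (a : S^o) k b l j : S) = 0 <-> frac_eq g a k b l j.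
Proof. by rewrite res_cocyc. Qed.

Lemma mpolyX_neq0 (i : 'I_2) : 'X_i != 0 :> A.
Proof. by rewrite -lf_delta lf_eq0; apply/eqP => /colP/(_ i)/eqP; rewrite !mxE !eqxx oner_eq0. Qed.

Lemma res_lftX_neq0 (i : 'I_2) : rs (lft F 'X_i) != 0.
Proof. by rewrite lftK mpolyX_neq0. Qed.

Lemma hm_lftX (i : 'I_2) : hm 1 (lft F 'X_i).
Proof. exact/lft_hm/hmXU. Qed.

Lemma res_mul_neq0 p q : rs p != 0 -> rs q != 0 -> rs (p * q) != 0.
Proof. by move=> p0 q0; rewrite resM mulf_neq0. Qed.

Lemma res_expn_neq0 p k : rs p != 0 -> rs (p ^+ k) != 0.
Proof. by move=> p0; rewrite resX expf_neq0. Qed.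

Lemma res_neq0 p : rs p != 0 -> p != 0.
Proof. by apply: contraNneq => ->; rewrite res0. Qed.

Definition rfr (g a : S) k (b : S) l : Prop := fr (rs g) (rs a) k (rs b) l.

Lemma frac_eq_rfr g a k b l j : rs g != 0 -> frac_eq g a k b l j -> rfr g a k b l.
Proof.
rewrite /frac_eq /cocyc -![_ *: (_ : A^o)]/(_ * _) => g0 /eqP.
by rewrite mulf_eq0 expf_eq0 (negPf g0) andbF /= subr_eq0 => /eqP.
Qed.

Lemma rfr_frac_eq g a k b l : rfr g a k b l -> frac_eq g a k b l 0.
Proof.
by rewrite /rfr /fr /frac_eq /cocyc -![_ *: (_ : A^o)]/(_ * _) => ->; rewrite subrr mulr0.
Qed.

Lemma rfr_sym g a k b l : rfr g a k b l -> rfr g b l a k. Proof. exact: fr_sym. Qed.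

Lemma rfr_trans g a k b l c m : rs g != 0 -> rfr g a k b l -> rfr g b l c m -> rfr g a k c m.
Proof. exact: fr_trans. Qed.

Lemma rfr_res g h a k b l : rfr g a k b l -> rfr (g * h) (h ^+ k * a) k (h ^+ l * b) l.
Proof. by rewrite /rfr !resM !resX; exact: fr_res. Qed.

Lemma rfr_scale g x a n k b l : rfr g a k b l -> rfr g (x * a) (n + k) (x * b) (n + l).
Proof. by rewrite /rfr !resM; exact: fr_scale. Qed.

Lemma rfr0 g a k b l : rs a = 0 -> rs b = 0 -> rfr g a k b l.
Proof. by rewrite /rfr /fr => -> ->; rewrite !mulr0. Qed.

Lemma rfr0_eq0 g a k b l : rs g != 0 -> rs a = 0 -> rfr g a k b l -> rs b = 0.
Proof.
rewrite /rfr /fr => g0 ->; rewrite mulr0 => /esym/eqP; rewrite mulf_eq0 expf_eq0 (negPf g0) andbF.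
by move/eqP.
Qed.

Lemma rfr_twist x y (n1 n2 k0 : nat) : (n1 + n2 = k0 + k0)%N ->
  rfr (x * y) (y ^+ n2 * x ^+ n1 * (x ^+ k0 * y ^+ n1)) (k0 + k0) (y ^+ k0 * x ^+ n1) k0.
Proof.
move=> E; rewrite /rfr /fr -!resX -!resM; congr res; rewrite !exprMn !exprD.
have Ey : y ^+ n1 * y ^+ n2 = y ^+ k0 * y ^+ k0 by rewrite -!exprD E.
transitivity (x ^+ k0 * x ^+ k0 * x ^+ n1 * y ^+ k0 * (y ^+ n1 * y ^+ n2)); first by ring.
by rewrite Ey; ring.
Qed.

Lemma rfr_twist_zero (a b : S) (n1 n2 k0 k l : nat) (dd ee : int) :
  rfr (lft F 'X_0 * lft F 'X_1) (lft F 'X_1 ^+ k * a) k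
    (lft F 'X_1 ^+ n2 * lft F 'X_0 ^+ n1 * (lft F 'X_0 ^+ l * b)) (k0 + l) ->
  n1%:Z = k0%:Z - ee -> ee < dd -> hm (- dd + k%:Z) a -> rs a = 0.
Proof.
rewrite /rfr /fr !(resM, resX) !lftK => E En lt ha.
exact: twist_zero E En lt (res_hm F ha).
Qed.

Lemma frac_eq_same g a k b l j : k = l -> rs a = rs b -> frac_eq g a k b l j.
Proof. move=> kl E; rewrite /frac_eq; by rewrite kl E /cocyc subrr scaler0. Qed.

Lemma frac_eq_shift g a b N l : rs a = rs (g ^+ N * b) -> frac_eq g a (N + l) b l 0.
Proof.
move=> E; rewrite /frac_eq /cocyc E resM resX -![_ *: (_ : A^o)]/(_ * _).
by rewrite addnC exprD -mulrA subrr mulr0.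
Qed.

Lemma resv_cocyc g u k v l j :
  resv F (cocyc g u k v l j) = cocyc (rs g) (resv F u) k (resv F v) l j.
Proof. by rewrite /cocyc resvZ resvB !resvZ !resX. Qed.

Definition fracv_eq (g : S) (u : 'rV[S]_3) k v l j : Prop :=
  cocyc (rs g) (resv F u) k (resv F v) l j = 0.

Lemma fracv_eqP g u k v l j : resv F (cocyc g u k v l j) = 0 <-> fracv_eq g u k v l j.
Proof. by rewrite resv_cocyc. Qed.

Lemma ar_cocyc f e g (u : 'rV[S]_3) k v l j : hm e%:Z g -> ar f (k * e)%N%:Z u ->
  ar f (l * e)%N%:Z v -> ar f ((j + k + l) * e)%N%:Z (cocyc g u k v l j).
Proof.
move=> hg au av.
have hN1 : hm 0 (-1 : S) by apply: hmN; exact: hm1.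
rewrite -addnA mulnDl PoszD /cocyc; apply: arZ; first exact: hm_expn.
rewrite -scaleN1r scalerA; apply: arD.
  by rewrite addnC mulnDl PoszD; apply: arZ => //; exact: hm_expn.
rewrite mulnDl PoszD; apply: arZ => //; rewrite -[X in hm X _]add0r.
apply: hmM => //; exact: hm_expn.
Qed.

Variables (d r : nat) (f : S) (rho1 : 'rV[S]_3).
Hypothesis Hf : reduced_eq d f.
Variables (m : nat) (b : A) (tau sigma : 'rV[A]_3).
Hypothesis Hs : on_split d r f rho1 F m b tau sigma.
Local Notation e1 := (r%:Z - m%:Z).
Local Notation e2 := (d%:Z - 1 - r%:Z + m%:Z).

Lemma split_uniq x y x' y' : x *: tau + y *: sigma = x' *: tau + y' *: sigma -> x = x' /\ y = y'.
Proof.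
have ts : cross tau sigma = resv F (grad f) by case: Hs => _ _ _ [].
exact: comb2_inj (resv_grad_neq0 Hf l0_neq0 F) ts.
Qed.

Lemma split_uniq0 x y : x *: tau + y *: sigma = 0 -> x = 0 /\ y = 0.
Proof. by move=> E; apply: split_uniq; rewrite E !scale0r addr0. Qed.

(** The coordinates are lifted to [S] by [lft], since sections of the target sheaf are represented
    in [S]. The default pair is not reached on homogeneous syzygies. *)
Definition split_coords (u : 'rV[S]_3) : S * S :=
  if pselect (exists xy : A * A, resv F u = xy.1 *: tau + xy.2 *: sigma)
  is left ex then (lft F (sval (cid ex)).1, lft F (sval (cid ex)).2) else (0, 0).

Lemma split_coordsE u x y : resv F u = x *: tau + y *: sigma ->
  split_coords u = (lft F x, lft F y).
Proof.
move=> E; rewrite /split_coords; case: pselect => [ex|[]]; last by exists (x, y).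
by have [-> ->] := split_uniq (etrans (esym (svalP (cid ex))) E).
Qed.

#[global] Opaque split_coords.

Lemma split_coordsP k u : ar f k u ->
  [/\ hm (k - e1) (split_coords u).1, hm (k - e2) (split_coords u).2
    & resv F u = rs (split_coords u).1 *: tau + rs (split_coords u).2 *: sigma].
Proof.
have [_ _ _ _ [dec _]] := Hs => au; have [x [y [hx hy E _]]] := dec _ _ au.
by rewrite (split_coordsE E) !lftK; split=> //; exact: lft_hm.
Qed.

Lemma split_coords_res u x y : resv F u = rs x *: tau + rs y *: sigma ->
  rs (split_coords u).1 = rs x /\ rs (split_coords u).2 = rs y.
Proof. by move/split_coordsE => ->; rewrite !lftK. Qed.

Lemma cocyc_split_coords k1 k2 u v g k l j : ar f k1 u -> ar f k2 v ->
  (fracv_eq g u k v l j <->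
   frac_eq g (split_coords u).1 k (split_coords v).1 l j /\
   frac_eq g (split_coords u).2 k (split_coords v).2 l j).
Proof.
move=> /split_coordsP[_ _ Eu] /split_coordsP[_ _ Ev].
have E := cocyc_comb2 (rs g) k l j Eu Ev.
split=> [E0|[E1 E2]]; first exact: split_uniq0 (etrans (esym E) E0).
by apply: (etrans E); rewrite E1 E2 !scale0r addr0.
Qed.

Lemma split_coordsD k1 k2 u v p q : ar f k1 u -> ar f k2 v ->
  rs (split_coords (p *: u + q *: v)).1 = rs (p * (split_coords u).1 + q * (split_coords v).1) /\
  rs (split_coords (p *: u + q *: v)).2 = rs (p * (split_coords u).2 + q * (split_coords v).2).
Proof.
move=> /split_coordsP[_ _ Eu] /split_coordsP[_ _ Ev]; apply: split_coords_res.
move: Eu Ev; case: (split_coords u) => a1 a2; case: (split_coords v) => c1 c2 /= Eu Ev.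
have EL : resv F (p *: u + q *: v) = rs p *: resv F u + rs q *: resv F v by rewrite resvD !resvZ.
have ER a c : rs (p * a + q * c) = rs p * rs a + rs q * rs c by rewrite resD !resM.
by apply: (etrans EL); rewrite !ER; exact: lincomb_comb2.
Qed.

Lemma split_coordsZ k1 u p : ar f k1 u ->
  rs (split_coords (p *: u)).1 = rs (p * (split_coords u).1) /\
  rs (split_coords (p *: u)).2 = rs (p * (split_coords u).2).
Proof.
move=> /split_coordsP[_ _ Eu]; apply: split_coords_res.
by rewrite resvZ Eu !resM scalerDr !scalerA.
Qed.

Lemma split_coords_onto e g (a c : S) k : (0 < e)%N -> hm e%:Z g ->
  hm (- e1 + (k * e)%N%:Z) a -> hm (- e2 + (k * e)%N%:Z) c ->
  exists N u, [/\ ar f ((N + k) * e)%N%:Z u,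
    rs (split_coords u).1 = rs (g ^+ N * a) & rs (split_coords u).2 = rs (g ^+ N * c)].
Proof.
move=> e0 hg ha hc; have [n0 H] := split_surjective Hf l0_neq0 Hs.
have hgn : hm (n0 * e)%N%:Z (rs (g ^+ n0)) by apply: res_hm; exact: hm_expn.
rewrite addrC in ha; rewrite addrC in hc.
have len : (n0 <= n0 * e)%N by rewrite leq_pmulr.
have [u au Eu] := H _ _ len hgn _ _ _ (res_hm F ha) (res_hm F hc).
exists n0, u; split; first by rewrite mulnDl PoszD.
all: have [] := split_coords_res (x := g ^+ n0 * a) (y := g ^+ n0 * c) (u := u); rewrite ?resM //.
Qed.

End SplitCoordinates.

Lemma det_mx22 (T : comNzRingType) (A : 'M[T]_2) : \det A = A 0 0 * A 1 1 - A 0 1 * A 1 0.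
Proof.
rewrite (expand_det_row _ 0) !big_ord_recl big_ord0 /cofactor !det_mx11 !mxE /=.
have E (i : 'I_1) : lift 0 i = 1 :> 'I_2 by apply: val_inj; rewrite /= (ord1 i).
rewrite !E [lift 1 0](_ : _ = 0); last exact: val_inj.
by rewrite expr0 addn1 expr1 addr0 mulN1r mulrN mul1r.
Qed.

Lemma det_dot_cross (T : comNzRingType) (a b c : 'rV[T]_3) :
  \det (\matrix_(i < 3) tnth [tuple a; b; c] i) = dot a (cross b c).
Proof.
have E00 : lift (0 : 'I_3) (0 : 'I_2) = 1 by exact: val_inj.
have E01 : lift (0 : 'I_3) (1 : 'I_2) = 2 by exact: val_inj.
have E10 : lift (1 : 'I_3) (0 : 'I_2) = 0 by exact: val_inj.
have E11 : lift (1 : 'I_3) (1 : 'I_2) = 2 by exact: val_inj.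
have E20 : lift (2 : 'I_3) (0 : 'I_2) = 0 by exact: val_inj.
have E21 : lift (2 : 'I_3) (1 : 'I_2) = 1 by exact: val_inj.
rewrite (expand_det_row _ 0) dotE sum3 /cofactor !det_mx22 !mxE.
rewrite E00 E01 E10 E11 E20 E21 !(tnth_nth 0) /=; ring.
Qed.

(** * Quotients in the saturated Jacobian ideal *)

Section Components.
Variable K : numClosedFieldType.
Local Notation S := {mpoly K[3]}.

Lemma pihomog_mul n k e (p q : {mpoly K[n]}) : q \is e.-homog ->
  pihomog mdeg (k + e) (p * q) = pihomog mdeg k p * q.
Proof.
move=> hq; set N := maxn (msize p) k.+1.
have kN : (k < N)%N by rewrite leq_max ltnSn orbT.
have {1}-> : p = \sum_(j < N) pihomog mdeg j p.
  by apply: pihomog_partitionE; rewrite leq_max leqnn.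
rewrite mulr_suml raddf_sum (bigD1 (Ordinal kN)) //= big1 => [|j jk].
  by rewrite addr0 pihomog_dE // dhomogM // pihomogP.
apply: (@pihomog_ne0 _ _ _ (j + e)%N); last by rewrite dhomogM // pihomogP.
by rewrite eqn_add2r; apply: contraNneq jk => jk; apply/eqP/val_inj.
Qed.

(** The partial derivatives share one degree, so the relation holds degree by degree. It gives
    access to [B(C, rho1)], which is defined by all syzygies, homogeneous or not. *)
Lemma syz_components (d N : nat) f (rho : 'rV[S]_3) : reduced_eq d f -> dot rho (grad f) = 0 ->
  (forall i, (msize (rho 0%R i) <= N)%N) ->
  exists e : nat -> 'rV[S]_3, (forall k : nat, ar f k%:Z (e k)) /\ rho = \sum_(k < N) e k.
Proof.
move=> Hf e0 rN; have [d0 _ _ _] := Hf.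
exists (fun k => map_mx (pihomog mdeg k) rho); split=> [k|].
  split=> [i|]; first by rewrite mxE; apply/hmP; exact: pihomogP.
  have hg i : (grad f) 0 i \is d.-1.-homog.
    by apply/hmP; have h := hm_grad Hf i; have <- : d%:Z - 1 = d.-1%:Z by clear -d0; lia.
  have : pihomog mdeg (k + d.-1) (dot rho (grad f)) = 0 by rewrite e0 raddf0.
  rewrite /dot raddf_sum /= => {2}<-; apply: eq_bigr => i _.
  by rewrite pihomog_mul // mxE.
apply/rowP => i; rewrite summxE; under eq_bigr do rewrite mxE.
exact: pihomog_partitionE.
Qed.

Lemma det_omega (d : nat) f (rho1 rho : 'rV[S]_3) : reduced_eq d f ->
  dot rho1 (grad f) = 0 -> dot rho (grad f) = 0 ->
  \det (\matrix_(i < 3) tnth [tuple \row_j 'X_j; rho1; rho] i) = d%:R *: omega f rho1 rho * f.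
Proof.
move=> Hf e1 e; have [_ hf _ _] := Hf.
by rewrite det_dot_cross (omegaE Hf e1 e) dotZr (grad_euler hf) -scalerAr scalerAl.
Qed.

End Components.

(** * The Koszul complex of three forms on a line *)

Section KoszulVector.
Variable T : comNzRingType.

Definition row3 (x y z : T) : 'rV[T]_3 := \row_(i < 3) [:: x; y; z]`_i.

Lemma cross_row3 (p : 'rV[T]_3) s t x y e :
  cross p (row3 (- y - e * s) (x - e * t) e) =
  row3 (e * (p 0 1 + t * p 0 2) - p 0 2 * x) (- e * (p 0 0 + s * p 0 2) - p 0 2 * y)
    ((p 0 0 * x + p 0 1 * y) - e * (t * p 0 0 - s * p 0 1)).
Proof. by apply: rV3P; rewrite !mxE /=; ring. Qed.

Lemma koszul_step (p g : 'rV[T]_3) s t x y e :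
  g 0 2 - s * g 0 0 - t * g 0 1 = x * (p 0 0 + s * p 0 2) + y * (p 0 1 + t * p 0 2) ->
  g 0 0 + p 0 2 * x = (p 0 1 + t * p 0 2) * e ->
  g 0 1 + p 0 2 * y = - ((p 0 0 + s * p 0 2) * e) ->
  g = cross p (row3 (- y - e * s) (x - e * t) e).
Proof.
move=> E2 E0 E1.
have G0 : g 0 0 = (p 0 1 + t * p 0 2) * e - p 0 2 * x by rewrite -E0 addrK.
have G1 : g 0 1 = - ((p 0 0 + s * p 0 2) * e) - p 0 2 * y by rewrite -E1 addrK.
have G2 : g 0 2 = x * (p 0 0 + s * p 0 2) + y * (p 0 1 + t * p 0 2) + s * g 0 0 + t * g 0 1.
  by rewrite -E2; ring.
rewrite cross_row3; apply: rV3P; rewrite !mxE /= ?G2 ?G0 ?G1; ring.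
Qed.

Lemma koszul_relation (p g : 'rV[T]_3) s t x y : dot p g = 0 ->
  g 0 2 - s * g 0 0 - t * g 0 1 = x * (p 0 0 + s * p 0 2) + y * (p 0 1 + t * p 0 2) ->
  (p 0 0 + s * p 0 2) * (g 0 0 + p 0 2 * x) = (p 0 1 + t * p 0 2) * - (g 0 1 + p 0 2 * y).
Proof.
rewrite dotE => E E2; apply/eqP; rewrite -subr_eq0; apply/eqP; rewrite -[RHS]E.
have -> : g 0 2 = x * (p 0 0 + s * p 0 2) + y * (p 0 1 + t * p 0 2) + s * g 0 0 + t * g 0 1.
  by rewrite -E2; ring.
ring.
Qed.

End KoszulVector.

Section BinaryKoszul.
Variable K : numClosedFieldType.
Local Notation A := {mpoly K[2]}.

Definition no_common_zero (p : 'rV[A]_3) : Prop :=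
  forall v : 'rV[K]_2, v != 0 -> exists i, (p 0 i).@[v 0] != 0.

(** [t] makes the second form nonzero; [s] then avoids the finitely many values for which the first
    vanishes at a zero of the second. At a zero where [p 0 2] also vanishes, the three entries would
    vanish together. *)
Lemma coprime_combinations (r : nat) (p : 'rV[A]_3) : (0 < r)%N -> hmv r%:Z p -> no_common_zero p ->
  exists s t : K, p 0 1 + t%:MP * p 0 2 != 0 /\
    nozero2 (p 0 0 + s%:MP * p 0 2) (p 0 1 + t%:MP * p 0 2).
Proof.
move=> r0 hp np.
have npE (v : 'rV[K]_2) : v != 0 -> (p 0 0).@[v 0] = 0 -> (p 0 1).@[v 0] = 0 -> (p 0 2).@[v 0] = 0 -> False.
  by move=> v0 e0 e1 e2; have [j] := np v v0; case: (I3P j) => ->; rewrite ?e0 ?e1 ?e2 eqxx.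
have [t b0] : exists t : K, p 0 1 + t%:MP * p 0 2 != 0.
  have [p1|p1] := eqVneq (p 0 1) 0; last by exists 0; rewrite mpolyC0 mul0r addr0.
  have [p2|p2] := eqVneq (p 0 2) 0; last by exists 1; rewrite p1 mpolyC1 mul1r add0r.
  have [v nv v0] := binary_form_zero r0 (hp 0).
  by case: (npE _ (normal_point_neq0 nv) v0); rewrite ?p1 ?p2 meval0.
have hb : hm r%:Z (p 0 1 + t%:MP * p 0 2).
  by apply: hmD => //; rewrite -[r%:Z]add0r; apply: hmM => //; exact: hmC.
have [c [z [c0 _ /allP nz Eb]]] := binary_form_prod hb b0.
have [s sz] := fresh_scalar [seq - (p 0 0).@[v 0] / (p 0 2).@[v 0] | v : 'rV_2 <- z].
exists s, t; split=> // v v0 av bv.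
have [u uz [k k0 Ev]] : exists2 u, u \in z & exists2 k, k != 0 & v = k *: u.
  move: bv; rewrite Eb mevalZ rmorph_prod /= => /eqP.
  rewrite mulf_eq0 (negPf c0) prodf_seq_eq0 => /hasP[u uz /= /eqP uv].
  have [k Ek] := lam_zero (normal_point_neq0 (nz _ uz)) uv.
  by exists u => //; exists k => //; apply: contraNneq v0 => k0; rewrite Ek k0 scale0r.
have u0 := normal_point_neq0 (nz _ uz).
have ha : hm r%:Z (p 0 0 + s%:MP * p 0 2).
  by apply: hmD => //; rewrite -[r%:Z]add0r; apply: hmM => //; exact: hmC.
move/eqP: av; rewrite Ev (hm_rescale _ ha k0) => /eqP au.
move/eqP: bv; rewrite Ev (hm_rescale _ hb k0) => /eqP bu.
rewrite !(mevalD, mevalM, mevalC) in au bu.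
have [p2|p2] := eqVneq (p 0 2).@[u 0] 0.
  by apply: (npE u u0) => //; [move: au|move: bu]; rewrite p2 mulr0 addr0.
case/negP: sz; apply/mapP; exists u => //.
apply: (mulIf p2); rewrite divfK //.
by apply/eqP; rewrite -addr_eq0 addrC au.
Qed.

(** After a change of basis two entries of [p] are coprime. From degree [2 r - 1] on, the last entry
    of [g] in the dual basis lies in the ideal of these two and is removed by a Koszul vector; the
    other two entries are then a multiple of the syzygy of the coprime pair. *)
Lemma binary_koszul (r D : nat) (p g : 'rV[A]_3) : (0 < r)%N -> hmv r%:Z p -> no_common_zero p ->
  hmv D%:Z g -> (2 * r <= D.+1)%N -> dot p g = 0 ->
  exists2 x, hmv (D%:Z - r%:Z) x & g = cross p x.
Proof.
move=> r0 hp np hg rD E; have [s [t [b0 ab]]] := coprime_combinations r0 hp np.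
have hC c z q : hm z q -> hm z (c%:MP * q : A).
  by move=> hq; rewrite -[z]add0r; apply: hmM => //; exact: hmC.
set a := p 0 0 + _ in ab; set b := p 0 1 + _ in b0 ab.
have ha : hm r%:Z a by apply: hmD => //; exact: hC.
have hb : hm r%:Z b by apply: hmD => //; exact: hC.
have hw : hm D%:Z (g 0 2 - s%:MP * g 0 0 - t%:MP * g 0 1).
  by apply: hmB; [apply: hmB => //|]; exact: hC.
have [||x [y [hx hy E2]]] := nozero2_span ha hb b0 ab hw.
- by rewrite addnn -mul2n.
- by rewrite r0.
have Erel := koszul_relation E E2.
have [e Ee] := nozero2_coprime ha hb b0 ab Erel.
have E1 : g 0 1 + p 0 2 * y = - (a * e).
  apply: oppr_inj; rewrite opprK; apply: (mulfI b0); rewrite -Erel Ee; exact: mulrCA.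
exists (row3 (- y - e * s%:MP) (x - e * t%:MP) e); last exact: koszul_step E2 Ee E1.
have he : hm (D%:Z - r%:Z) e.
  apply: (hm_div b0 hb); rewrite -Ee; apply: hmD => //.
  by rewrite -(subrK r%:Z D%:Z) addrC; exact: hmM.
move=> i; rewrite mxE; case: (I3P i) => -> /=; last by [].
  by apply: hmB; [exact: hmN|rewrite mulrC; exact: hC].
by apply: hmB => //; rewrite mulrC; exact: hC.
Qed.

End BinaryKoszul.

Section BinaryUnit.
Variable K : numClosedFieldType.
Local Notation A := {mpoly K[2]}.

Lemma binary_unit_ideal (r D : nat) (p : 'rV[A]_3) x : (0 < r)%N -> hmv r%:Z p ->
  no_common_zero p -> hm D%:Z x -> (2 * r <= D.+1)%N ->
  exists2 y, hmv (D%:Z - r%:Z) y & x = dot p y.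
Proof.
move=> r0 hp np hx rD; have [s [t [b0 ab]]] := coprime_combinations r0 hp np.
have hC c z q : hm z q -> hm z (c%:MP * q : A).
  by move=> hq; rewrite -[z]add0r; apply: hmM => //; exact: hmC.
have ha : hm r%:Z (p 0 0 + s%:MP * p 0 2) by apply: hmD => //; exact: hC.
have hb : hm r%:Z (p 0 1 + t%:MP * p 0 2) by apply: hmD => //; exact: hC.
have [||u [w [hu hw ->]]] := nozero2_span ha hb b0 ab hx.
- by rewrite addnn -mul2n.
- by rewrite r0.
exists (row3 u w (s%:MP * u + t%:MP * w)).
  move=> i; rewrite mxE; case: (I3P i) => -> //=.
  by apply: hmD; exact: hC.
by rewrite dotE !mxE /=; ring.
Qed.

End BinaryUnit.

Section KoszulLift.
Variable T : comNzRingType.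
Implicit Types r n x y w e : 'rV[T]_3.

Lemma koszul_lift_eq (h c : T) r n x y x' y' : h *: n = cross r x + c *: y ->
  forall a, y = cross r x' + a *: y' -> h *: n = cross r (x + c *: x') + (a * c) *: y'.
Proof.
by move=> -> a ->; rewrite crossDr crossZr scalerDr scalerA addrA [c * a]mulrC.
Qed.

Lemma koszul_lift_dot (h c : T) r n x y : h *: n = cross r x + c *: y -> dot r n = 0 ->
  c * dot r y = 0 /\ h * dot x n = c * dot x y.
Proof.
move=> E rn; have Er := congr1 (dot r) E; have Ex := congr1 (dot x) E.
by move: Er Ex; rewrite !(dotDr, dotZr) rn mulr0 dot_crossl dot_crossr !add0r => <- ->.
Qed.

Lemma koszul_lift_cross (h c : T) r n x y : h *: n = cross r x + c *: y -> dot r y = 0 ->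
  h *: cross y n = dot x y *: r.
Proof.
move=> E ry; have := congr1 (cross y) E.
rewrite crossZr crossDr crossZr crossvv scaler0 addr0 cross_crossr [dot y r]dotC ry scale0r subr0.
by rewrite [dot y x]dotC.
Qed.

Lemma koszul_lift_diff (h o c : T) r n x y w : h *: n = cross r x + c *: y ->
  cross r (x - c *: w) = o *: n -> forall i, n 0 i * (h - o) = c * (cross r w + y) 0 i.
Proof.
rewrite crossBr crossZr => E /eqP; rewrite subr_eq => /eqP E' i.
have : (h - o) *: n = c *: (cross r w + y).
  by rewrite scalerBl E E' scalerDr [o *: n + _]addrC [X in X - _]addrAC addrK.
by move/rowP/(_ i); rewrite !mxE mulrC.
Qed.

End KoszulLift.

Section JacobianSaturation.
Variable K : numClosedFieldType.
Local Notation S := {mpoly K[3]}.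
Local Notation A := {mpoly K[2]}.
Variables (d r : nat) (f : S) (rho1 : 'rV[S]_3).
Hypothesis Hf : reduced_eq d f.
Hypothesis ar1 : ar f r%:Z rho1.
Hypothesis rho1_neq0 : rho1 != 0.
Hypothesis rmin : forall (k : nat) rho, (k < r)%N -> ar f k%:Z rho -> rho = 0.
Hypothesis r0 : (0 < r)%N.
Local Notation n := (grad f).

Let s1 : dot rho1 n = 0. Proof. by case: ar1. Qed.

(** Dividing by a nonconstant [g] gives a syzygy whose homogeneous components all have degree below
    [r], hence vanish. Components are taken because the quotient is not known to be homogeneous. *)
Lemma rho1_primitive g q : (forall i, rho1 0 i = g * q i) -> (msize g <= 1)%N.
Proof.
move=> E; rewrite leqNgt; apply/negP => g1; case/eqP: rho1_neq0.
pose rq : 'rV[S]_3 := \row_i q i.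
have Eq : rho1 = g *: rq by apply/rowP => i; rewrite !mxE E.
have g0 : g != 0 by apply: contraTneq g1 => ->; rewrite msize0.
have sq : dot rq n = 0 by apply: (mulfI g0); rewrite mulr0 -dotZl -Eq.
have [i|e [he Ee]] := syz_components (N := r) Hf sq.
  rewrite mxE; have [->|qi] := eqVneq (q i) 0; first by rewrite msize0.
  have h : (msize (rho1 0%R i) <= r.+1)%N.
    have [ha _] := ar1; have [->|ri] := eqVneq (rho1 0 i) 0; first by rewrite msize0.
    have := hm_inj ri (ha i) ((hmP _ _).2 (dhomog_msize ((hmP _ _).1 (ha i)))).
    by move=> [->]; exact: leqSpred.
  have le a b : (1 < a)%N -> ((a + b).-1 <= r.+1)%N -> (b <= r)%N by clear; lia.
  by move: h; rewrite E msizeM //; exact: le.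
rewrite Eq Ee big1 ?scaler0 // => k _; exact: rmin (ltn_ord k) (he k).
Qed.

Lemma rho1_free_line : exists2 l : 'cV[K]_3, l != 0 &
  forall v : 'rV[K]_3, v != 0 -> v *m l = 0 -> exists i, (rho1 0 i).@[v 0] != 0.
Proof.
have [i0 ri0] := rV0Pn _ rho1_neq0.
have [hr _] := ar1.
exact: (common_zero_free_line r0 hr ri0 rho1_primitive).
Qed.

Variables (l : 'cV[K]_3) (F : line_frame l).
Hypothesis l0 : l != 0.
Hypothesis lfree : forall v : 'rV[K]_3, v != 0 -> v *m l = 0 -> exists i, (rho1 0 i).@[v 0] != 0.
Local Notation alpha := (lf l).

Lemma resv_rho1_free : no_common_zero (resv F rho1).
Proof.
move=> v v0; have [||j rj] := lfree (v := v *m frame_in F).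
- by rewrite frame_pt_neq0.
- exact: frame_pt_on.
by exists j; rewrite resvE res_meval.
Qed.

Lemma koszul_lift_line (D : nat) (y : 'rV[S]_3) : hmv D%:Z y -> (2 * r <= D.+1)%N ->
  dot rho1 y = 0 -> exists x' y', [/\ hmv (D%:Z - r%:Z) x', hmv (D%:Z - 1) y'
    & y = cross rho1 x' + alpha *: y'].
Proof.
move=> hy rD E; have [hr _] := ar1.
have hr' : hmv r%:Z (resv F rho1) by move=> i; rewrite resvE; apply: res_hm.
have hy' : hmv D%:Z (resv F y) by move=> i; rewrite resvE; apply: res_hm.
have E' : dot (resv F rho1) (resv F y) = 0.
  rewrite dotE !resvE -!resM -!resD -dotE E; exact: res0.
have [x hx Ex] := binary_koszul r0 hr' resv_rho1_free hy' rD E'.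
pose x' : 'rV[S]_3 := \row_i lft F (x 0 i).
have hx' : hmv (D%:Z - r%:Z) x' by move=> i; rewrite mxE; apply: lft_hm.
have hc i : hm D%:Z (cross rho1 x' 0 i).
  have -> : D%:Z = r%:Z + (D%:Z - r%:Z) by rewrite addrC subrK.
  by rewrite mxE; case: (I3P i) => -> /=; apply: hmB; exact: hmM.
have H i : exists z, y 0 i - cross rho1 x' 0 i = alpha * z /\ hm (D%:Z - 1) z.
  have h : hm D%:Z (y 0 i - cross rho1 x' 0 i) by apply: hmB.
  have [|z Ez hz] := res_eq0_hm l0 (F := F) h; last by exists z.
  rewrite resB -resvE Ex !mxE.
  case: (I3P i) => -> /=; rewrite resB !resM ?mxE !lftK ?resvE; exact: subrr.
have [z Ez] := choice H.
exists x', (\row_i z i); split=> // [i|]; first by rewrite mxE; case: (Ez i).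
by apply/rowP => i; rewrite !mxE; have [<- _] := Ez i; rewrite !mxE addrC subrK.
Qed.

(** Each step takes one more factor [alpha] out of the remainder and lowers its degree by one; the
    bound on [j] keeps the degrees at which [binary_koszul] is applied at least [2 r - 1]. *)
Lemma koszul_lift_power (dl j : nat) (h : S) : hm dl%:Z h -> (2 * r + j <= (dl + d).+1)%N ->
  exists x y, [/\ hmv (dl%:Z + (d%:Z - 1) - r%:Z) x, hmv (dl%:Z + (d%:Z - 1) - j%:Z) y
    & h *: n = cross rho1 x + alpha ^+ j *: y].
Proof.
have [d0 _ _ _] := Hf.
move=> hh; elim: j => [|j IH] rj.
  exists 0, (h *: n); split=> [i|i|].
  - by rewrite mxE; exact: hm0.
  - by rewrite mxE subr0; apply: hmM => //; exact: hm_grad.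
  - by rewrite expr0 scale1r -(scale0r (0 : 'rV[S]_3)) crossZr scale0r add0r.
have [|x [y [hx hy E]]] := IH; first by clear -rj; lia.
have [D ED] : exists D : nat, D%:Z = dl%:Z + (d%:Z - 1) - j%:Z.
  by exists (dl + d - 1 - j)%N; clear -rj d0 r0; lia.
rewrite -ED in hy.
have [Er _] := koszul_lift_dot E s1.
have ry : dot rho1 y = 0.
  by apply/eqP; move/eqP: Er; rewrite mulf_eq0 expf_eq0 lf_eq0 (negPf l0) andbF.
have [|x' [y' [hx' hy' Ey]]] := koszul_lift_line hy _ ry; first by clear -rj ED d0 r0; lia.
exists (x + alpha ^+ j *: x'), y'; split=> [i|i|].
- rewrite !mxE; apply: hmD => //.
  have -> : dl%:Z + (d%:Z - 1) - r%:Z = j%:Z + (D%:Z - r%:Z) by rewrite ED; ring.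
  by apply: hmM => //; exact: hm_lf_exp.
- have -> : dl%:Z + (d%:Z - 1) - j.+1%:Z = D%:Z - 1 by rewrite ED -addn1 PoszD; ring.
  exact: hy'.
- by rewrite (koszul_lift_eq E Ey) exprS.
Qed.

End JacobianSaturation.

Section SaturationIdentities.
Variable T : comNzRingType.
Implicit Types r n x y w : 'rV[T]_3.

Lemma saturation_combination (g z c q : T) r n x y w : g = dot r w + c * z ->
  dot x n = c * q -> q *: r = cross y n -> g * q = dot (cross w y + z *: x) n.
Proof.
move=> -> Ex Eq; rewrite dotDl dotZl Ex [dot _ n]dotC -dot_cross_cycle -Eq dotZr [dot w r]dotC.
by ring.
Qed.

End SaturationIdentities.

Section JacobianQuotient.
Variable K : numClosedFieldType.
Local Notation S := {mpoly K[3]}.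
Local Notation A := {mpoly K[2]}.
Variables (d r : nat) (f : S) (rho1 : 'rV[S]_3).
Hypothesis Hf : reduced_eq d f.
Hypothesis ar1 : ar f r%:Z rho1.
Hypothesis r0 : (0 < r)%N.
Local Notation n := (grad f).

Let s1 : dot rho1 n = 0. Proof. by case: ar1. Qed.

Lemma pihomog_mul_lt m k e (p q : {mpoly K[m]}) : q \is e.-homog -> (k < e)%N ->
  pihomog mdeg k (p * q) = 0.
Proof.
move=> hq ke; rewrite [p in LHS](pihomog_partitionE (mf := mdeg) (leqnn _)).
rewrite mulr_suml raddf_sum big1 // => j _.
apply: (@pihomog_ne0 _ _ _ (j + e)%N); last by rewrite dhomogM // pihomogP.
by rewrite gtn_eqF // (leq_trans ke) // leq_addl.
Qed.

Lemma jacobian_component (k : nat) q w : hm k%:Z q -> q = dot w n ->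
  exists2 w', hmv (k%:Z - (d%:Z - 1)) w' & q = dot w' n.
Proof.
have [d0 _ _ _] := Hf.
have Ed : d%:Z - 1 = d.-1%:Z by clear -d0; lia.
have hg i : n 0 i \is d.-1.-homog by apply/hmP; rewrite -Ed; exact: hm_grad.
move=> hq Eq; have Ek : q = pihomog mdeg k (dot w n) by rewrite -Eq pihomog_dE //; exact/hmP.
rewrite Ed; have [dk|kd] := leqP d.-1 k.
  exists (map_mx (pihomog mdeg (k - d.-1)) w) => [i|].
    by rewrite mxE subzn //; apply/hmP; exact: pihomogP.
  rewrite Ek /dot raddf_sum; apply: eq_bigr => i _ /=.
  by rewrite -{1}(subnK dk) pihomog_mul //; congr (_ * _); rewrite mxE.
exists 0; first by move=> i; rewrite mxE; exact: hm0.
rewrite Ek /dot raddf_sum; apply: eq_bigr => i _ /=.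
by rewrite (pihomog_mul_lt _ (hg i) kd) [X in X * _]mxE mul0r.
Qed.

Variables (l : 'cV[K]_3) (F : line_frame l).
Hypothesis l0 : l != 0.
Hypothesis lfree : forall v : 'rV[K]_3, v != 0 -> v *m l = 0 -> exists i, (rho1 0 i).@[v 0] != 0.
Local Notation alpha := (lf l).

Lemma alpha_expn_neq0 N : alpha ^+ N != 0.
Proof. by rewrite expf_eq0 lf_eq0 (negPf l0) andbF. Qed.

(** Pairing the relation with [x] gives [h * dot x n = alpha ^+ N * dot x y], and [alpha] does not
    divide [h]. Crossing it with [y], which is orthogonal to [rho1], gives the second equation after
    division by [h]. *)
Lemma lift_quotient N (h : S) x y : h *: n = cross rho1 x + alpha ^+ N *: y -> ~ mdvd alpha h ->
  exists2 q, dot x n = alpha ^+ N * q & q *: rho1 = cross y n.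
Proof.
move=> E nh; have a0 := alpha_expn_neq0 N; have [Er Ex] := koszul_lift_dot E s1.
have h0 : h != 0 by apply/eqP => h0; apply: nh; exists 0; rewrite h0 mulr0.
have ry : dot rho1 y = 0 by apply: (mulfI a0); rewrite mulr0.
have [|q Eq] := @lf_exp_prime K 3 l N h (dot x n) l0 nh; first by exists (dot x y).
exists q => //; have Eh : h * q = dot x y by apply: (mulfI a0); rewrite -Ex Eq; exact: mulrCA.
have Ec := koszul_lift_cross E ry; rewrite -Eh -scalerA in Ec.
apply/rowP => i; apply: (mulfI h0); have /rowP/(_ i) := Ec.
by rewrite mxE [RHS]mxE.
Qed.

(** On the line the entries of [rho1] have no common zero and generate all forms of large degree;
    lifting this and iterating on the multiple of [alpha] that is left reaches [alpha ^+ N]. *)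
Lemma rho1_power_ideal (D N : nat) g : hm D%:Z g -> (2 * r + N <= D.+1)%N ->
  exists y z, hm (D%:Z - N%:Z) z /\ g = dot rho1 y + alpha ^+ N * z.
Proof.
have [hr _] := ar1; move=> hg; elim: N => [|N IH] rD.
  exists 0, g; rewrite subr0; split=> //.
  by rewrite expr0 mul1r /dot big1 ?add0r // => i _; rewrite mxE mulr0.
have [|y [z [hz E]]] := IH; first by clear -rD; lia.
have ED : D%:Z - N%:Z = (D - N)%N%:Z by clear -rD; lia.
have hr' : hmv r%:Z (resv F rho1) by move=> i; rewrite resvE; apply: res_hm.
have hz' : hm (D - N)%N%:Z (res F z) by rewrite -ED; apply: res_hm.
have [|x hx Ex] := binary_unit_ideal r0 hr' (resv_rho1_free F lfree) hz'.
  by clear -rD; lia.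
pose x' : 'rV[S]_3 := \row_i lft F (x 0 i).
have hc : hm (D%:Z - N%:Z) (z - dot rho1 x').
  apply: hmB => //; apply: hm_sum => i _; rewrite mxE ED -(subrK r%:Z (D - N)%N%:Z) addrC.
  by apply: hmM => //; exact: lft_hm.
have [|z' Ez hz''] := res_eq0_hm l0 (F := F) hc.
  by rewrite resB Ex !dotE !resD !resM !resvE !mxE !lftK; exact: subrr.
exists (y + alpha ^+ N *: x'), z'; split.
  by have -> : D%:Z - N.+1%:Z = D%:Z - N%:Z - 1 by rewrite -addn1 PoszD opprD addrA.
rewrite dotDr dotZr exprSr -[alpha ^+ N * alpha * z']mulrA -Ez mulrBr E.
by rewrite -addrA [_ + (_ - _)]addrCA subrr addr0.
Qed.

(** Both [alpha ^+ N] and the entries of [rho1] multiply [q] into the Jacobian ideal, hence so does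
    every form of large degree. *)
Lemma quotient_saturated N q x y g (D : nat) : dot x n = alpha ^+ N * q -> q *: rho1 = cross y n ->
  hm D%:Z g -> (2 * r + N <= D.+1)%N -> exists w, g * q = dot w n.
Proof.
move=> Ex Eq hg rD; have [w [z [_ Eg]]] := rho1_power_ideal hg rD.
exists (cross w y + z *: x); exact: saturation_combination Eg Ex Eq.
Qed.

(* Modulo [alpha ^ N] with [N] larger than the degree of [h], a quotient lying in
   the Jacobian ideal forces [h] to come from a syzygy. *)
Lemma quotient_in_jacobian (dl k N : nat) h x y q w : hm dl%:Z h ->
  hmv (dl%:Z + (d%:Z - 1) - r%:Z) x -> h *: n = cross rho1 x + alpha ^+ N *: y ->
  dot x n = alpha ^+ N * q -> hm k%:Z q -> (k + r + N = dl + 2 * (d - 1))%N -> (dl < N)%N ->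
  q = dot w n -> exists2 e, dot e n = 0 & h = omega f rho1 e.
Proof.
move=> hh hx E Ex hq kN dN Eq; have [d0 _ _ _] := Hf.
have [w' hw' Eq'] := jacobian_component hq Eq.
have hw : hmv (dl%:Z + (d%:Z - 1) - r%:Z) (alpha ^+ N *: w').
  move=> i; rewrite mxE.
  have -> : dl%:Z + (d%:Z - 1) - r%:Z = N%:Z + (k%:Z - (d%:Z - 1)) by clear -kN d0; lia.
  apply: hmM => //; exact: hm_lf_exp.
pose e := x - alpha ^+ N *: w'.
have se : dot e n = 0 by rewrite /e dotBl dotZl Ex Eq' subrr.
have ae : ar f (dl%:Z + (d%:Z - 1) - r%:Z) e.
  by split=> // i; rewrite /e !mxE; apply: hmB => //; have := hw i; rewrite mxE.
exists e => //; have Ho := omega_hm Hf ar1 ae.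
have Ed := koszul_lift_diff E (omegaE Hf s1 se).
have [i ni] := grad_line_neq0 Hf l0.
have [|u Eu] := @lf_exp_prime K 3 l N (n 0 i) (h - omega f rho1 e) l0 ni.
  by exists ((cross rho1 w' + y) 0 i); exact: Ed.
have hd : hm dl%:Z (h - omega f rho1 e).
  apply: hmB => //; have -> : dl%:Z = r%:Z + (dl%:Z + (d%:Z - 1) - r%:Z) - (d%:Z - 1) by ring.
  exact: Ho.
have hu : hm (dl%:Z - N%:Z) u.
  apply: (hm_div (alpha_expn_neq0 N)); last by rewrite -Eu.
  exact: hm_lf_exp.
apply/eqP; rewrite -subr_eq0 Eu (hm_lt0 _ hu) ?mulr0 //.
by rewrite subr_lt0 ltz_nat.
Qed.

End JacobianQuotient.

Section CrossSums.
Variable T : comNzRingType.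

Lemma cross_sumr (I : Type) (s : seq I) (P : pred I) (u : 'rV[T]_3) (g : I -> 'rV[T]_3) :
  cross u (\sum_(i <- s | P i) g i) = \sum_(i <- s | P i) cross u (g i).
Proof.
apply: (big_morph (cross u) (crossDr u)).
by rewrite -(scale0r (0 : 'rV[T]_3)) crossZr !scale0r.
Qed.

Lemma dot_suml (I : Type) (s : seq I) (P : pred I) (u : 'rV[T]_3) (g : I -> 'rV[T]_3) :
  dot (\sum_(i <- s | P i) g i) u = \sum_(i <- s | P i) dot (g i) u.
Proof.
apply: (big_morph (fun v => dot v u)) => [x y|]; first exact: dotDl.
by rewrite -(scale0r (0 : 'rV[T]_3)) dotZl mul0r.
Qed.

End CrossSums.

(** * Separating points by lines, and independent quotients *)

Section PointForms.
Variable K : numClosedFieldType.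
Local Notation S := {mpoly K[3]}.

Definition independent_points m (p : 'I_m -> 'rV[K]_3) : Prop :=
  (forall k, p k != 0) /\ forall j k, j != k -> forall t, p k <> t *: p j.

Lemma separating_form (p q : 'rV[K]_3) : q != 0 -> (forall t, p <> t *: q) ->
  exists L : 'cV[K]_3, q *m L = 0 /\ p *m L != 0.
Proof.
move=> q0 pq; have qp : cross q p != 0.
  by apply/eqP => /(cross_eq0_scale q0)[t Et]; exact: (pq t).
have [j cj] := rV0Pn _ qp.
pose u : 'rV[K]_3 := cross (delta_mx 0 j) q.
exists u^T; split.
  apply/row_mul_eq0; rewrite trmxK; exact: dot_crossr.
apply/eqP => /row_mul_eq0; rewrite trmxK /u -dot_cross_cycle => E; case/eqP: cj.
move: E; rewrite /dot (bigD1 j) //= big1 => [|k /negPf kj]; last by rewrite mxE kj mul0r.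
by rewrite mxE !eqxx mul1r addr0.
Qed.

Lemma independent_point_forms m (p : 'I_m -> 'rV[K]_3) : independent_points p ->
  exists L : 'I_m -> 'I_m -> 'cV[K]_3, forall k j, j != k ->
    p j *m L k j = 0 /\ p k *m L k j != 0.
Proof.
move=> [p0 pp].
suff H k : exists L : 'I_m -> 'cV[K]_3, forall j, j != k -> p j *m L j = 0 /\ p k *m L j != 0.
  by have [L HL] := choice H; exists L.
suff /choice[L HL] : forall j, exists L : 'cV[K]_3, j != k -> p j *m L = 0 /\ p k *m L != 0.
  by exists L.
move=> j; have [->|jk] := eqVneq j k; first by exists 0.
by have [L HL] := separating_form (p0 j) (pp j k jk); exists L.
Qed.

Lemma not_mdvd_lf (l L : 'cV[K]_3) (p q : 'rV[K]_3) : p *m l != 0 -> p *m L = 0 -> q *m L != 0 ->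
  ~ mdvd (lf l) (lf L).
Proof.
move=> pl pL qL [s E]; case/eqP: qL.
pose t := (q *m l) 0 0 / (p *m l) 0 0; pose u := q - t *: p.
have pl' : (p *m l) 0 0 != 0.
  by apply: contraNneq pl => E0; apply/eqP/matrixP => i j; rewrite !ord1 E0 mxE.
have ul : (u *m l) 0 0 = 0.
  by rewrite mulmxBl -scalemxAl !mxE /t !mxE mulfVK ?subrr //; move: pl'; rewrite mxE.
have : (lf L).@[u 0] = 0 by rewrite E mevalM lf_meval ul mul0r.
rewrite lf_meval mulmxBl -scalemxAl pL scaler0 subr0 => E0.
by apply/matrixP => i j; rewrite !ord1 E0 mxE.
Qed.

Lemma not_mdvd_prod (I : finType) (P : pred I) (l : 'cV[K]_3) (g : I -> S) : l != 0 ->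
  (forall i, P i -> ~ mdvd (lf l) (g i)) -> ~ mdvd (lf l) (\prod_(i | P i) g i).
Proof.
move=> l0 ng; apply: (big_ind (fun x => ~ mdvd (lf l) x)) => //; first by have [T [_ TP]] := lf_dvd_projection l0; rewrite TP lsub1r => /eqP; rewrite oner_eq0.
by move=> x y nx ny /(lf_prime l0)[].
Qed.

End PointForms.

Section IndependentQuotients.
Variable K : numClosedFieldType.
Local Notation S := {mpoly K[3]}.
Variables (d r : nat) (f : S) (rho1 : 'rV[S]_3).
Hypothesis Hf : reduced_eq d f.
Hypothesis ar1 : ar f r%:Z rho1.
Hypothesis rho1_neq0 : rho1 != 0.
Hypothesis rmin : forall (k : nat) rho, (k < r)%N -> ar f k%:Z rho -> rho = 0.
Hypothesis r0 : (0 < r)%N.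
Hypothesis rd : (2 * r <= d - 1)%N.
Local Notation n := (grad f).

Let s1 : dot rho1 n = 0. Proof. by case: ar1. Qed.

Definition omega_zero (p : 'rV[K]_3) : Prop :=
  forall rho, dot rho n = 0 -> (omega f rho1 rho).@[p 0] = 0.

Lemma omega_zero_rho1 p i : omega_zero p -> (rho1 0 i).@[p 0] = 0.
Proof.
move=> /(_ _ (koszul_syz f (delta_mx 0 i))); rewrite (omega_koszul Hf) // mevalN => /eqP.
rewrite oppr_eq0 => /eqP; rewrite /dot (bigD1 i) //= big1 => [|k /negPf ki].
  by rewrite mxE !eqxx mulr1 addr0.
by rewrite mxE ki mulr0.
Qed.

Lemma independent_quotients m (p : 'I_m -> 'rV[K]_3) : independent_points p ->
  (forall k, omega_zero (p k)) ->
  exists (M : nat) (q : 'I_m -> S), [/\ forall k, hm ((3 * (d - 2))./2)%:Z (q k),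
      forall k g, hm M%:Z g -> exists w, g * q k = dot w n
    & forall (c : 'I_m -> K) w, \sum_k (c k)%:MP * q k = dot w n -> forall k, c k = 0].
Proof.
move=> ip zp; have [p0 _] := ip; have [L HL] := independent_point_forms ip.
have [l l0 lfree] := rho1_free_line Hf ar1 rho1_neq0 rmin r0.
have [F] := exists_line_frame l0.
pose h k := \prod_(j | j != k) lf (L k j).
have pl k : p k *m l != 0.
  apply/eqP => E; have [i1] := lfree _ (p0 k) E.
  by rewrite omega_zero_rho1 ?eqxx.
have nh k : ~ mdvd (lf l) (h k).
  apply: not_mdvd_prod => // j jk; have [Lj Lk] := HL k j jk.
  exact: not_mdvd_lf (pl j) Lj Lk.
(* [q] has degree [dl + 2 (d - 1) - r - N], and [N] is the exponent that makes it [(3 (d - 2))./2].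
   With this [N] the Koszul lift asks for [r <= d./2] and the inequality [dl < N] for
   [r + d./2 <= d]; both follow from [2 r <= d - 1]. *)
pose dl := m.-1; pose N := (m + d - r - d./2)%N; pose kk := ((3 * (d - 2))./2)%N.
have hh k : hm dl%:Z (h k).
  have -> : dl%:Z = \sum_(j | j != k) 1 by rewrite sumr_const cardC1 card_ord natz.
  rewrite /h; elim/big_rec2: _ => [|j z g _ hg]; first exact: hm1.
  by apply: hmM => //; exact: hm_lf.
have [d0 _ _ _] := Hf.
have arith : (0 < m)%N -> [/\ (2 * r + N <= (dl + d).+1)%N, (kk + r + N = dl + 2 * (d - 1))%N,
    (dl < N)%N & (N <= dl + d)%N].
  by rewrite /N /dl /kk; clear -rd r0 d0 => m0; split; lia.
have [t Ht] : exists t : 'I_m -> ('rV[S]_3 * 'rV[S]_3) * S, forall k,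
    [/\ hmv (dl%:Z + (d%:Z - 1) - r%:Z) (t k).1.1,
        h k *: n = cross rho1 (t k).1.1 + lf l ^+ N *: (t k).1.2,
        dot (t k).1.1 n = lf l ^+ N * (t k).2, (t k).2 *: rho1 = cross (t k).1.2 n
      & hm kk%:Z (t k).2].
  suff H k : exists t : ('rV[S]_3 * 'rV[S]_3) * S,
    [/\ hmv (dl%:Z + (d%:Z - 1) - r%:Z) t.1.1,
        h k *: n = cross rho1 t.1.1 + lf l ^+ N *: t.1.2,
        dot t.1.1 n = lf l ^+ N * t.2, t.2 *: rho1 = cross t.1.2 n & hm kk%:Z t.2].
    by have [t Ht] := choice H; exists t.
  have [A1 A2 A3 A4] := arith (leq_ltn_trans (leq0n k) (ltn_ord k)).
  have [x [y [hx hy E]]] := koszul_lift_power Hf ar1 r0 F l0 lfree (hh k) A1.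
  have [q Eq1 Eq2] := lift_quotient ar1 l0 E (nh k).
  exists (x, y, q); split=> //=.
  have hN : hm N%:Z (lf l ^+ N) by exact: hm_lf_exp.
  have -> : kk%:Z = dl%:Z + (d%:Z - 1) - r%:Z + (d%:Z - 1) - N%:Z by clear -A2 d0; lia.
  apply: (hm_div (alpha_expn_neq0 l0 N) hN); rewrite -Eq1.
  apply: hm_sum => i _; apply: hmM; [exact: hx|exact: hm_grad].
exists (2 * r + N)%N, (fun k => (t k).2); split=> [k|k g hg|c w E k].
- by have [_ _ _ _ hk] := Ht k.
- have [_ _ E1 E2 _] := Ht k.
  have X1 := quotient_saturated ar1 r0 F l0 lfree E1 E2 hg (leqnSn _).
  exact: X1.
have [A1 A2 A3 A4] := arith (leq_ltn_trans (leq0n k) (ltn_ord k)).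
pose hC := \sum_k (c k)%:MP * h k; pose qC := \sum_k (c k)%:MP * (t k).2.
pose xC := \sum_k (c k)%:MP *: (t k).1.1; pose yC := \sum_k (c k)%:MP *: (t k).1.2.
have hC0 z q cc : hm z q -> hm z (cc%:MP * q : S).
  by move=> hq; rewrite -[z]add0r; apply: hmM => //; exact: hmC.
have hhC : hm dl%:Z hC by apply: hm_sum => j _; exact: hC0.
have hqC : hm kk%:Z qC by apply: hm_sum => j _; apply: hC0; case: (Ht j).
have hxC : hmv (dl%:Z + (d%:Z - 1) - r%:Z) xC.
  by move=> i; rewrite summxE; apply: hm_sum => j _; rewrite mxE; apply: hC0; case: (Ht j).
have EC : hC *: n = cross rho1 xC + lf l ^+ N *: yC.
  rewrite /hC /xC /yC scaler_suml cross_sumr scaler_sumr -big_split; apply: eq_bigr => j _ /=.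
  have [_ Ej _ _ _] := Ht j.
  by rewrite -scalerA Ej scalerDr crossZr !scalerA [(c j)%:MP * _]mulrC.
have EqC : dot xC n = lf l ^+ N * qC.
  rewrite /xC /qC dot_suml mulr_sumr; apply: eq_bigr => j _.
  by have [_ _ Ej _ _] := Ht j; rewrite dotZl Ej mulrCA.
have [e se Ee] := quotient_in_jacobian Hf ar1 l0 hhC hxC EC EqC hqC A2 A3 E.
(* At [p k] every other product contains a line through [p k]; only [c k] times the nonzero value of
   [h k] survives. *)
have := zp k e se; rewrite -Ee /hC rmorph_sum (bigD1 k) //= big1 => [|j jk].
  rewrite addr0 mevalM mevalC => /eqP; rewrite mulf_eq0 => /orP[/eqP //|].
  rewrite /h rmorph_prod /= prodf_seq_eq0 => /hasP[j _ /andP[jk /eqP Lj]].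
  have [_ /eqP[]] := HL k j jk; apply/matrixP => i i'.
  by rewrite !ord1 -lf_meval Lj mxE.
rewrite mevalM /h rmorph_prod (bigD1 k) /= ?[k == j]eq_sym //.
have [|Lk _] := HL j k; first by rewrite eq_sym.
by rewrite lf_meval Lk mxE mul0r mulr0.
Qed.

End IndependentQuotients.

(** * Convergent power series on a line *)

Section SeriesDivision.
Variable K : numFieldType.

(** Course-of-values recursion for the coefficients of [a / q], carried by the list of those already
    computed. *)
Fixpoint quotient_seq (q a : nat -> K) (k : nat) : seq K :=
  if k is k'.+1 then
    let s := quotient_seq q a k' in
    rcons s ((a k' - \sum_(j < k') s`_j * q (k' - j)%N) / q 0%N)
  else [::].

Lemma size_quotient_seq q a k : size (quotient_seq q a k) = k.
Proof. by elim: k => //= k IH; rewrite size_rcons IH. Qed.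

Lemma nth_quotient_seq q a j k : (j < k)%N ->
  (quotient_seq q a k)`_j = (quotient_seq q a j.+1)`_j.
Proof.
elim: k => // k IH; rewrite ltnS leq_eqVlt => /orP[/eqP -> //|jk].
by rewrite -(IH jk) [LHS]/= nth_rcons size_quotient_seq jk.
Qed.

Lemma series_quotient (q a : nat -> K) : q 0%N != 0 ->
  exists s : nat -> K, forall k, s k = (a k - \sum_(j < k) s j * q (k - j)%N) / q 0%N.
Proof.
move=> q0; exists (fun k => (quotient_seq q a k.+1)`_k) => k.
rewrite [in LHS]/= nth_rcons size_quotient_seq ltnn eqxx; congr ((_ - _) / _).
by apply: eq_bigr => j _; rewrite nth_quotient_seq.
Qed.

Lemma geometric_le (B : K) k : 1 <= B -> (B - 1) * (\sum_(j < k) B ^+ j) <= B ^+ k.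
Proof. by move=> B1; rewrite -subrX1 lerBlDr lerDl ler01. Qed.

Lemma series_division (q a : nat -> K) (M A B : K) : q 0%N != 0 ->
  (forall j, `|q j| <= M) -> 0 <= A -> 0 <= B -> (forall k, `|a k| <= A * B ^+ k) ->
  exists s D B', [/\ 0 <= D, 0 <= B', forall k, `|s k| <= D * B' ^+ k
    & forall k, \sum_(j < k.+1) s j * q (k - j)%N = a k].
Proof.
move=> q0 qM A0 B0 aA; have [s Es] := series_quotient a q0.
have M0 : 0 <= M := le_trans (normr_ge0 _) (qM 0%N).
have p0 : 0 < `|q 0%N| by rewrite normr_gt0.
(* [D] and [B'] are chosen so that [a k] and the convolution with earlier coefficients each take at
   most half of [D * t * B' ^+ k]; for the latter, [2 M / t <= B' - 1] absorbs the geometric sum. *)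
pose t := `|q 0%N|; pose B' := 1 + B + 2 * M / t; pose D := 2 * A / t.
have Mt : 0 <= M / t by rewrite divr_ge0 // ltW.
have D0 : 0 <= D by rewrite divr_ge0 ?mulr_ge0 // ltW.
have B'1 : 1 <= B' by rewrite /B' -addrA lerDl addr_ge0 // -mulrA mulr_ge0.
have B'0 : 0 <= B' := le_trans ler01 B'1.
have BB' : B <= B' by rewrite /B' -addrA addrCA lerDl addr_ge0 // -mulrA mulr_ge0.
have MB : 2 * (M / t) <= B' - 1.
  have -> : B' - 1 = B + 2 * (M / t) by rewrite /B'; ring.
  by rewrite lerDr.
exists s, D, B'; split=> // [k|k]; last first.
  rewrite big_ord_recr /= subnn (Es k) divfK // addrCA.
  by rewrite subrr addr0.
have [n] := ubnP k; elim: n k => // n IH k kn.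
rewrite Es normrM normfV ler_pdivrMr //.
have S1 : `|\sum_(j < k) s j * q (k - j)%N| <= M * D * \sum_(j < k) B' ^+ j.
  apply: le_trans (ler_norm_sum _ _ _) _; rewrite mulr_sumr; apply: ler_sum => j _.
  rewrite normrM mulrC -mulrA; apply: ler_pM => //.
  by apply: IH; exact: leq_trans (ltn_ord j) kn.
apply: le_trans (ler_normB _ _) _.
apply: le_trans (lerD (aA k) S1) _.
have E1 : A * B ^+ k <= D * t / 2 * B' ^+ k.
  have -> : D * t / 2 = A by rewrite /D; field; rewrite gt_eqF.
  by rewrite ler_wpM2l // lerXn2r.
have E2 : M * D * (\sum_(j < k) B' ^+ j) <= D * t / 2 * B' ^+ k.
  have -> : M * D = D * t / 2 * (2 * (M / t)).
    field; by rewrite gt_eqF.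
  have G : 2 * (M / t) * (\sum_(j < k) B' ^+ j) <= B' ^+ k.
    apply: le_trans (geometric_le k B'1); apply: ler_wpM2r => //.
    by apply: sumr_ge0 => j _; exact: exprn_ge0.
  have Dt : 0 <= D * t / 2 by rewrite divr_ge0 // mulr_ge0 // ltW.
  by rewrite -[leLHS]mulrA; exact: ler_wpM2l Dt _ _ G.
apply: le_trans (lerD E1 E2) _.
rewrite -mulrDl; have -> : D * t / 2 + D * t / 2 = D * t by field.
by rewrite mulrAC.
Qed.

End SeriesDivision.

Local Notation axis k := (U_(1%R : 'I_2) *+ k)%MM.
Local Notation pmul a b m := (\sum_(k : 'X_{1..2 < (mdeg m).+1} | (bmnm k <= m)%MM)
             a (bmnm k) * b (m - bmnm k)%MM).

Lemma axisE k i : (axis k : 'X_{1..2}) i = if i == 1%R then k else 0%N.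
Proof. by rewrite mulmnE mnm1E [1 == _]eq_sym; case: eqP => _; rewrite ?mul1n ?mul0n. Qed.

Lemma axisP (m : 'X_{1..2}) : m 0 = 0%N -> m = axis (m 1).
Proof. by move=> m0; apply/mnmP => i; rewrite axisE; case: (I2P i) => ->. Qed.

Lemma mdeg_axis k : mdeg (axis k : 'X_{1..2}) = k.
Proof. by rewrite mdegMn mdeg1 mul1n. Qed.

Section SeriesAxis.
Variable K : comNzRingType.
Implicit Types a b : 'X_{1..2} -> K.

Definition axis_poly (P : {mpoly K[2]}) : {poly K} :=
  mmap polyC (fun i : 'I_2 => if i == 0 then 0 else 'X) P.
HB.instance Definition _ := GRing.RMorphism.copy axis_poly
  (mmap polyC (fun i : 'I_2 => if i == 0 then 0 else 'X)).

Lemma coef_axis_poly P j : (axis_poly P)`_j = P@_(axis j).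
Proof.
rewrite {2}[P]mpolyE raddf_sum /axis_poly /mmap coef_sum /=.
apply: eq_bigr => m _; rewrite coefCM mcoeffZ mcoeffX; congr (_ * _).
rewrite /mmap1 !big_ord_recl big_ord0 mulr1 /=.
rewrite [lift _ _](_ : _ = 1) //=; last exact: val_inj.
have -> : (m == axis j) = (m 0 == 0%N) && (m 1 == j).
  apply/eqP/andP => [->|[/eqP m0 /eqP <-]]; first by rewrite !axisE.
  exact: axisP.
rewrite expr0n; case: eqP => _ /=; last by rewrite mul0r coef0.
by rewrite mul1r coefXn eq_sym.
Qed.

Lemma pmul_axis a b k :
  pmul a b (axis k) = \sum_(j < k.+1) a (axis j) * b (axis (k - j)).
Proof.
have dj (j : 'I_k.+1) : (mdeg (axis j : 'X_{1..2}) < (mdeg (axis k : 'X_{1..2})).+1)%N.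
  by rewrite !mdeg_axis.
rewrite (reindex (fun j : 'I_k.+1 => BMultinom (dj j))) /=.
  apply: eq_big => [j|j _]; last first.
    by congr (_ * b _); apply/mnmP => i; rewrite mnmBE !axisE; case: ifP.
  by apply/mnm_lepP => i; rewrite !axisE; case: ifP => // _; rewrite -ltnS.
exists (fun m => inord (bmnm m 1)) => [j _|m].
  by apply: val_inj; rewrite /= axisE /= inordK ?ltn_ord.
rewrite inE => /mnm_lepP le; apply: val_inj; rewrite /= inordK.
  by apply/esym/axisP/eqP; have := le 0; rewrite axisE leqn0.
by have := le 1; rewrite axisE /= ltnS.
Qed.

Lemma pmul_X0 a m :
  pmul a (fun m' => ('X_0 : {mpoly K[2]})@_m') m =
  if m 0 == 0%N then 0 else a (m - U_(0%R))%MM.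
Proof.
case: ifP => [/eqP m0|/negbT m0].
  apply: big1 => k _; rewrite mcoeffX; case: eqP => [E|_]; last by rewrite mulr0.
  by have := congr1 (fun x : 'X_{1..2} => x 0) E; rewrite mnm1E mnmBE m0 sub0n.
have lm : (U_(0%R) <= m)%MM by rewrite lep1mP.
have dk : (mdeg (m - U_(0%R))%MM < (mdeg m).+1)%N.
  by rewrite ltnS -{2}(submK lm) mdegD leq_addr.
rewrite (bigD1 (BMultinom dk)) /=; last by apply/mnm_lepP => i; rewrite mnmBE leq_subr.
rewrite mcoeffX big1 ?addr0 => [|k /andP[km nk]]; last first.
  rewrite mcoeffX; case: eqP => [E|_]; last by rewrite mulr0.
  by case/eqP: nk; apply: val_inj; rewrite /= E submBA // addmC addmK.
by rewrite submBA // addmC addmK eqxx mulr1.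
Qed.

End SeriesAxis.

Section SeriesBound.
Variable K : numFieldType.
Implicit Types a b : 'X_{1..2} -> K.

Lemma mpoly_coef_bound (P : {mpoly K[2]}) : exists M : K, forall m, `|P@_m| <= M.
Proof.
exists (\sum_(m <- msupp P) `|P@_m|) => m.
case: (boolP (m \in msupp P)) => [mP|/memN_msupp_eq0 ->]; last first.
  by rewrite normr0; apply: sumr_ge0.
by rewrite (bigD1_seq m) //= lerDl; apply: sumr_ge0.
Qed.

Lemma card_bmultinom2 N : (#|{: 'X_{1..2 < N.+1}}| <= N.+1 ^ 2)%N.
Proof.
pose g (m : 'X_{1..2 < N.+1}) : {ffun 'I_2 -> 'I_N.+1} := [ffun i => inord (bmnm m i)].
have gi : injective g.
  move=> m m' /ffunP E; apply: val_inj; apply/mnmP => i; have := congr1 val (E i).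
  have le (x : 'X_{1..2 < N.+1}) : (bmnm x i < N.+1)%N.
    by apply: leq_ltn_trans (bmdeg x); rewrite mdegE (bigD1 i) //= leq_addr.
  by rewrite !ffunE /= !inordK.
by apply: leq_trans (leq_card g gi) _; rewrite card_ffun !card_ord.
Qed.

(** With [N = mdeg m], the sum has at most [(N + 1) ^ 2 <= 4 ^ N] terms, which accounts for the rate
    [4 * B]. *)
Lemma pmul_bound a b (A B A' : K) : 0 <= A -> 0 <= A' -> 0 <= B ->
  (forall m, `|a m| <= A * B ^+ mdeg m) -> (forall m, `|b m| <= A' * B ^+ mdeg m) ->
  forall m, `|pmul a b m| <= A * A' * (4 * B) ^+ mdeg m.
Proof.
move=> A0 A'0 B0 ha hb m; set N := mdeg m.
have AA : 0 <= A * A' * B ^+ N by rewrite !mulr_ge0 // exprn_ge0.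
have : `|pmul a b m| <= \sum_(k : 'X_{1..2 < N.+1} | (bmnm k <= m)%MM) A * A' * B ^+ N.
  apply: le_trans (ler_norm_sum _ _ _) _; apply: ler_sum => k km.
  rewrite normrM; apply: le_trans (ler_pM _ _ (ha _) (hb _)) _ => //.
  by rewrite mulrACA -exprD -mdegD addmC submK.
move/le_trans; apply.
apply: le_trans (_ : \sum_(k : 'X_{1..2 < N.+1}) A * A' * B ^+ N <= _).
  by rewrite [leRHS](bigID (fun k : 'X_{1..2 < N.+1} => (bmnm k <= m)%MM)) /= lerDl; apply: sumr_ge0.
rewrite sumr_const -[leLHS]mulr_natl exprMn mulrCA.
apply: ler_wpM2l; first exact: mulr_ge0.
apply: ler_wpM2r; first exact: exprn_ge0.
rewrite -natrX ler_nat; apply: leq_trans (card_bmultinom2 N) _.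
by rewrite -[4%N]/(2 ^ 2)%N -expnM mulnC expnM leq_exp2r // ltn_expl.
Qed.

End SeriesBound.

Section Weierstrass.
Variable K : numFieldType.
Implicit Types a b : 'X_{1..2} -> K.

Definition geometric_bound a : Prop := exists A B : K, forall m, `|a m| <= A * B ^+ mdeg m.

Definition nonneg_geometric_bound a : Prop :=
  exists A B : K, [/\ 0 <= A, 0 <= B & forall m, `|a m| <= A * B ^+ mdeg m].

Lemma geometric_boundP a : geometric_bound a <-> nonneg_geometric_bound a.
Proof.
split=> [[A [B H]]|[A [B [_ _ H]]]]; last by exists A, B.
exists `|A|, `|B|; split=> // m; apply: le_trans (H m) _.
by rewrite -normrX -normrM ger0_norm // (le_trans _ (H m)).
Qed.

Lemma nonneg_bound_common a b : nonneg_geometric_bound a -> nonneg_geometric_bound b ->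
  exists A A' B, [/\ 0 <= A, 0 <= A', 0 <= B, forall m, `|a m| <= A * B ^+ mdeg m
    & forall m, `|b m| <= A' * B ^+ mdeg m].
Proof.
move=> [A [B [A0 B0 ha]]] [A' [B' [A'0 B'0 hb]]]; exists A, A', (B + B').
split=> // [|m|m]; first exact: addr_ge0.
  by apply: le_trans (ha m) _; rewrite ler_wpM2l // lerXn2r ?nnegrE ?addr_ge0 // lerDl.
by apply: le_trans (hb m) _; rewrite ler_wpM2l // lerXn2r ?nnegrE ?addr_ge0 // lerDr.
Qed.

Lemma nonneg_boundB a b : nonneg_geometric_bound a -> nonneg_geometric_bound b ->
  nonneg_geometric_bound (fun m => a m - b m).
Proof.
move=> ha hb; have [A [A' [B [A0 A'0 B0 {}ha {}hb]]]] := nonneg_bound_common ha hb.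
exists (A + A'), B; split=> // [|m]; first exact: addr_ge0.
by apply: le_trans (ler_normB _ _) _; rewrite mulrDl lerD.
Qed.

Lemma nonneg_bound_pmul a b : nonneg_geometric_bound a -> nonneg_geometric_bound b ->
  nonneg_geometric_bound (fun m => pmul a b m).
Proof.
move=> ha hb; have [A [A' [B [A0 A'0 B0 {}ha {}hb]]]] := nonneg_bound_common ha hb.
exists (A * A'), (4 * B); split=> [||m]; try exact: mulr_ge0.
exact: pmul_bound.
Qed.

Lemma nonneg_bound_const a (M : K) : (forall m, `|a m| <= M) -> nonneg_geometric_bound a.
Proof.
move=> h; exists M, 1; split=> // [|m]; last by rewrite expr1n mulr1.
by apply: le_trans (h 0%MM).
Qed.

Lemma nonneg_bound_mpoly (P : {mpoly K[2]}) : nonneg_geometric_bound (fun m => P@_m).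
Proof. by have [M /nonneg_bound_const] := mpoly_coef_bound P. Qed.

Lemma nonneg_bound_axis n (c : nat -> K) :
  nonneg_geometric_bound (fun m => \sum_(i < n) c i * (m == axis i)%:R).
Proof.
apply: (@nonneg_bound_const _ (\sum_(i < n) `|c i|)) => m.
apply: le_trans (ler_norm_sum _ _ _) _; apply: ler_sum => i _.
by rewrite normrM; case: eqP => _; rewrite ?normr1 ?mulr1 // normr0 mulr0.
Qed.

Lemma axis_sum n (c : 'I_n -> K) (i : 'I_n) : \sum_j c j * ((axis i == axis j) : bool)%:R = c i.
Proof.
rewrite (bigD1 i) //= eqxx mulr1 big1 ?addr0 // => j ji.
case: eqP => [E|_]; last by rewrite mulr0.
by case/eqP: ji; apply: val_inj; have := congr1 mdeg E; rewrite !mdeg_axis.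
Qed.

Lemma axis_sum_out n (c : 'I_n -> K) k : (n <= k)%N ->
  \sum_(j < n) c j * ((axis k == axis j) : bool)%:R = 0.
Proof.
move=> nk; apply: big1 => j _; case: eqP => [E|_]; last by rewrite mulr0.
by have := congr1 mdeg E; rewrite !mdeg_axis => E'; have := ltn_ord j; rewrite -E' ltnNge nk.
Qed.

(* Weierstrass division modulo [u]: it suffices to divide along the axis [u = 0],
   where the quotient depends on [v] alone. *)
Lemma axis_division n (P : {mpoly K[2]}) a :
  (forall k, (k < n)%N -> P@_(axis k) = 0) -> P@_(axis n) != 0 -> nonneg_geometric_bound a ->
  exists c h, [/\ nonneg_geometric_bound c, nonneg_geometric_bound h
    & forall m, a m - \sum_(i < n) a (axis i) * (m == axis i)%:R =
        pmul c (fun m' => P@_m') m + pmul h (fun m' => ('X_0 : {mpoly K[2]})@_m') m].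
Proof.
move=> Pn P0 ga; have [A [B [A0 B0 ha]]] := ga.
have [M hM] := mpoly_coef_bound P.
have [|||||s [D [B' [D0 B'0 hs Es]]]] :=
  @series_division _ (fun j => P@_(axis (j + n))) (fun j => a (axis (j + n))) M (A * B ^+ n) B.
- exact: P0.
- by move=> j; exact: hM.
- by rewrite mulr_ge0 // exprn_ge0.
- exact: B0.
- by move=> k; apply: le_trans (ha _) _; rewrite mdeg_axis addnC exprD mulrA.
pose c (m : 'X_{1..2}) : K := if m 0 == 0%N then s (m 1) else 0.
have gc : nonneg_geometric_bound c.
  exists D, B'; split=> // m; rewrite /c; case: eqP => [m0|_]; last first.
    by rewrite normr0 mulr_ge0 // exprn_ge0.
  by rewrite {2}(axisP m0) mdeg_axis; exact: hs.
(* This remainder vanishes on the axis, so it is [u] times its own shift by one in the exponent of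
   [u]. *)
pose rest m := a m - \sum_(i < n) a (axis i) * (m == axis i)%:R - pmul c (fun m' => P@_m') m.
have grest : nonneg_geometric_bound rest.
  apply: nonneg_boundB (nonneg_bound_pmul gc (nonneg_bound_mpoly P)).
  by apply: nonneg_boundB => //; exact: (nonneg_bound_axis n (fun i => a (axis i))).
exists c, (fun m => rest (m + U_(0%R))%MM); split=> // [|m].
  have [A1 [B1 [A10 B10 h1]]] := grest; exists (A1 * B1), B1; split=> // [|m]; first exact: mulr_ge0.
  by apply: le_trans (h1 _) _; rewrite mdegD mdeg1 addn1 exprS mulrA.
have /= -> := pmul_X0 (fun m => rest (m + U_(0%R)))%MM m; case: ifP => [/eqP m0|/negbT m0]; last first.
  by rewrite submK ?lep1mP // /rest [RHS]addrC subrK.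
rewrite addr0 (axisP m0); set k := m 1.
have cE j : c (axis j) = s j by rewrite /c !axisE.
have /= -> := pmul_axis c (fun m' => P@_m') k; case: (ltnP k n) => kn.
  rewrite (axis_sum (fun i => a (axis i)) (Ordinal kn)) subrr big1 // => j _.
  by rewrite Pn ?mulr0 // (leq_ltn_trans (leq_subr _ _)).
rewrite axis_sum_out // subr0 -[k in LHS](subnK kn) -Es.
have -> : k.+1 = ((k - n).+1 + n)%N by rewrite addSn subnK.
rewrite big_split_ord /= [X in _ + X]big1 ?addr0; last first.
  move=> j _; rewrite Pn ?mulr0 //.
  have := ltn_ord j; lia.
apply: eq_bigr => j _; rewrite cE; congr (_ * P@_(axis _)).
have := ltn_ord j; lia.
Qed.

End Weierstrass.

(** * Local parameters on a line *)

Section LineParam.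
Variable K : numClosedFieldType.
Implicit Types v w : 'rV[K]_2.

Definition line_param v w (b : {mpoly K[2]}) : {poly K} :=
  mmap polyC (fun i => (v 0 i)%:P + (w 0 i)%:P * 'X) b.
HB.instance Definition _ v w := GRing.RMorphism.copy (line_param v w)
  (mmap polyC (fun i => (v 0 i)%:P + (w 0 i)%:P * 'X)).

Lemma line_paramC v w c : line_param v w c%:MP = c%:P.
Proof. exact: mmapC. Qed.

Lemma line_paramM v w : {morph line_param v w : x y / x * y}.
Proof. exact: rmorphM. Qed.

Lemma line_paramX v w i : line_param v w 'X_i = (v 0 i)%:P + (w 0 i)%:P * 'X.
Proof. by rewrite /line_param mmapX mmap1U. Qed.

Lemma line_param_lf v w a :
  line_param v w (lf a) = ((v *m a) 0 0)%:P + ((w *m a) 0 0)%:P * 'X.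
Proof.
rewrite /lf rmorph_sum !mxE !rmorph_sum /= mulr_suml -big_split; apply: eq_bigr => i _.
rewrite -mul_mpolyC rmorphM /= line_paramC line_paramX mulrDr !polyCM mulrA.
by rewrite [(v 0 i)%:P * _]mulrC [(w 0 i)%:P * _]mulrC.
Qed.

Lemma line_param_horner0 v w y : (line_param v w y).[0] = y.@[v 0].
Proof.
move: y; apply: (rmorph_mpoly_eq (f := horner_eval 0 \o line_param v w)) => [c|i] /=.
  by rewrite line_paramC /horner_eval hornerC mevalC.
by rewrite line_paramX /horner_eval !hornerE mevalXU.
Qed.

(** [line_param] is an affine coordinate on the projective line centered at [v]. Only the factors
    equal to [lam v] vanish there, and each vanishes simply because [w] is another point. *)
Lemma line_param_prod v w c (s : seq 'rV[K]_2) : c != 0 -> normal_point v -> all (@normal_point K) s ->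
  (forall t, w != t *: v) ->
  exists2 B, line_param v w (c *: \prod_(u <- s) lam u) = 'X^(count_mem v s) * B & B.[0] != 0.
Proof.
move=> c0 nv ns vw.
suff [B E B0] : exists2 B, line_param v w (\prod_(u <- s) lam u) = 'X^(count_mem v s) * B & B.[0] != 0.
  exists (c%:P * B); last by rewrite hornerM hornerC mulf_neq0.
  by rewrite -mul_mpolyC rmorphM /= line_paramC E mulrCA.
elim: s ns => [|u s IH] /= => [_|/andP[nu /IH[B E B0]]].
  by exists 1; rewrite ?big_nil ?rmorph1 ?mulr1 // hornerC oner_neq0.
rewrite big_cons rmorphM /= E line_param_lf -!lf_meval -/(lam u) /=.
have [->|uv] := eqVneq u v.
  exists (((lam v).@[w 0])%:P * B); first by rewrite lam_self polyC0 add0r exprS [_ * 'X]mulrC mulrACA.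
  rewrite hornerM hornerC mulf_neq0 //; apply/eqP => /(lam_zero (normal_point_neq0 nv))[t Et].
  by case/eqP: (vw t).
exists ((((lam u).@[v 0])%:P + ((lam u).@[w 0])%:P * 'X) * B); first by rewrite mulrCA.
rewrite hornerM !hornerE mulf_neq0 //; apply/eqP => /(lam_zero (normal_point_neq0 nu))[t Et].
by case/eqP: uv; rewrite (normal_point_eq nu nv Et).
Qed.

End LineParam.

Section AxisChart.
Variable K : numClosedFieldType.
Variables (a : 'cV[K]_3) (F : line_frame a).

Lemma axis_poly_affine c (e e' : K) :
  axis_poly (c%:MP + e *: 'X_0 + e' *: 'X_1) = c%:P + e'%:P * 'X.
Proof.
rewrite -!mul_mpolyC !rmorphD !rmorphM /= /axis_poly !mmapC !mmapX !mmap1U /=.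
by rewrite mulr0 addr0.
Qed.

Lemma axis_poly_chart (T : 3.-tuple {mpoly K[2]}) (p q : 'rV[K]_3) g :
  p *m a = 0 -> q *m a = 0 ->
  (forall i, axis_poly (tnth T i) = (p 0 i)%:P + (q 0 i)%:P * 'X) ->
  axis_poly (g \mPo T) = line_param (p *m frame_out F) (q *m frame_out F) (res F g).
Proof.
move=> pa qa ET; move: g.
pose f1 : {rmorphism {mpoly K[3]} -> {poly K}} := @axis_poly K \o comp_mpoly T.
pose f2 : {rmorphism {mpoly K[3]} -> {poly K}} :=
  line_param (p *m frame_out F) (q *m frame_out F) \o res F.
suff : f1 =1 f2 by [].
apply: rmorph_mpoly_eq => [c|i] /=.
  by rewrite comp_mpolyC resC line_paramC /axis_poly mmapC.
rewrite comp_mpolyXU -tnth_nth ET res_var line_param_lf.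
have E (x : 'rV[K]_3) : x *m a = 0 -> (x *m frame_out F *m col i (frame_in F)) 0 0 = x 0 i.
  by move=> /(frame_ptP F) {2}<-; rewrite !mxE; apply: eq_bigr => j _; rewrite [in LHS]mxE [in X in _ * X]mxE !mxE.
by rewrite !E.
Qed.

(** The rows are the point, a vector [o] off the line and a second point of the line; the coordinate
    [u] along [o] therefore vanishes exactly on the line. *)
Lemma exists_line_chart (v : 'rV[K]_2) : a != 0 -> v != 0 -> exists (Q : 'M[K]_3) (w : 'rV[K]_2),
  [/\ Q \in unitmx, row 0 Q = v *m frame_in F, row 2 Q = w *m frame_in F
    & forall t, w != t *: v].
Proof.
move=> a0 /exists_unitmx_row[V uV Ev].
pose w := row 1 V; pose vv := v *m frame_in F; pose ww := w *m frame_in F.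
have [o oa] : exists o : 'rV[K]_3, (o *m a) 0 0 != 0.
  have : lf a != 0 by rewrite lf_eq0.
  by move=> /exists_meval_neq0[o oa]; exists o; rewrite -lf_meval.
pose Q : 'M[K]_3 := \matrix_(i, j) (if i == 0 then vv 0 j else if i == 1 then o 0 j else ww 0 j).
have indep (x y : K) : x *: v + y *: w = 0 -> x = 0 /\ y = 0.
  move=> E; have EV : (\row_(i < 2) if i == 0 then x else y) *m V = 0.
    rewrite -E -Ev; apply/rowP => j; rewrite !mxE !big_ord_recl big_ord0 !mxE addr0 /=.
    by congr (_ + _ * V _ _); apply: val_inj.
  have /rowP Z : (\row_(i < 2) if i == 0 then x else y) = 0 by rewrite -[LHS](mulmxK uV) EV mul0mx.
  by have := Z 0; have := Z 1; rewrite !mxE /= => -> ->.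
exists Q, w; split.
- rewrite -row_free_unit -kermx_eq0; apply/rowV0P => x /sub_kermxP xQ.
  have E : x 0 0 *: vv + x 0 1 *: o + x 0 2 *: ww = 0.
    by rewrite -xQ; apply/rowP => j; rewrite !mxE sum3 !mxE.
  have x1 : x 0 1 = 0.
    have /(congr1 (fun y : 'rV_3 => (y *m a) 0 0)) := E.
    rewrite !mulmxDl -!scalemxAl !frame_pt_on !scaler0 add0r addr0 mul0mx !mxE => /eqP.
    by rewrite mulf_eq0; case/orP => [/eqP //|/eqP Eo]; case/eqP: oa; rewrite mxE.
  have [|x0 x2] := indep (x 0 0) (x 0 2).
    have := congr1 (fun y => y *m frame_out F) E.
    by rewrite x1 scale0r addr0 mulmxDl -!scalemxAl !frame_ptK mul0mx.
  by apply: rV3P; rewrite ?x0 ?x1 ?x2 mxE.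
- by apply/rowP => j; rewrite !mxE.
- by apply/rowP => j; rewrite !mxE.
- move=> t; apply/eqP => Ew; have [|_ /eqP] := indep t (-1); last by rewrite oppr_eq0 oner_eq0.
  by rewrite scaleN1r -Ew subrr.
Qed.

End AxisChart.

(** * Dimension of a quotient of subspaces *)

Section QuotientDimension.
Variables (K : fieldType) (V : lmodType K).
Implicit Types A I : V -> Prop.

Definition independent_mod I m (e : 'I_m -> V) : Prop :=
  forall c : 'I_m -> K, I (\sum_i c i *: e i) -> forall i, c i = 0.

(** A maximal independent family spans, since a vector outside its span could be added. Its
    maximality is kept in the conclusion, to compare the dimension with a number of points later. *)
Lemma exists_quot_dim A I (D : nat) : (forall k v, I v -> I (k *: v)) ->
  (forall m (e : 'I_m -> V), (forall i, A (e i)) -> independent_mod I e -> (m <= D)%N) ->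
  exists2 n, quot_dim A I n &
    forall m (e : 'I_m -> V), (forall i, A (e i)) -> independent_mod I e -> (m <= n)%N.
Proof.
move=> IZ bound.
pose P m := `[< exists2 e : 'I_m -> V, (forall i, A (e i)) & independent_mod I e >].
have P0 : exists m, P m.
  exists 0%N; apply/asboolP; exists (fun=> 0); first by case.
  by move=> c _; case.
have PD m : P m -> (m <= D)%N by move=> /asboolP[e eA ei]; exact: bound eA ei.
case: (ex_maxnP P0 PD) => n /asboolP[e eA ei] nmax.
exists n; last by move=> m e' e'A e'i; apply: nmax; apply/asboolP; exists e'.
exists e; split=> // a Aa; apply: contrapT => nspan.
have [] := negP (negbT (ltnn n)); apply: nmax; apply/asboolP.
exists (fun i => if unlift ord0 i is Some j then e j else a).
  by move=> i; case: unliftP.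
move=> c; rewrite big_ord_recl unlift_none /=; under eq_bigr do rewrite liftK.
move=> Ic; have c0 : c ord0 = 0.
  apply: contrapT => /eqP c0; apply: nspan.
  exists (fun j => - ((c ord0)^-1 * c (lift ord0 j))).
  have -> : a - \sum_i - ((c ord0)^-1 * c (lift ord0 i)) *: e i =
      (c ord0)^-1 *: (c ord0 *: a + \sum_i c (lift ord0 i) *: e i).
    rewrite scalerDr scalerA mulVf // scale1r scaler_sumr -sumrN.
    by congr (_ + _); apply: eq_bigr => i _; rewrite scaleNr opprK scalerA.
  exact: IZ.
rewrite c0 scale0r add0r in Ic.
by move=> i; case: (unliftP ord0 i) => [j ->|->] //; exact: (ei (fun j => c (lift ord0 j)) Ic).
Qed.

End QuotientDimension.

Lemma dhomog_dependent (K : fieldType) n k m (e : 'I_m -> {mpoly K[n]}) :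
  (forall i, e i \is k.-homog) -> (#|{: 'X_{1..n < k.+1}}| < m)%N ->
  exists c : 'I_m -> K, \sum_i c i *: e i = 0 /\ exists i, c i != 0.
Proof.
move=> he Dm; set D := #|_| in Dm.
pose M : 'M[K]_(m, D) := \matrix_(i, j) (e i)@_(bmnm (enum_val j)).
have : kermx M != 0.
  rewrite kermx_eq0 -row_leq_rank -ltnNge; apply: leq_ltn_trans Dm; exact: rank_leq_col.
move=> /rowV0Pn[v /sub_kermxP vM v0].
exists (fun i => v 0 i); split; last first.
  exact/rV0Pn.
apply/mpolyP => mu; rewrite mcoeff0 raddf_sum /=; under eq_bigr do rewrite mcoeffZ.
have [muk|muk] := ltnP (mdeg mu) k.+1.
  have /rowP/(_ (enum_rank (BMultinom muk))) := vM; rewrite !mxE => Ev; rewrite -[RHS]Ev.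
  by apply: eq_bigr => i _; rewrite mxE enum_rankK.
apply: big1 => i _; rewrite (dhomog_nemf_coeff (he i)) ?mulr0 //.
by rewrite gtn_eqF.
Qed.

Local Open Scope complex_scope.

(** * Splitting types *)

Section SheafIso.
Variable R : realType.
Local Notation C := R[i].
Local Notation S := {mpoly C[3]}.

Lemma homogzP z (p : S) : homogz z p <-> hm z p.
Proof.
case: z => [k|k]; first exact: iff_sym (hmP k p).
by split=> [->|]; [exact: hm0|exact: hm_lt0].
Qed.

Lemma syzP (f : S) rho : syz f rho <-> dot rho (grad f) = 0.
Proof.
suff -> : dot rho (grad f) = \sum_(i < 3) rho 0 i * f^`M(i) by [].
by apply: eq_bigr => i _; rewrite mxE.
Qed.

Lemma ARP (f : S) k rho : AR f k rho <-> ar f k rho.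
Proof.
split=> -[h s]; split; try exact/syzP.
  by move=> i; apply/homogzP.
by move=> i; apply/homogzP.
Qed.

Lemma sec_eqE (N : gmod R) e g (s t : gcar N * nat) : sec_eq e g s t =
  exists j, gnul ((j + s.2 + t.2) * e)%N%:Z (cocyc g s.1 s.2 t.1 t.2 j).
Proof. by []. Qed.

Section Line.
Variables (l0 : 'cV[C]_3) (F : line_frame l0).
Hypothesis l0_neq0 : l0 != 0.
Local Notation alpha := (lf l0).
Local Notation rs := (res F).
Local Notation Lmod := (grestr alpha (gself R)).
Local Notation Osum e1 e2 := (gsum (gshift Lmod (- e1)) (gshift Lmod (- e2))).
Local Notation Mmod f := (grestr alpha (ARmod f)).

Lemma grestr_nulP k (v : S) : hm k v -> (@gnul _ Lmod k v <-> rs v = 0).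
Proof.
move=> hv; split=> [[w _ /eqP]|/(res_eq0_hm l0_neq0 hv)[w Ew hw]].
  by rewrite subr_eq0 => /eqP ->; rewrite -[alpha *: _]/(alpha * _) resM res_lf mul0r.
exists w; first exact/homogzP.
by rewrite Ew -[alpha *: _]/(alpha * _); apply: subrr.
Qed.

Lemma Mmod_nulP f k u : ar f k u -> (@gnul _ (Mmod f) k u <-> resv F u = 0).
Proof.
move=> au; split=> [[w _ /eqP]|/(resv_eq0 l0_neq0 au)[w aw Ew]].
  by rewrite subr_eq0 => /eqP ->; rewrite resvZ res_lf scale0r.
by exists w; [exact/ARP|rewrite Ew; apply: subrr].
Qed.

Lemma Mmod_secP f e (s : gcar (Mmod f) * nat) :
  is_sec e s <-> ar f (s.2 * e)%N%:Z (s.1 : 'rV[S]_3).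
Proof. exact: ARP. Qed.

Lemma Mmod_sec_eqP f e g (s t : gcar (Mmod f) * nat) : hm e%:Z g -> is_sec e s -> is_sec e t ->
  (sec_eq e g s t <-> exists j, fracv_eq F g s.1 s.2 t.1 t.2 j).
Proof.
move=> hg /Mmod_secP as_ /Mmod_secP at_; split=> -[j n1]; exists j.
  have N1 := (Mmod_nulP (ar_cocyc j hg as_ at_)).1 n1.
  exact: (fracv_eqP _ _ _ _ _ _ _).1 N1.
have N1 := (Mmod_nulP (ar_cocyc j hg as_ at_)).2 ((fracv_eqP _ _ _ _ _ _ _).2 n1).
exact: N1.
Qed.

Section Osum.
Variables e1 e2 : int.
Implicit Types s t : gcar (Osum e1 e2) * nat.

Lemma Osum_secP e s : is_sec e s <->
  hm (- e1 + (s.2 * e)%N%:Z) (s.1.1 : S) /\ hm (- e2 + (s.2 * e)%N%:Z) (s.1.2 : S).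
Proof. by split=> -[h1 h2]; split; apply/homogzP. Qed.

Lemma Osum_nulE k v : @gnul R (Osum e1 e2) k v =
  (@gnul R Lmod (- e1 + k) v.1 /\ @gnul R Lmod (- e2 + k) v.2).
Proof. by []. Qed.

Lemma Osum_sec_add e g s t : hm e%:Z g -> is_sec e s -> is_sec e t -> is_sec e (sec_add g s t).
Proof.
move=> hg /Osum_secP[h1 h2] /Osum_secP[h3 h4]; apply/Osum_secP.
have H1 := hm_frac_add hg h1 h3; have H2 := hm_frac_add hg h2 h4.
by rewrite /sec_add; split; [exact: H1|exact: H2].
Qed.

Lemma Osum_sec_scale e a l s : hm (l * e)%N%:Z a -> is_sec e s -> is_sec e (sec_scale a l s).
Proof.
move=> ha /Osum_secP[h1 h2]; apply/Osum_secP.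
have H1 := hm_frac_scale ha h1; have H2 := hm_frac_scale ha h2.
by rewrite /sec_scale; split; [exact: H1|exact: H2].
Qed.

Lemma Osum_sec_res e e' h s : hm e'%:Z h -> is_sec e s -> is_sec (e + e') (sec_res h s).
Proof.
move=> hh /Osum_secP[h1 h2]; apply/Osum_secP.
have H1 := hm_frac_res hh h1; have H2 := hm_frac_res hh h2.
by rewrite /sec_res; split; [exact: H1|exact: H2].
Qed.

Lemma Osum_sec_eqP e g s t : hm e%:Z g -> is_sec e s -> is_sec e t ->
  (sec_eq e g s t <-> exists j,
     frac_eq F g s.1.1 s.2 t.1.1 t.2 j /\ frac_eq F g s.1.2 s.2 t.1.2 t.2 j).
Proof.
move=> hg /Osum_secP[hs1 hs2] /Osum_secP[ht1 ht2]; rewrite sec_eqE; split=> -[j].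
  move=> nn; exists j; move: nn; rewrite Osum_nulE cocyc_pair => -[n1 n2].
  have N1 := (grestr_nulP (hm_cocyc j hg hs1 ht1)).1 n1.
  have N2 := (grestr_nulP (hm_cocyc j hg hs2 ht2)).1 n2.
  by split; [exact: (frac_eqP _ _ _ _ _ _ _).1 N1|exact: (frac_eqP _ _ _ _ _ _ _).1 N2].
move=> [n1 n2]; exists j; rewrite Osum_nulE cocyc_pair.
have N1 := (grestr_nulP (hm_cocyc j hg hs1 ht1)).2 ((frac_eqP _ _ _ _ _ _ _).2 n1).
have N2 := (grestr_nulP (hm_cocyc j hg hs2 ht2)).2 ((frac_eqP _ _ _ _ _ _ _).2 n2).
exact: conj N1 N2.
Qed.

Lemma Osum_sec_eq_res e g s t : hm e%:Z g -> is_sec e s -> is_sec e t ->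
  s.2 = t.2 -> rs s.1.1 = rs t.1.1 -> rs s.1.2 = rs t.1.2 -> sec_eq e g s t.
Proof.
move=> hg ss st E2 Ea Eb; apply: (Osum_sec_eqP hg ss st).2; exists 0%N.
have N1 := frac_eq_same g 0 E2 Ea; have N2 := frac_eq_same g 0 E2 Eb.
exact: conj N1 N2.
Qed.

End Osum.
Section Iso.
Variables (d r : nat) (f : S) (rho1 : 'rV[S]_3).
Hypothesis Hf : reduced_eq d f.
Variables (m : nat) (b : {mpoly C[2]}) (tau sigma : 'rV[{mpoly C[2]}]_3).
Hypothesis Hs : on_split d r f rho1 F m b tau sigma.
Local Notation e1 := (r%:Z - m%:Z).
Local Notation e2 := (d%:Z - 1 - r%:Z + m%:Z).

Definition split_map (s : gcar (Mmod f) * nat) : gcar (Osum e1 e2) * nat :=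
  (split_coords F tau sigma s.1, s.2).

Lemma split_map_sec e s : is_sec e s -> is_sec e (split_map s).
Proof.
move=> /Mmod_secP/(split_coordsP l0_neq0 Hf Hs)[hx hy _]; apply/Osum_secP.
by split; rewrite addrC.
Qed.

Lemma split_map_eq e g s t : hm e%:Z g -> is_sec e s -> is_sec e t ->
  (sec_eq e g s t <-> sec_eq e g (split_map s) (split_map t)).
Proof.
move=> hg ss st; have E1 := Mmod_sec_eqP hg ss st.
have E2 := Osum_sec_eqP hg (split_map_sec ss) (split_map_sec st).
have E3 j := cocyc_split_coords l0_neq0 Hf Hs g s.2 t.2 j ((Mmod_secP _ _).1 ss) ((Mmod_secP _ _).1 st).
split=> [/E1[j /E3 H]|/E2[j H]]; first by apply: E2.2; exists j; exact: H.
by apply: E1.2; exists j; apply: (E3 j).2; exact: H.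
Qed.

Lemma split_map_onto e g t : (0 < e)%N -> hm e%:Z g -> is_sec e t ->
  exists2 s, is_sec e s & sec_eq e g (split_map s) t.
Proof.
move=> e0 hg st; have /Osum_secP[h1 h2] := st.
have [N [u [au E1 E2]]] := split_coords_onto l0_neq0 Hf Hs e0 hg h1 h2.
have ss : is_sec e ((u, (N + t.2)%N) : gcar (Mmod f) * nat) by exact: (Mmod_secP _ _).2.
exists (u, (N + t.2)%N) => //; apply: (Osum_sec_eqP hg (split_map_sec ss) st).2.
have N1 := frac_eq_shift t.2 E1; have N2 := frac_eq_shift t.2 E2.
by exists 0%N; exact: conj N1 N2.
Qed.

Lemma split_sheaf_iso : sheaf_iso (Mmod f) (Osum e1 e2).
Proof.
(* Coordinates in the frame do not depend on the open set, so one map serves for every [g]. *)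
exists (fun=> split_map) => e g e0 g0 /hmP hg; split; split.
- by move=> s; exact: split_map_sec.
- by move=> s t; exact: split_map_eq.
- by move=> t; exact: split_map_onto.
- move=> s t ss st.
  have hgk i := hm_expn i hg.
  have sadd : is_sec e (sec_add g s t).
    apply/Mmod_secP; rewrite /sec_add /= mulnDl PoszD; apply: arD.
      by rewrite addrC; apply: arZ => //; exact/Mmod_secP.
    by apply: arZ => //; exact/Mmod_secP.
  have sadd' : is_sec e (sec_add g (split_map s) (split_map t)).
    exact: Osum_sec_add hg (split_map_sec ss) (split_map_sec st).
  have [R1 R2] := split_coordsD l0_neq0 Hf Hs (g ^+ t.2) (g ^+ s.2) ((Mmod_secP _ _).1 ss) ((Mmod_secP _ _).1 st).
  have sm := split_map_sec sadd.
  exact: Osum_sec_eq_res hg sm sadd' erefl R1 R2.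
- move=> a l s /hmP ha ss.
  have ssc : is_sec e (sec_scale a l s).
    by apply/Mmod_secP; rewrite /sec_scale /= mulnDl PoszD; apply: arZ => //; exact/Mmod_secP.
  have ssc' : is_sec e (sec_scale a l (split_map s)).
    exact: Osum_sec_scale ha (split_map_sec ss).
  have [R1 R2] := split_coordsZ l0_neq0 Hf Hs a ((Mmod_secP _ _).1 ss).
  have sm := split_map_sec ssc.
  exact: Osum_sec_eq_res hg sm ssc' erefl R1 R2.
move=> e' h s e'0 h0 /hmP hh ss.
have hgh : hm (e + e')%N%:Z (g * h) by rewrite PoszD; exact: hmM.
have sr : is_sec (e + e') (sec_res h s).
  apply/Mmod_secP; rewrite /sec_res /= mulnDr addnC PoszD; apply: arZ; last exact/Mmod_secP.
  exact: hm_expn.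
have sr' : is_sec (e + e') (sec_res h (split_map s)).
  exact: Osum_sec_res hh (split_map_sec ss).
have [R1 R2] := split_coordsZ l0_neq0 Hf Hs (h ^+ s.2) ((Mmod_secP _ _).1 ss).
have sm := split_map_sec sr.
exact: Osum_sec_eq_res hgh sm sr' erefl R1 R2.
Qed.

End Iso.
End Line.
End SheafIso.

(** * Uniqueness of the splitting type *)

Section SplittingUnique.
Variable R : realType.
Local Notation C := R[i].
Local Notation S := {mpoly C[3]}.
Variables (l0 : 'cV[C]_3) (F : line_frame l0).
Hypothesis l0_neq0 : l0 != 0.
Local Notation alpha := (lf l0).
Local Notation rs := (res F).
Local Notation Lmod := (grestr alpha (gself R)).
Local Notation Osum e1 e2 := (gsum (gshift Lmod (- e1)) (gshift Lmod (- e2))).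

Section Rel.
Variables e1 e2 : int.
Implicit Types s t u : gcar (Osum e1 e2) * nat.

Definition osr (g : S) s t : Prop :=
  rfr F g s.1.1 s.2 t.1.1 t.2 /\ rfr F g s.1.2 s.2 t.1.2 t.2.

Lemma osrP e g s t : rs g != 0 -> hm e%:Z g -> is_sec e s -> is_sec e t ->
  (sec_eq e g s t <-> osr g s t).
Proof.
move=> g0 hg ss st; have E := Osum_sec_eqP F l0_neq0 hg ss st; split=> [/E[j [n1 n2]]|[n1 n2]].
  exact: conj (frac_eq_rfr g0 n1) (frac_eq_rfr g0 n2).
by apply: E.2; exists 0%N; exact: conj (rfr_frac_eq n1) (rfr_frac_eq n2).
Qed.

Lemma osr_sym g s t : osr g s t -> osr g t s.
Proof. by move=> [n1 n2]; exact: conj (rfr_sym n1) (rfr_sym n2). Qed.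

Lemma osr_trans g s t u : rs g != 0 -> osr g s t -> osr g t u -> osr g s u.
Proof. by move=> g0 [n1 n2] [m1 m2]; exact: conj (rfr_trans g0 n1 m1) (rfr_trans g0 n2 m2). Qed.

Lemma osr_res g h s t : osr g s t -> osr (g * h) (sec_res h s) (sec_res h t).
Proof.
move=> [n1 n2]; have N1 := rfr_res h n1; have N2 := rfr_res h n2.
by rewrite /sec_res; split; [exact: N1|exact: N2].
Qed.

Lemma osr_scale g a l s t : osr g s t -> osr g (sec_scale a l s) (sec_scale a l t).
Proof.
move=> [n1 n2]; have N1 := rfr_scale a l n1; have N2 := rfr_scale a l n2.
by rewrite /sec_scale; split; [exact: N1|exact: N2].
Qed.

End Rel.

Local Notation x := (lft F 'X_0).
Local Notation y := (lft F 'X_1).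

Let hx : hm 1 x. Proof. exact: hm_lftX. Qed.
Let hy : hm 1 y. Proof. exact: hm_lftX. Qed.
Let rx : rs x != 0. Proof. exact: res_lftX_neq0. Qed.
Let ry : rs y != 0. Proof. exact: res_lftX_neq0. Qed.
Let rxy : rs (x * y) != 0. Proof. exact: res_mul_neq0. Qed.

(* The section [x^n1 / x^k = x^(-e)] of the first summand, and its analogue on
   [D_+(y)]; they differ by the factor [(y / x)^e]. *)
Definition tsec e1 e2 (z : S) n1 k : gcar (Osum e1 e2) * nat := ((z ^+ n1 : S^o, 0 : S^o), k).

Lemma tsec_sec e1 e2 z (n1 k : nat) : hm 1 z -> n1%:Z = k%:Z - e1 -> is_sec 1 (tsec e1 e2 z n1 k).
Proof.
move=> hz En; apply/Osum_secP; split; last exact: hm0.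
have h := hm_expn n1 hz; rewrite muln1 En in h.
by rewrite muln1 addrC; exact: h.
Qed.

Lemma osr_twist_zero e1 e2 (s t : gcar (Osum e1 e2) * nat) (n1 n2 k0 : nat) ee :
  osr (x * y) (sec_res y s) (sec_scale (y ^+ n2 * x ^+ n1) k0 (sec_res x t)) ->
  n1%:Z = k0%:Z - ee -> ee < e1 -> ee < e2 -> is_sec 1 s -> rs s.1.1 = 0 /\ rs s.1.2 = 0.
Proof.
case: s t => [[a1 a2] k] [[b1 b2] l] [W1 W2] En lt1 lt2 /Osum_secP[p1 p2].
rewrite !muln1 in p1 p2.
have V1 : rfr F (x * y) (y ^+ k * a1) k (y ^+ n2 * x ^+ n1 * (x ^+ l * b1)) (k0 + l) by exact: W1.
have V2 : rfr F (x * y) (y ^+ k * a2) k (y ^+ n2 * x ^+ n1 * (x ^+ l * b2)) (k0 + l) by exact: W2.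
exact: conj (rfr_twist_zero V1 En lt1 p1) (rfr_twist_zero V2 En lt2 p2).
Qed.

Lemma osr_scale0 e1 e2 g (s : gcar (Osum e1 e2) * nat) :
  rs s.1.1 = 0 -> rs s.1.2 = 0 -> osr g (sec_scale 0 0 s) s.
Proof.
case: s => [[a1 a2] k] /= Z1 Z2.
have zz q : rs (0 * q) = 0 by rewrite mul0r res0.
have N1 : rfr F g (0 * a1) (0 + k) a1 k := rfr0 g (0 + k) k (zz a1) Z1.
have N2 : rfr F g (0 * a2) (0 + k) a2 k := rfr0 g (0 + k) k (zz a2) Z2.
rewrite /sec_scale; split; [exact: N1|exact: N2].
Qed.

Lemma tsec_neq0 e1 e2 z (s : gcar (Osum e1 e2) * nat) n1 k :
  rs z != 0 -> osr z (sec_scale 0 0 s) (tsec e1 e2 z n1 k) -> False.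
Proof.
case: s => [[a1 a2] l] z0 [N1 _].
have V : rfr F z (0 * a1) (0 + l) (z ^+ n1) k by exact: N1.
have zz : rs (0 * a1) = 0 by rewrite mul0r res0.
have := rfr0_eq0 z0 zz V.
by apply/eqP; exact: res_expn_neq0.
Qed.

Section Modules.
Variable f : S.
Local Notation Mmod := (grestr alpha (ARmod f)).

Lemma Mmod_sec_scale e a l (s : gcar Mmod * nat) : hm (l * e)%N%:Z a -> is_sec e s ->
  is_sec e (sec_scale a l s).
Proof.
move=> ha ss; apply/Mmod_secP; rewrite /sec_scale /= mulnDl PoszD; apply: arZ => //.
exact/Mmod_secP.
Qed.

Lemma Mmod_sec_res e e' h (s : gcar Mmod * nat) : hm e'%:Z h -> is_sec e s ->
  is_sec (e + e') (sec_res h s).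
Proof.
move=> hh ss; apply/Mmod_secP; rewrite /sec_res /= mulnDr addnC PoszD.
by apply: arZ; [exact: hm_expn|exact/Mmod_secP].
Qed.

(** If [e1 < d1], the twist by [e1] has a nonzero global section in the second model and none in the
    first. As only untwisted sections are available, that section is encoded by two sections, over
    [D_+(x)] and [D_+(y)], related by [(y / x)^e1] over [D_+(x y)]. It is pulled back through [psi]
    and pushed through [phi], where [osr_twist_zero] kills it. *)
Lemma sheaf_iso_le d1 d2 e1 e2 : d1 <= d2 ->
  sheaf_iso Mmod (Osum d1 d2) -> sheaf_iso Mmod (Osum e1 e2) -> d1 <= e1.
Proof.
move=> d12; rewrite leNgt => HD HE; apply/negP => lt.
(* A denominator of degree [|e1|] makes both [k0 - e1] and [k0 + e1] natural, whatever the sign of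
   [e1]. *)
pose k0 : nat := absz e1.
have [n1 En1] : exists n1 : nat, n1%:Z = k0%:Z - e1 by exists (absz (k0%:Z - e1)); lia.
have [n2 En2] : exists n2 : nat, n2%:Z = k0%:Z + e1 by exists (absz (k0%:Z + e1)); lia.
have nn : (n1 + n2 = k0 + k0)%N by clear -En1 En2; lia.
move: HD HE => [phi Hphi] [psi Hpsi].
have x0 := res_neq0 rx; have y0 := res_neq0 ry; have xy0 := res_neq0 rxy.
have hxy := hmM hx hy; rewrite -[1 + 1]/((1 + 1)%N%:Z) in hxy.
have dx := (hmP 1 x).1 hx; have dy := (hmP 1 y).1 hy; have dxy := (hmP _ _).1 hxy.
have [[fS fE fO] [_ fL fR]] := Hphi 1%N x isT x0 dx.
have [[gS gE gO] [_ gL gR]] := Hpsi 1%N x isT x0 dx.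
have [[fS' _ _] [_ _ fR']] := Hphi 1%N y isT y0 dy.
have [[gS' _ gO'] [_ _ gR']] := Hpsi 1%N y isT y0 dy.
have [[fS2 fE2 _] [_ fL2 _]] := Hphi (1 + 1)%N (x * y) isT xy0 dxy.
have [[gS2 gE2 _] [_ gL2 _]] := Hpsi (1 + 1)%N (x * y) isT xy0 dxy.
have sx := tsec_sec e2 hx En1; have sy := tsec_sec e2 hy En1.
have [mx smx Emx] := gO _ sx; have [my smy Emy] := gO' _ sy.
have Ox := (osrP rx hx (gS _ smx) sx).1 Emx; have Oy := (osrP ry hy (gS' _ smy) sy).1 Emy.
have smx2 := Mmod_sec_res hy smx; have smy2 := Mmod_sec_res hx smy.
have Gx := gR 1%N y mx isT y0 dy smx.
have Gy := gR' 1%N x my isT x0 dx smy.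
have Fx := fR 1%N y mx isT y0 dy smx.
have Fy := fR' 1%N x my isT x0 dx smy.
rewrite [y * x]mulrC in Gy Fy.
have {}Gx := (osrP rxy hxy (gS2 _ smx2) (Osum_sec_res hy (gS _ smx))).1 Gx.
have {}Gy := (osrP rxy hxy (gS2 _ smy2) (Osum_sec_res hx (gS' _ smy))).1 Gy.
have {}Fx := (osrP rxy hxy (fS2 _ smx2) (Osum_sec_res hy (fS _ smx))).1 Fx.
have {}Fy := (osrP rxy hxy (fS2 _ smy2) (Osum_sec_res hx (fS' _ smy))).1 Fy.
have Px := osr_trans rxy Gx (osr_res y Ox).
have Py0 := osr_res x Oy; rewrite [y * x]mulrC in Py0.
have Py := osr_trans rxy Gy Py0.
pose a := y ^+ n2 * x ^+ n1.
have ha : hm (k0 * (1 + 1))%N%:Z a.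
  have h := hmM (hm_expn n2 hy) (hm_expn n1 hx).
  by rewrite !muln1 -PoszD addnC nn addnn -muln2 in h; exact: h.
have smy3 := Mmod_sec_scale ha smy2.
have GL := (osrP rxy hxy (gS2 _ smy3) (Osum_sec_scale ha (gS2 _ smy2))).1 (gL2 a k0 _ ((hmP _ _).1 ha) smy2).
have FL := (osrP rxy hxy (fS2 _ smy3) (Osum_sec_scale ha (fS2 _ smy2))).1 (fL2 a k0 _ ((hmP _ _).1 ha) smy2).
have tw : osr (x * y) (sec_scale a k0 (sec_res x (tsec e1 e2 y n1 k0))) (sec_res y (tsec e1 e2 x n1 k0)).
  have T1 := rfr_twist F x y nn.
  have z1 : rs (a * (x ^+ k0 * 0)) = 0 by rewrite !mulr0 res0.
  have z2 : rs (y ^+ k0 * 0) = 0 by rewrite mulr0 res0.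
  have T2 := rfr0 (x * y) (k0 + k0) k0 z1 z2.
  exact: conj T1 T2.
(* Over [D_+(x y)] the restriction of [mx] and the rescaled restriction of [my] have equal images
   under [psi]; they are therefore equal sections, and have equal images under [phi]. *)
have Q := osr_trans rxy GL (osr_trans rxy (osr_scale a k0 Py) tw).
have EM := (gE2 _ _ smx2 smy3).2 ((osrP rxy hxy (gS2 _ smx2) (gS2 _ smy3)).2 (osr_trans rxy Px (osr_sym Q))).
have {}EM := (osrP rxy hxy (fS2 _ smx2) (fS2 _ smy3)).1 ((fE2 _ _ smx2 smy3).1 EM).
have W := osr_trans rxy (osr_sym Fx) (osr_trans rxy EM (osr_trans rxy FL (osr_scale a k0 Fy))).
have [Z1 Z2] := osr_twist_zero W En1 lt (lt_le_trans lt d12) (fS _ smx).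
(* The vanishing of a section is expressed as its equality with its multiple by 0, which linearity
   carries from one model to the other. *)
have h0 : hm (0 * 1)%N%:Z (0 : S) by exact: hm0.
have sm0 := Mmod_sec_scale h0 smx.
have F0 := (osrP rx hx (fS _ sm0) (Osum_sec_scale h0 (fS _ smx))).1 (fL 0 0%N _ ((hmP _ _).1 h0) smx).
have G0 := (osrP rx hx (gS _ sm0) (Osum_sec_scale h0 (gS _ smx))).1 (gL 0 0%N _ ((hmP _ _).1 h0) smx).
have Fz := osr_scale0 x Z1 Z2.
have EZ := (fE _ _ sm0 smx).2 ((osrP rx hx (fS _ sm0) (fS _ smx)).2 (osr_trans rx F0 Fz)).
have {}EZ := (osrP rx hx (gS _ sm0) (gS _ smx)).1 ((gE _ _ sm0 smx).1 EZ).
exact: tsec_neq0 rx (osr_trans rx (osr_sym G0) (osr_trans rx EZ Ox)).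
Qed.

Lemma sheaf_iso_unique d1 d2 e1 e2 : d1 <= d2 -> e1 <= e2 ->
  sheaf_iso Mmod (Osum d1 d2) -> sheaf_iso Mmod (Osum e1 e2) -> d1 = e1.
Proof.
by move=> d12 e12 D E; apply/eqP; rewrite eq_le (sheaf_iso_le d12 D E) (sheaf_iso_le e12 E D).
Qed.

End Modules.

End SplittingUnique.

Lemma sum_count_undup (T : eqType) (s : seq T) : (\sum_(x <- undup s) count_mem x s)%N = size s.
Proof.
rewrite -(perm_size (perm_count_undup s)) size_flatten /shape -map_comp sumnE big_map.
by apply: eq_bigr => x _; rewrite /= size_nseq.
Qed.

Section SplitIdeal.
Variable K : numClosedFieldType.
Local Notation S := {mpoly K[3]}.
Variables (d r : nat) (f : S) (rho1 : 'rV[S]_3) (l0 : 'cV[K]_3) (F : line_frame l0).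
Hypothesis Hf : reduced_eq d f.
Hypothesis s1 : dot rho1 (grad f) = 0.

Lemma split_omega_dvd m b tau sigma rho : on_split d r f rho1 F m b tau sigma ->
  dot rho (grad f) = 0 -> exists y, res F (omega f rho1 rho) = b * y.
Proof.
move=> [_ _ _ _ [H _]] s2'; pose N := (\max_(i < 3) msize (rho 0%R i))%N.
have [i|e [he ->]] := syz_components (N := N) Hf s2'.
  exact: (@leq_bigmax _ (fun i => msize (rho 0 i))).
have s2 k : dot (e k) (grad f) = 0 by case: (he k).
suff [] : dot (\sum_(k < N) e k) (grad f) = 0 /\
  exists y, res F (omega f rho1 (\sum_(k < N) e k)) = b * y by [].
elim: (N) => [|k [IH [y Ey]]].
  rewrite big_ord0; split; first by rewrite /dot big1 // => i _; rewrite mxE mul0r.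
  exists 0; rewrite mulr0 -(scale0r (0 : 'rV[S]_3)) (omegaZr Hf) // ?mul0r ?res0 //.
  by rewrite /dot big1 // => i _; rewrite mxE mul0r.
rewrite big_ord_recr /=; split; first by rewrite dotDl IH s2 addr0.
have [x' [y' [_ _ _ Ey']]] := H _ _ (he k).
by exists (y + y'); rewrite (omegaDr Hf) // resD Ey Ey' mulrDr.
Qed.

End SplitIdeal.

Section PowerSeriesQuotient.
Variable R : realType.
Local Notation C := R[i].

Lemma convergentP (a : 'X_{1..2} -> C) : convergent a <-> nonneg_geometric_bound a.
Proof. exact: geometric_boundP. Qed.

(** Modulo [u] the generators have order at least [n] in [v], and [P] has order exactly [n]: the
    ideal is [(u, v^n)], with basis [1, ..., v^(n-1)] of the quotient. Spanning is Weierstrass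
    division by [P]. *)
Lemma ps_quot_dim (G : ('X_{1..2} -> C) -> Prop) n (P : {mpoly C[2]}) :
  G (ps_poly 'X_0) ->
  (forall a, G a -> a = ps_poly 'X_0 \/ forall k, (k < n)%N -> a (axis k) = 0) ->
  G (ps_poly P) -> (forall k, (k < n)%N -> P@_(axis k) = 0) -> P@_(axis n) != 0 ->
  quot_dim (@convergent R) (ps_ideal G) n.
Proof.
move=> GX Gn GP Pn P0.
pose e (i : 'I_n) : 'X_{1..2} -> C := fun m => (m == axis i)%:R.
have E (c : 'I_n -> C) m : (\sum_i c i *: e i) m = \sum_i c i * (m == axis i)%:R.
  by rewrite fct_sumE.
exists e; split=> [i|a ca|c].
- exists 1, 1 => m; rewrite expr1n mulr1 /e; case: eqP => _; rewrite ?normr1 // normr0.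
  exact: ler01.
- have [c [h [gc gh Eq]]] := axis_division Pn P0 ((convergentP a).1 ca).
  exists (fun i => a (axis i)), 2, (fun i => if i == 0 then c else h),
    (fun i => if i == 0 then ps_poly P else ps_poly 'X_0); split=> [j|j|m].
  + by case: ifP => _; exact/convergentP.
  + by case: ifP.
  + rewrite !big_ord_recl big_ord0 addr0 /=.
    have E1 : (a - \sum_(i < n) a (axis i) *: e i) m = a m - (\sum_(i < n) a (axis i) *: e i) m by [].
    rewrite E1 E; exact: Eq.
- move=> [N [c' [g [_ Gg Ec]]]] i.
  have Ei := Ec (axis i); rewrite E axis_sum in Ei.
  rewrite Ei; apply: big1 => j _.
  have -> : ps_mul (c' j) (g j) (axis i) = \sum_(k < i.+1) c' j (axis k) * g j (axis (i - k)).
    exact: pmul_axis.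
  apply: big1 => k _; case: (Gn _ (Gg j)) => [->|->]; last 1 first.
  + by rewrite (leq_ltn_trans (leq_subr _ _)).
  + rewrite /ps_poly mcoeffX; case: eqP => [Ex|_]; last by rewrite mulr0.
    by have := congr1 (fun m : 'X_{1..2} => m 0) Ex; rewrite axisE mnm1E.
  + by rewrite mulr0.
Qed.

End PowerSeriesQuotient.

(** * Multiplicities on a line *)

Section LineMultiplicity.
Variable R : realType.
Local Notation C := R[i].
Local Notation S := {mpoly C[3]}.
Variables (d r : nat) (f : S) (rho1 : 'rV[S]_3).
Hypothesis Hf : reduced_eq d f.
Hypothesis s1 : dot rho1 (grad f) = 0.

Lemma Bideal_omega g : Bideal f rho1 g ->
  exists2 rho, dot rho (grad f) = 0 & g = d%:R *: omega f rho1 rho.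
Proof.
have [_ _ f0 _] := Hf.
move=> [rho /syzP e E]; exists rho => //; apply: (mulIf f0).
have D := det_omega Hf s1 e; rewrite -E; exact: D.
Qed.

Lemma omega_Bideal rho : dot rho (grad f) = 0 -> Bideal f rho1 (d%:R *: omega f rho1 rho).
Proof. move=> e; exists rho; [exact/syzP|exact: (det_omega Hf s1 e)]. Qed.

Variables (l0 : 'cV[C]_3) (F : line_frame l0).
Hypothesis l0_neq0 : l0 != 0.
Variables (m : nat) (b : {mpoly C[2]}) (tau sigma : 'rV[{mpoly C[2]}]_3).
Hypothesis sp : on_split d r f rho1 F m b tau sigma.

Lemma Bideal_res g : Bideal f rho1 g -> exists y, res F g = b * y.
Proof.
move=> /Bideal_omega[rho e ->]; have [y Ey] := split_omega_dvd Hf s1 sp e.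
exists (d%:R%:MP * y); rewrite -mul_mpolyC resM resC Ey.
exact: mulrCA.
Qed.

Lemma Bideal_res_neq0 (v : 'rV[C]_2) : v != 0 -> exists g y,
  [/\ Bideal f rho1 g, res F g = b * y & y.@[v 0] != 0].
Proof.
move=> v0; have [_ _ _ _ [_ H]] := sp; have [k [e [y [[_ ae] Ey yv]]]] := H v v0.
have [d0 _ _ _] := Hf.
exists (d%:R *: omega f rho1 e), (d%:R *: y); split; first exact: omega_Bideal.
  rewrite -mul_mpolyC resM resC Ey -[d%:R *: y]mul_mpolyC; exact: mulrCA.
by rewrite mevalZ mulf_neq0 // pnatr_eq0 -lt0n.
Qed.

Lemma in_supp_frame (v : 'rV[C]_2) : v != 0 ->
  in_supp f rho1 (v *m frame_in F) <-> b.@[v 0] = 0.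
Proof.
move=> v0; split=> [[_ H]|bv].
  have [g [y [Bg Eg yv]]] := Bideal_res_neq0 v0.
  have := H g Bg; rewrite -res_meval Eg mevalM => /eqP.
  by rewrite mulf_eq0 (negPf yv) orbF => /eqP.
split=> [|g Bg]; first by rewrite frame_pt_neq0.
by have [y Ey] := Bideal_res Bg; rewrite -res_meval Ey mevalM bv mul0r.
Qed.

Lemma on_line_lf (p : 'rV[C]_3) : on_line (lf l0) p <-> p *m l0 = 0.
Proof.
rewrite /on_line lf_meval; split=> [E|->]; last by rewrite mxE.
by apply/rowP => i; rewrite !(ord1 i) E mxE.
Qed.

(** On the line the ideal restricts to multiples of [b], and some element to [b] times a form
    nonzero at the point; the order of [b] there is the number of its factors [lam v]. *)
Lemma local_mult_count c (s : seq 'rV[C]_2) (v : 'rV[C]_2) :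
  c != 0 -> all (@normal_point _) s -> b = c *: \prod_(u <- s) lam u -> normal_point v ->
  local_mult f rho1 (lf l0) (v *m frame_in F) (count_mem v s).
Proof.
move=> c0 ns Eb nv; have v0 := normal_point_neq0 nv.
have [Q [w [uQ Q0 Q2 vw]]] := exists_line_chart F l0_neq0 v0.
exists Q; split=> //; try by apply/on_line_lf; rewrite ?Q0 ?Q2 frame_pt_on.
have [B EB B0] := line_param_prod c0 nv ns vw; rewrite -Eb in EB.
have chartE g y : res F g = b * y ->
    axis_poly (g \mPo chart Q) = 'X^(count_mem v s) * (B * line_param v w y).
  move=> Eg.
  have ET i : axis_poly (tnth (chart Q) i) =
      ((v *m frame_in F) 0 i)%:P + ((w *m frame_in F) 0 i)%:P * 'X.
    have -> : (v *m frame_in F) 0 i = Q 0 i by rewrite -Q0 mxE.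
    have -> : (w *m frame_in F) 0 i = Q 2 i by rewrite -Q2 mxE.
    rewrite tnth_mktuple; exact: axis_poly_affine.
  rewrite (axis_poly_chart F g (frame_pt_on F v) (frame_pt_on F w) ET).
  rewrite !frame_ptK Eg; have EM := line_paramM v w b y; rewrite EB in EM.
  exact: etrans EM (esym (mulrA _ _ _)).
have [g [y [Bg Eg yv]]] := Bideal_res_neq0 v0.
apply: (@ps_quot_dim _ _ _ (g \mPo chart Q)).
- by left.
- move=> a [->|[h Bh ->]]; [by left|right => k kn].
  have [z /chartE Ez] := Bideal_res Bh.
  by rewrite /ps_poly -coef_axis_poly Ez coefXnM kn.
- by right; exists g.
- by move=> k kn; rewrite -coef_axis_poly (chartE _ _ Eg) coefXnM kn.
- rewrite -coef_axis_poly (chartE _ _ Eg) coefXnM ltnn subnn -horner_coef0 hornerM.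
  by rewrite line_param_horner0 mulf_neq0.
Qed.

Lemma line_mult_split : line_mult f rho1 (lf l0) m.
Proof.
have [[hb b0] _ _ _ _] := sp.
have [c [s [c0 sz ns Eb]]] := binary_form_prod hb b0.
have bz (v : 'rV[C]_2) : b.@[v 0] = 0 <-> exists2 u, u \in s & (lam u).@[v 0] = 0.
  rewrite Eb mevalZ rmorph_prod /=; split=> [/eqP|[u us uv]].
    rewrite mulf_eq0 (negPf c0) prodf_seq_eq0 => /hasP[u us /= /eqP uv].
    by exists u.
  by rewrite (big_rem u) //= uv mul0r mulr0.
pose t := undup s.
have nt u : u \in s -> normal_point u by move=> us; exact: (allP ns).
have tn (k : 'I_(size t)) : t`_k \in s by rewrite -mem_undup mem_nth.
exists (size t), (fun k => t`_k *m frame_in F), (fun k => count_mem t`_k s); split.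
- move=> k l [e e0 Ekl].
  have E : t`_k = e *: t`_l.
    have := congr1 (fun y => y *m frame_out F) Ekl.
    by rewrite -scalemxAl !frame_ptK.
  have /eqP := normal_point_eq (nt _ (tn l)) (nt _ (tn k)) E.
  by rewrite nth_uniq ?undup_uniq // => /eqP/val_inj.
- move=> q; split=> [[[q0 Sq] /on_line_lf ql]|[k [e e0 ->]]].
    set v := q *m frame_out F; have Ev : v *m frame_in F = q by exact: frame_ptP.
    have v0 : v != 0 by exact: frame_out_neq0.
    have [|u us uv] := (bz v).1; first by apply/(in_supp_frame v0); rewrite Ev.
    have [e Ee] := lam_zero (normal_point_neq0 (nt u us)) uv.
    have us' : u \in t by rewrite mem_undup.
    have ku : (index u t < size t)%N by rewrite index_mem.
    exists (Ordinal ku); exists e; last by rewrite -Ev Ee -scalemxAl nth_index.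
    by apply: contraNneq v0 => e0; rewrite Ee e0 scale0r.
  have u0 := normal_point_neq0 (nt _ (tn k)).
  have v0 : e *: t`_k != 0 by rewrite scaler_eq0 negb_or e0.
  rewrite scalemxAl; split; last by apply/on_line_lf; rewrite frame_pt_on.
  apply/(in_supp_frame v0)/bz; exists t`_k => //.
  by rewrite lam_meval !mxE mulrCA [X in _ - X]mulrCA [X in e * X - _]mulrC subrr.
- by move=> k; exact: local_mult_count c0 ns Eb (nt _ (tn k)).
- by rewrite -sz -[LHS]sum_count_undup -/t (big_nth 0) big_mkord.
Qed.

End LineMultiplicity.

(** * Finiteness of the support and the bound by its defect *)

Section PointList.
Variable K : numClosedFieldType.

Lemma exists_point_list (Z : 'rV[K]_3 -> Prop) (nu : nat) : (forall p, Z p -> p != 0) ->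
  (forall m (p : 'I_m -> 'rV[K]_3), independent_points p -> (forall k, Z (p k)) -> (m <= nu)%N) ->
  exists pts : seq 'rV[K]_3, [/\ (size pts <= nu)%N, forall q, q \in pts -> Z q
    & forall p, Z p -> exists2 q, q \in pts & exists2 c, c != 0 & p = c *: q].
Proof.
move=> Z0 bound.
pose P m := `[< exists2 p : 'I_m -> 'rV[K]_3, independent_points p & forall k, Z (p k) >].
have P0 : exists m, P m.
  by exists 0%N; apply/asboolP; exists (fun=> 0); [split; case|case].
have PD m : P m -> (m <= nu)%N by move=> /asboolP[p ip Zp]; exact: bound ip Zp.
case: (ex_maxnP P0 PD) => n /asboolP[p [pn0 ip] Zp] nmax.
exists [seq p k | k : 'I_n]; split.
- by rewrite size_image card_ord; apply: bound Zp.
- by move=> q /imageP[k _ ->].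
move=> a Za; apply: contrapT => H.
have aN k t : p k <> t *: a.
  move=> E; apply: H; exists (p k); first exact: image_f.
  have t0 : t != 0 by apply: contraNneq (pn0 k) => t0; rewrite E t0 scale0r.
  by exists t^-1; rewrite ?invr_neq0 // E scalerA mulVf // scale1r.
have Na k t : a <> t *: p k.
  move=> E; apply: H; exists (p k); first exact: image_f.
  by exists t => //; apply: contraNneq (Z0 _ Za) => t0; rewrite E t0 scale0r.
have [] := negP (negbT (ltnn n)); apply: nmax; apply/asboolP.
pose p' (i : 'I_n.+1) := if unlift ord0 i is Some j then p j else a.
have p'l j : p' (lift ord0 j) = p j by rewrite /p' liftK.
have p'0 : p' ord0 = a by rewrite /p' unlift_none.
exists p'; last by move=> k; case: (unliftP ord0 k) => [j ->|->]; rewrite ?p'l ?p'0.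
split=> [k|j k]; first by case: (unliftP ord0 k) => [j ->|->]; rewrite ?p'l ?p'0 ?Z0.
case: (unliftP ord0 k) => [k' ->|->]; case: (unliftP ord0 j) => [j' ->|->] jk t; rewrite ?p'l ?p'0 //.
by apply: ip; apply: contraNneq jk => ->.
Qed.

Lemma linear_form_lf n (p : {mpoly K[n]}) : p \is 1.-homog -> p = lf (\col_i p@_(U_(i))).
Proof.
move=> hp; apply/mpolyP => mu.
have [mu1|mu1] := eqVneq (mdeg mu) 1%N; last first.
  rewrite (dhomog_nemf_coeff hp mu1) (dhomog_nemf_coeff _ mu1) //.
  by apply/hmP; exact: hm_lf.
by have /eqP/mdeg1P[i /eqP->] := mu1; rewrite mcoeff_lf mxE.
Qed.

End PointList.

Section NuBound.
Variable R : realType.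
Local Notation C := R[i].
Local Notation S := {mpoly C[3]}.
Variables (d r : nat) (f : S) (rho1 : 'rV[S]_3).
Hypothesis Hf : reduced_eq d f.
Hypothesis ar1 : ar f r%:Z rho1.
Hypothesis rho1_neq0 : rho1 != 0.
Hypothesis rmin : forall (k : nat) rho, (k < r)%N -> ar f k%:Z rho -> rho = 0.
Hypothesis r0 : (0 < r)%N.
Hypothesis rd : (2 * r <= d - 1)%N.

Let s1 : dot rho1 (grad f) = 0. Proof. by case: ar1. Qed.

Lemma jacobian_dot g : Jacobian_ideal f g <-> exists w, g = dot w (grad f).
Proof.
split=> [[a ->]|[w ->]].
  by exists (\row_i a i); apply: eq_bigr => i _; rewrite !mxE.
by exists (fun i => w 0 i); apply: eq_bigr => i _; rewrite mxE.
Qed.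

Lemma in_supp_omega p : in_supp f rho1 p <-> p != 0 /\ omega_zero f rho1 p.
Proof.
have [d0 _ _ _] := Hf.
have dn : d%:R != 0 :> C by rewrite pnatr_eq0 -lt0n.
split=> -[p0 H]; split=> //.
  move=> rho e; have := H _ (omega_Bideal Hf s1 e); rewrite mevalZ => /eqP.
  by rewrite mulf_eq0 (negPf dn) => /eqP.
move=> g /(Bideal_omega Hf s1)[rho e ->]; rewrite mevalZ (H rho e); exact: mulr0.
Qed.

Lemma exists_nu : exists2 nu, is_nu d f nu &
  forall m (p : 'I_m -> 'rV[C]_3), independent_points p ->
    (forall k, in_supp f rho1 (p k)) -> (m <= nu)%N.
Proof.
pose A (g : S) := g \is ((3 * (d - 2))./2).-homog /\ saturated_Jacobian_ideal f g.
have IZ (k : C) g : Jacobian_ideal f g -> Jacobian_ideal f (k *: g).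
  move=> /jacobian_dot[w ->]; apply/jacobian_dot; exists (k%:MP *: w).
  by rewrite dotZl mul_mpolyC.
(* The number of monomials up to degree [(3 (d - 2))./2] bounds every independent family, so the
   dimension exists. *)
have [m e eA ei|nu Hnu numax] := @exists_quot_dim C S A (Jacobian_ideal f)
  #|{: 'X_{1..3 < ((3 * (d - 2))./2).+1}}| IZ.
  rewrite leqNgt; apply/negP => lt.
  have [i|c [Ec [i ci]]] := dhomog_dependent (e := e) _ lt; first by case: (eA i).
  case/negP: ci; apply/eqP; apply: ei; rewrite Ec; apply/jacobian_dot; exists 0.
  by rewrite /dot big1 // => j _; rewrite mxE mul0r.
exists nu => // m p ip sp.
have zp k : omega_zero f rho1 (p k) by case: ((in_supp_omega (p k)).1 (sp k)).
have [M [q [hq sq iq]]] := independent_quotients Hf ar1 rho1_neq0 rmin r0 rd ip zp.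
apply: (numax _ q) => [k|c].
  split; first exact/hmP.
  exists M => mu muM; apply/jacobian_dot; apply: sq.
  by apply/hmP; rewrite dhomogX; apply/eqP.
move=> /jacobian_dot[w Ew]; apply: (iq c w).
by rewrite -Ew; apply: eq_bigr => k _; rewrite mul_mpolyC.
Qed.

End NuBound.

(** * Jumping lines *)

Section JumpingLines.
Variable R : realType.
Local Notation C := R[i].
Local Notation S := {mpoly C[3]}.
Variables (d r : nat) (f : S) (rho1 : 'rV[S]_3).
Hypothesis Hf : reduced_eq d f.
Hypothesis ar1 : ar f r%:Z rho1.
Hypothesis rho1_neq0 : rho1 != 0.
Hypothesis rmin : forall (k : nat) rho, (k < r)%N -> ar f k%:Z rho -> rho = 0.
Hypothesis r0 : (0 < r)%N.
Hypothesis rd : (2 * r <= d - 1)%N.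

Let s1 : dot rho1 (grad f) = 0. Proof. by case: ar1. Qed.

Lemma lineP (alpha : S) : is_line alpha -> exists2 l : 'cV[C]_3, l != 0 & alpha = lf l.
Proof.
move=> [a0 /linear_form_lf Ea]; exists (\col_i alpha@_(U_(i))) => //.
by apply: contraNneq a0 => E; rewrite Ea E lf_eq0.
Qed.

Lemma is_line_lf (l : 'cV[C]_3) : l != 0 -> is_line (lf l).
Proof. by move=> l0; split; [rewrite lf_eq0|apply/hmP; exact: hm_lf]. Qed.

Lemma splitting_type_unique (alpha : S) d1 d2 e1 e2 : is_line alpha ->
  splitting_type f alpha d1 d2 -> splitting_type f alpha e1 e2 -> d1 = e1.
Proof.
move=> /lineP[l l0 ->] [d12 D] [e12 E]; have [F] := exists_line_frame l0.
have U := sheaf_iso_unique F l0 d12 e12 D E.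
exact: U.
Qed.

(** All lines are treated at once: [m = 0] is the case of a line that misses the support, and its
    type is the generic one. *)
Lemma line_data (alpha : S) : is_line alpha -> exists m : nat,
  [/\ line_mult f rho1 alpha m,
      splitting_type f alpha (r%:Z - m%:Z) (d%:Z - 1 - r%:Z + m%:Z), (m <= r)%N
    & (0 < m)%N <-> exists2 p, in_supp f rho1 p & on_line alpha p].
Proof.
move=> /lineP[l l0 ->]; have [F] := exists_line_frame l0.
have [m [b [tau [sigma sp]]]] := exists_split Hf ar1 rho1_neq0 rmin rd l0 F.
have [[hb b0] mr _ _ _] := sp.
exists m; split=> //.
- have U := line_mult_split Hf s1 l0 sp; exact: U.
- split; first by clear -rd mr r0; lia.
  have U := split_sheaf_iso l0 Hf sp; exact: U.
split=> [m0|[p [p0 Zp] /on_line_lf pl]].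
  have [v /normal_point_neq0 v0 bv] := binary_form_zero m0 hb.
  exists (v *m frame_in F); first exact/(in_supp_frame Hf s1 sp v0).
  by apply/on_line_lf; exact: frame_pt_on.
have v0 := frame_out_neq0 F pl p0.
have bz : b.@[(p *m frame_out F) 0] = 0.
  by apply/(in_supp_frame Hf s1 sp v0); rewrite (frame_ptP F pl).
rewrite lt0n; apply: contraNneq b0 => m0; rewrite m0 in hb.
by move: bz; rewrite (dhomog_const hb) mevalC => ->; rewrite mpolyC0.
Qed.

Lemma exists_line_through (q : 'rV[C]_3) : exists2 l : 'cV[C]_3, l != 0 & q *m l = 0.
Proof.
have : kermx q^T != 0.
  by rewrite kermx_eq0 -row_leq_rank -ltnNge; apply: leq_ltn_trans (rank_leq_col _) _.
move=> /rowV0Pn[u /sub_kermxP uq u0]; exists u^T; first by rewrite -trmx0 (inj_eq trmx_inj).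
by apply: trmx_inj; rewrite trmx_mul trmxK uq trmx0.
Qed.

(** Elements of [B(C, rho1)] may be inhomogeneous, so invariance under scaling is read on a line
    through the point, where the support is the zero set of the form [b]. *)
Lemma in_supp_scale (q : 'rV[C]_3) c : c != 0 -> in_supp f rho1 q -> in_supp f rho1 (c *: q).
Proof.
move=> c0 [q0 Zq]; have [l l0 ql] := exists_line_through q; have [F] := exists_line_frame l0.
have [m [b [tau [sigma sp]]]] := exists_split Hf ar1 rho1_neq0 rmin rd l0 F.
have [[hb b0] _ _ _ _] := sp; have v0 := frame_out_neq0 F ql q0.
have cv0 : c *: (q *m frame_out F) != 0 by rewrite scaler_eq0 negb_or c0.
rewrite -(frame_ptP F ql) scalemxAl; apply/(in_supp_frame Hf s1 sp cv0).
apply: hm_zero_scale hb _; apply/(in_supp_frame Hf s1 sp v0).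
by rewrite (frame_ptP F ql).
Qed.

Variable pts : seq 'rV[C]_3.
Hypothesis ptsP : forall p, in_supp f rho1 p <-> exists2 q, q \in pts & same_point p q.

Lemma supp_on_line (alpha : S) : is_line alpha ->
  (exists2 p, in_supp f rho1 p & on_line alpha p) <-> exists2 q, q \in pts & on_line alpha q.
Proof.
move=> /lineP[l l0 ->]; split=> [[p /ptsP[q qp [c c0 ->]]] /on_line_lf|[q qp ql]].
  rewrite -scalemxAl => /eqP; rewrite scaler_eq0 (negPf c0) => /eqP ql.
  by exists q => //; apply/on_line_lf.
exists q => //; apply/ptsP; exists q => //; exists 1; rewrite ?scale1r //.
exact: oner_neq0.
Qed.

Lemma generic_splitting : generic_splitting_type f r%:Z (d%:Z - 1 - r%:Z).
Proof.
(* As a form on the dual plane, this product is nonzero exactly at the lines that miss all the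
   points of the support. *)
exists (size pts), (\prod_(q <- pts) lf q^T); split.
- apply/hmP; elim: pts => [|q s IH]; first by rewrite big_nil; exact: hm1.
  by rewrite big_cons /= -[(size s).+1]add1n PoszD; apply: hmM => //; exact: hm_lf.
- rewrite prodf_seq_neq0; apply/allP => q qp /=.
  have [q0 _] : in_supp f rho1 q.
    apply/ptsP; exists q => //; exists 1; rewrite ?scale1r //; exact: oner_neq0.
  by rewrite lf_eq0 -trmx0 (inj_eq trmx_inj).
move=> alpha al; have [m [_ st _ mE]] := line_data al.
have [m00|m0] := posnP m => Phi0; last first.
  have /(supp_on_line al)[q qp] := mE.1 m0.
  have [l l0 El] := lineP al; rewrite {1}El => /on_line_lf ql.
  case/negP: Phi0; rewrite rmorph_prod /= (big_rem q) //= mulf_eq0; apply/orP; left.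
  pose v : 'rV[C]_3 := \row_i alpha@_(U_(i)).
  have -> : (lf q^T).@[fun i => alpha@_(U_(i))] = (lf q^T).@[v 0].
    by apply: meval_eq => i; rewrite mxE.
  rewrite lf_meval; have -> : v = l^T by apply/rowP => i; rewrite !mxE El mcoeff_lf.
  by rewrite -trmx_mul ql !mxE.
by move: st; rewrite m00 subr0 addr0.
Qed.

Lemma generic_splitting_unique e1 e2 : generic_splitting_type f e1 e2 -> e1 = r%:Z.
Proof.
move=> [k [Phi [hPhi Phi0 H]]]; have [k' [Psi [hPsi Psi0 H']]] := generic_splitting.
(* The factor ['X_0] ensures that the vector found is nonzero, hence defines a line, even if [Phi]
   and [Psi] are constant. *)
have X0 : 'X_0 != 0 :> S.
  rewrite -lf_delta lf_eq0; apply/eqP => /colP/(_ 0); rewrite !mxE /= => /eqP.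
  by rewrite oner_eq0.
have [v] := exists_meval_neq0 (mulf_neq0 X0 (mulf_neq0 Phi0 Psi0)).
rewrite !mevalM mevalXU !mulf_eq0 !negb_or => /and3P[v0 Phiv Psiv].
have al : is_line (lf v^T).
  by apply: is_line_lf; apply: contraNneq v0 => /(congr1 (fun x : 'cV_3 => x 0 0)); rewrite !mxE => ->.
have E (g : S) : g.@[fun i => (lf v^T)@_(U_(i))] = g.@[v 0].
  by apply: meval_eq => i; rewrite mcoeff_lf mxE.
have st := H _ al; have st' := H' _ al; rewrite E in st; rewrite E in st'.
exact: splitting_type_unique al (st Phiv) (st' Psiv).
Qed.

Lemma line_orderE (alpha : S) m o : is_line alpha ->
  splitting_type f alpha (r%:Z - m%:Z) (d%:Z - 1 - r%:Z + m%:Z) ->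
  line_order f alpha o <-> o = m%:Z.
Proof.
move=> al st; split=> [[e1 [e2 [d1 [d2 [ge se ->]]]]]|->].
  by rewrite (generic_splitting_unique ge) (splitting_type_unique al se st) subKr.
exists r%:Z, (d%:Z - 1 - r%:Z), (r%:Z - m%:Z), (d%:Z - 1 - r%:Z + m%:Z).
by split; [exact: generic_splitting|exact: st|rewrite subKr].
Qed.

Lemma jumping_lineE (alpha : S) : is_line alpha ->
  jumping_line f alpha <-> exists2 p, in_supp f rho1 p & on_line alpha p.
Proof.
move=> al; have [m [_ st _ <-]] := line_data al.
split=> [[_ [o /(line_orderE _ al st) -> o0]]|m0]; first by rewrite -ltz_nat.
by split=> //; exists m%:Z; [exact/(line_orderE _ al st)|rewrite ltz_nat].
Qed.

Lemma VlinesE (alpha : S) : is_line alpha ->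
  Vlines f (r%:Z - 1) alpha <-> exists2 p, in_supp f rho1 p & on_line alpha p.
Proof.
move=> al; have [m [_ st _ <-]] := line_data al; split=> [[_ [d1 [d2 [se]]]]|m0].
  by rewrite (splitting_type_unique al se st); clear; lia.
split=> //; exists (r%:Z - m%:Z), (d%:Z - 1 - r%:Z + m%:Z); split=> //.
by clear -m0; lia.
Qed.

End JumpingLines.

Theorem theorem5p10 (R : realType) (d r : nat) (f : {mpoly R[i][3]})
    (rho1 : 'rV[{mpoly R[i][3]}]_3)
    (Hf : reduced_form d f)
    (Hr : is_mdr f r) (Hr1 : (1 <= r)%N)
    (Hrho : AR f r%:Z rho1) (Hrho0 : rho1 != 0)
    (Hrd : (2 * r <= d - 1)%N) :
  [/\ forall alpha, is_line alpha ->
        (exists2 p, in_supp f rho1 p & on_line alpha p) ->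
        jumping_line f alpha /\
        exists m : nat,
          [/\ line_mult f rho1 alpha m,
              splitting_type f alpha (r%:Z - m%:Z) (d%:Z - 1 - r%:Z + m%:Z),
              line_order f alpha m%:Z
            & (m <= r)%N],
      forall alpha, jumping_line f alpha <-> Vlines f (r%:Z - 1) alpha
    & exists (nu : nat) (pts : seq 'rV[R[i]]_3),
        [/\ is_nu d f nu, (size pts <= nu)%N,
            forall p, in_supp f rho1 p <->
                      exists2 q, q \in pts & same_point p q
          & forall alpha, Vlines f (r%:Z - 1) alpha <->
              is_line alpha /\ exists2 q, q \in pts & on_line alpha q]].
Proof.
have [hf f0 fred] := Hf.
have Hf' : reduced_eq d f by split=> //; [clear -Hr1 Hrd; lia|exact/hmP].
have ar1 : ar f r%:Z rho1 by exact/ARP.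
have rmin (k : nat) rho : (k < r)%N -> ar f k%:Z rho -> rho = 0.
  by have [_ H] := Hr; move=> kr /ARP; exact: H.
have [nu Hnu bound] := exists_nu Hf' ar1 Hrho0 rmin Hr1 Hrd.
have [p []|pts [sz ptsZ Zpts]] := exists_point_list _ bound; first by [].
have ptsP p : in_supp f rho1 p <-> exists2 q, q \in pts & same_point p q.
  split=> [/Zpts//|[q /ptsZ Zq [c c0 ->]]].
  have U := in_supp_scale Hf' ar1 Hrho0 rmin Hrd c0 Zq; exact: U.
have JE alpha al := jumping_lineE Hf' ar1 Hrho0 rmin Hr1 Hrd ptsP (alpha := alpha) al.
have VE alpha al := VlinesE Hf' ar1 Hrho0 rmin Hr1 Hrd (alpha := alpha) al.
split.
- move=> alpha al meets; split; first exact/(JE _ al).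
  have [m [mL st mr _]] := line_data Hf' ar1 Hrho0 rmin Hr1 Hrd al.
  exists m; split=> //.
  exact/(line_orderE Hf' ar1 Hrho0 rmin Hr1 Hrd ptsP _ al st).
- move=> alpha; split=> [J|V].
    by have [al _] := J; apply/(VE _ al)/(JE _ al).
  by have [al _] := V; apply/(JE _ al)/(VE _ al).
exists nu, pts; split=> // alpha; split=> [V|[al H]].
  have [al _] := V; split=> //.
  exact/(supp_on_line ptsP al)/(VE _ al).
exact/(VE _ al)/(supp_on_line ptsP al).
Qed.
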